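(* Let $C \subseteq \mathbb{R}^n$ be a $(0,r,R)$-centered, $\gamma$-symmetric convex body (given by an oracle), $L \subseteq \mathbb{R}^n$ an $n$-dimensional lattice given by a basis, and $M \subseteq \mathbb{R}^n$ a linear subspace with $\dim(M) \leq n-1$. For $0 < \varepsilon \leq \frac{1}{2}$, a lattice vector $y \in L \setminus M$ with $\|y\|_C \leq (1+\varepsilon)\lambda(C,L,M)$ can be computed by a randomized algorithm in time $O\big(\frac{1}{\gamma^4\varepsilon^2}\big)^n$ with probability at least $1-2^{-n}$. Furthermore, if $\lambda(C,L,M) \leq t\,\lambda_1(C,L)$ for some $t \geq 2$, then a vector $y \in L \setminus M$ with $\|y\|_C = \lambda(C,L,M)$ can be computed in time $O\big(\frac{t^2}{\gamma^4}\big)^n$ with probability at least $1-2^{-n}$.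
   Context: A convex body is a full-dimensional compact convex set; $C$ is $(0,r,R)$-centered if $rB_2^n \subseteq C \subseteq RB_2^n$ ($B_2^n$ the Euclidean unit ball). The gauge (semi-norm) of $C$ is $\|x\|_C = \inf\{s \geq 0 : x \in sC\}$; it satisfies all norm axioms except possibly symmetry. $C$ is $\gamma$-symmetric ($0<\gamma\le 1$) if $\mathrm{vol}(C \cap -C) \geq \gamma^n \mathrm{vol}(C)$. For an $n$-dimensional lattice $L$ (integer combinations of a basis of $\mathbb{R}^n$), $\lambda_1(C,L) = \inf_{z \in L\setminus\{0\}} \|z\|_C$ and $\lambda(C,L,M) = \inf_{x \in L \setminus M}\|x\|_C$. Complexity is measured in oracle calls and arithmetic operations, with polynomial factors in $n$, $\log R$, $\log r$, $1/\varepsilon$ and the bit size of the basis omitted. *)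

(* Defs.v *)
From HB Require Import structures.
From mathcomp Require Import all_boot all_order all_algebra.
From mathcomp Require Import all_classical all_reals all_analysis.

Set Implicit Arguments.
Unset Strict Implicit.
Unset Printing Implicit Defensive.

Import Order.TTheory GRing.Theory Num.Theory.
Import numFieldNormedType.Exports.

Local Open Scope classical_set_scope.
Local Open Scope ring_scope.

Section Geometry.
Context {R : realType} {n : nat}.
Implicit Types (C L M : set 'rV[R]_n) (x : 'rV[R]_n).

(* The norm the library puts on 'rV[R]_n is the sup norm, hence the explicit
   Euclidean ball. *)
Definition eball (r : R) : set 'rV[R]_n :=
  [set x | Num.sqrt (\sum_i x 0 i ^+ 2) <= r].

(* Some n.+1 points of C are affinely independent. *)
Definition full_dimensional C :=
  exists (p0 : 'rV[R]_n) (P : 'M[R]_n),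
    [/\ C p0, forall i, C (row i P) & row_free (\matrix_i (row i P - p0))].

Definition convex_body C :=
  [/\ convex_set (C : set (convex_lmodType 'rV[R]_n)), compact C
    & full_dimensional C].

Definition centered (r rho : R) C :=
  [/\ 0 < r, eball r `<=` C & C `<=` eball rho].

(* Lebesgue outer measure (infimum over countable covers by closed boxes); it
   is the n-dimensional volume on convex bodies, which are measurable. *)
Definition vol (A : set 'rV[R]_n) : \bar R :=
  ereal_inf [set v | exists a b : nat -> 'rV[R]_n,
    [/\ forall k i, a k 0 i <= b k 0 i,
        A `<=` \bigcup_k [set x | forall i, a k 0 i <= x 0 i <= b k 0 i]
      & v = (\sum_(0 <= k <oo) (\prod_i (b k 0 i - a k 0 i))%:E)%E]].

Definition gamma_symmetric (gamma : R) C :=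
  0 < gamma <= 1 /\
  ((gamma ^+ n)%:E * vol C <= vol (C `&` (-%R @` C)))%E.

Definition gauge C x : R :=
  inf [set s | 0 <= s /\ ( *:%R s @` C) x].

Definition lattice (B : 'M[R]_n) : set 'rV[R]_n :=
  [set map_mx intr z *m B | z in [set: 'rV[int]_n]].

Definition rowspace (M : 'M[R]_n) : set 'rV[R]_n := [set x | (x <= M)%MS].

Definition lambda C L M : R := inf (gauge C @` (L `\` M)).

Definition lambda1 C L : R := lambda C L [set 0].

Definition membership_oracle C x : R := (x \in C)%:R.

End Geometry.

(* Randomized oracle machines: while programs over a real RAM.  There are four
   stores, all indexed by nat: index registers (ireg) and real registers (rreg),
   addressed by literals, and an index memory (imem) and a real memory (rmem),
   addressed through index registers.  Literals are natural numbers, so a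
   program cannot contain real advice.  The only randomness is fair coin
   flips.  Subtraction of indices is truncated and x / 0 = 0. *)
Inductive instr :=
| ISet of nat & nat
| IAdd of nat & nat & nat
| ISub of nat & nat & nat
| ILoad of nat & nat
| IStore of nat & nat
| RSet of nat & nat
| RAdd of nat & nat & nat
| RSub of nat & nat & nat
| RMul of nat & nat & nat
| RDiv of nat & nat & nat
| RLoad of nat & nat
| RStore of nat & nat
| Flip of nat
| Query of nat & nat.

Inductive test :=
| ILt of nat & nat
| RLt of nat & nat.

Inductive cmd :=
| Skip
| Do of instr
| Seq of cmd & cmd
| If of test & cmd & cmd
| While of test & cmd.

Record state (R : Type) := State {
  ireg : nat -> nat; imem : nat -> nat;
  rreg : nat -> R;   rmem : nat -> R;
  tape : seq bool    (* outcomes of the coin flips still to come *) }.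

Definition upd {T : Type} (f : nat -> T) (i : nat) (v : T) : nat -> T :=
  fun j => if j == i then v else f j.

Section Semantics.
Context {R : realType} {n : nat}.
Variable oracle : 'rV[R]_n -> R.
Implicit Types (s : state R).

Definition set_ireg s i v := State (upd (ireg s) i v) (imem s) (rreg s) (rmem s) (tape s).
Definition set_imem s i v := State (ireg s) (upd (imem s) i v) (rreg s) (rmem s) (tape s).
Definition set_rreg s i v := State (ireg s) (imem s) (upd (rreg s) i v) (rmem s) (tape s).
Definition set_rmem s i v := State (ireg s) (imem s) (rreg s) (upd (rmem s) i v) (tape s).

Definition rvec s (a : nat) : 'rV[R]_n := \row_(k < n) rmem s (a + k)%N.

Definition do_instr (c : instr) s : option (state R) :=
  match c with
  | ISet i c => Some (set_ireg s i c)
  | IAdd i j k => Some (set_ireg s i (ireg s j + ireg s k)%N)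
  | ISub i j k => Some (set_ireg s i (ireg s j - ireg s k)%N)
  | ILoad i j => Some (set_ireg s i (imem s (ireg s j)))
  | IStore i j => Some (set_imem s (ireg s i) (ireg s j))
  | RSet i c => Some (set_rreg s i c%:R)
  | RAdd i j k => Some (set_rreg s i (rreg s j + rreg s k))
  | RSub i j k => Some (set_rreg s i (rreg s j - rreg s k))
  | RMul i j k => Some (set_rreg s i (rreg s j * rreg s k))
  | RDiv i j k => Some (set_rreg s i (rreg s j / rreg s k))
  | RLoad i j => Some (set_rreg s i (rmem s (ireg s j)))
  | RStore i j => Some (set_rmem s (ireg s i) (rreg s j))
  | Flip i =>
      if tape s is b :: w then
        Some (State (upd (ireg s) i (nat_of_bool b)) (imem s) (rreg s) (rmem s) w)
      else None
  | Query i j => Some (set_rreg s i (oracle (rvec s (ireg s j))))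
  end.

Definition do_test (b : test) s : bool :=
  match b with
  | ILt i j => (ireg s i < ireg s j)%N
  | RLt i j => rreg s i < rreg s j
  end.

(* [exec c s t s'] : started in s, c halts in s' after t unit-cost steps; each
   arithmetic operation, memory access, coin flip, oracle call and test counts
   one. *)
Inductive exec : cmd -> state R -> nat -> state R -> Prop :=
| ESkip s : exec Skip s 0 s
| EDo c s s' : do_instr c s = Some s' -> exec (Do c) s 1 s'
| ESeq c1 c2 s1 t1 s2 t2 s3 :
    exec c1 s1 t1 s2 -> exec c2 s2 t2 s3 -> exec (Seq c1 c2) s1 (t1 + t2) s3
| EIf b c1 c2 s t s' :
    exec (if do_test b s then c1 else c2) s t s' -> exec (If b c1 c2) s t.+1 s'
| EWhileF b c s : ~~ do_test b s -> exec (While b c) s 1 s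
| EWhileT b c s1 t1 s2 t2 s3 :
    do_test b s1 -> exec c s1 t1 s2 -> exec (While b c) s2 t2 s3 ->
    exec (While b c) s1 (t1 + t2).+1 s3.

(* The vector returned is read off the first n cells of the real memory.  With
   a tape of T bits, a run of at most T steps cannot run out of coins, so the
   probability is over uniform tapes of length T. *)
Definition computes_whp (c : cmd) (init : seq bool -> state R) (T : nat) (p : R)
    (good : set 'rV[R]_n) : Prop :=
  (forall w : T.-tuple bool,
     exists t s', (t <= T)%N /\ exec c (init w) t s') /\
  p <= #|[pred w : T.-tuple bool |
           `[< exists t s', exec c (init w) t s' /\ good (rvec s' 0) >]]|%:R
       / 2 ^+ T.

End Semantics.

Definition entries (T : Type) (n : nat) (A : 'M[T]_n) : seq T :=
  [seq A i j | i <- enum 'I_n, j <- enum 'I_n].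

(* Initially: ireg 0 is n; rreg 0, 1, ... are the scalar parameters; rmem holds
   the numerators of B, the denominators of B and the matrix M, each row by row;
   everything else is 0. *)
Definition input {R : realType} (n : nat) (params : seq R) (B : 'M[rat]_n)
    (M : 'M[R]_n) (w : seq bool) : state R :=
  State (upd (fun=> 0%N) 0 n) (fun=> 0%N) (nth 0 params)
    (nth 0 ([seq (numq q)%:~R | q <- entries B] ++
            [seq (denq q)%:~R | q <- entries B] ++ entries M)) w.

Definition bitlen (z : int) : nat := (trunc_log 2 `|z|).+1.

(* Per entry: numerator, denominator and a sign bit. *)
Definition bitsize (n : nat) (B : 'M[rat]_n) : nat :=
  \sum_i \sum_j (bitlen (numq (B i j)) + bitlen (denq (B i j)) + 1).

(* Main.v *)
Require Import Defs.
From mathcomp Require Import all_boot all_order all_algebra fingroup perm.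
From mathcomp Require Import all_classical all_reals all_analysis.
From mathcomp Require Import zify ring lra.
Set Implicit Arguments.
Unset Strict Implicit.
Unset Printing Implicit Defensive.
Import Order.TTheory GRing.Theory Num.Theory.
Import numFieldNormedType.Exports.
Local Open Scope classical_set_scope.
Local Open Scope ring_scope.

(** Write q(z) for the gauge of the lattice point with integer coordinate vector z, and lambda for
    the infimum of q outside M. Both programs are deterministic searches, so every coin tape
    succeeds. At each length scale they build a list of lattice vectors that is a fine net of all
    lattice vectors of that length, and they output the best listed vector outside M.

    A net suffices. Let z outside M satisfy q(z) < 2 lambda, and let x be listed with q(z-x) and
    q(x-z) at most (e/2) q(z). In the approximate case e = eps < 1, so q(z-x) < lambda. Hence z-x
    lies in M, x lies outside M, and q(x) <= (1+e/2) q(z). Membership queries evaluate the gauge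
    only up to a factor 1+e/4, and (1+e/4)(1+e/2) <= 1+e. In the exact case e = 1/t gives q(z-x) <
    lambda/t <= lambda_1, so z = x: every nearly shortest vector is itself listed. See
    [examined_close], [search_approx], [search_exact].

    Separated lists are short. Points with q <= b that are s-separated in max(q(w-w'), q(w'-w))
    carry disjoint translates of a small multiple of the core C [&] -C, all inside a multiple of C.
    The core has volume at least gamma^n vol(C), so there are at most 3 (m/gamma)^n points, with m
    about 8(b+s)/s ([packing]). Volume is an infimum over box covers, so the comparison is made by
    counting points of a fine grid.

    Building the nets. The norm max(q(z), v |z|_oo) is a multiple of the sup norm of the coordinates
    when v >= U, where explicit nets exist ([base_covers]), and equals q when v <= vend. The
    parameter v descends by factors 3/4. If the error of a net W1 falls within the range of a net
    W0, then the sumset W1 + W0 is a finer net. Sieving it greedily to separated points keeps its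
    size under the packing bound ([prune_covers], [level_covers]). At the last v the same operation
    halves the error until it is at most e/4 of the scale ([refine_covers]). Cramer's rule bounds
    U/vend through the bit size ([coord_basis_le]), so the numbers of scales, descents and trial
    gauge values are polynomial.

    Cost. A pruning compares every sum of two list elements with the current output list. Coarse
    lists have (c/gamma)^n elements and fine ones (c/(e gamma))^n. The dominant product is fine
    times coarse times fine, which is within the claimed (c/(gamma^4 e^2))^n up to a polynomial
    factor ([caps_product], [total_time_bound]). Membership in M is decided exactly by Gram-Schmidt
    orthogonalization. *)

(** * The gauge of a centered convex body *)

Section Gauge.
Context {R : realType} {n : nat} (C : set 'rV[R]_n) (r rho : R).
Hypothesis Cconv : convex_set (C : set (convex_lmodType 'rV[R]_n)).
Hypothesis Ccent : centered r rho C.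
Implicit Types (x y : 'rV[R]_n) (s t : R).
Local Notation p := (gauge C).

Lemma body_convex x y t : C x -> C y -> 0 <= t <= 1 -> C (t *: x + (1 - t) *: y).
Proof.
move=> Cx Cy t01; have := @Cconv x y (Itv01 (andP t01).1 (andP t01).2).
by move=> /(_ (mem_set Cx) (mem_set Cy)) /set_mem.
Qed.

Lemma body0 : C 0.
Proof.
case: Ccent => r0 rC _; apply: rC; rewrite /eball /=.
rewrite big1 ?sqrtr0 ?ltW// => i _; by rewrite mxE expr0n.
Qed.

Lemma body_star x t : C x -> 0 <= t <= 1 -> C (t *: x).
Proof. by move=> Cx t01; have := body_convex Cx body0 t01; rewrite scaler0 addr0. Qed.

Lemma gauge_has_inf x : has_inf [set s | 0 <= s /\ ( *:%R s @` C) x].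
Proof.
case: Ccent => r0 rC _; split; last by exists 0 => s [].
set N := Num.sqrt (\sum_i x 0 i ^+ 2).
have N0 : 0 <= N by rewrite sqrtr_ge0.
have s0 : 0 < (N + 1) / r by rewrite divr_gt0// ltr_wpDl.
exists ((N + 1) / r); split; first exact: ltW.
exists (((N + 1) / r)^-1 *: x); last by rewrite scalerA divff ?scale1r// gt_eqF.
apply: rC; rewrite /eball /=.
under eq_bigr do rewrite mxE exprMn.
rewrite -mulr_sumr sqrtrM ?sqr_ge0// sqrtr_sqr ger0_norm ?invr_ge0 ?(ltW s0)// -/N.
by rewrite invf_div mulrAC ler_pdivrMr ?ltr_wpDl// ler_wpM2l ?(ltW r0)// lerDl ler01.
Qed.

Lemma gauge_ge0 x : 0 <= p x.
Proof. by apply: lb_le_inf; [case: (gauge_has_inf x) | move=> s []]. Qed.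

Lemma gauge_scale_le x s : C x -> 0 <= s -> p (s *: x) <= s.
Proof.
move=> Cx s0; apply: ge_inf; last by split => //; exists x.
by case: (gauge_has_inf (s *: x)).
Qed.

(** The strict inequality gives an actual scale below [s] that contains x, and star-shapedness about
    0 raises it to [s]. *)
Lemma gauge_lt_mem x s : p x < s -> C (s^-1 *: x).
Proof.
move=> ps; have s0 : 0 < s by apply: le_lt_trans ps; exact: gauge_ge0.
have [e /= [e0 [c Cc <-]] es] : exists2 e, [set s | 0 <= s /\ ( *:%R s @` C) x] e & e < s.
  by apply: inf_lt => //; case: (gauge_has_inf x).
rewrite scalerA; apply: body_star => //.
by rewrite mulr_ge0 ?invr_ge0 ?(ltW s0)//= mulrC ler_pdivrMr// mul1r ltW.
Qed.

Lemma mem_gauge_le x s : 0 < s -> C (s^-1 *: x) -> p x <= s.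
Proof.
move=> s0 Cx; have := gauge_scale_le Cx (ltW s0).
by rewrite scalerA divff ?scale1r// gt_eqF.
Qed.

Lemma gauge0 : p 0 = 0.
Proof.
apply/eqP; rewrite eq_le gauge_ge0 andbT.
by have := gauge_scale_le body0 (lexx 0); rewrite scale0r.
Qed.

Lemma gaugeD x y : p (x + y) <= p x + p y.
Proof.
apply/ler_addgt0Pr => e e0.
have ps z : p z < p z + e / 2 by rewrite ltrDl divr_gt0.
have gs z : 0 < p z + e / 2 by apply: le_lt_trans (ps z); exact: gauge_ge0.
have -> : p x + p y + e = (p x + e / 2) + (p y + e / 2) by field.
move: (gs x) (gs y) (gauge_lt_mem (ps x)) (gauge_lt_mem (ps y)).
set a := _ + _; set b := p y + _ => a0 b0 Ca Cb.
have ab : 0 < a + b by rewrite addr_gt0.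
apply: mem_gauge_le => //.
(* The scaled sum is a convex combination of the two scaled points, with weights a/(a+b) and
   b/(a+b). *)
have -> : (a + b)^-1 *: (x + y) =
   (a / (a + b)) *: (a^-1 *: x) + (1 - a / (a + b)) *: (b^-1 *: y).
  rewrite !scalerA scalerDr; congr (_ *: _ + _ *: _); field; first by rewrite !gt_eqF.
  by rewrite !gt_eqF.
apply: body_convex => //.
by rewrite divr_ge0 ?(ltW a0) ?(ltW ab)//= ler_pdivrMr// mul1r lerDl ltW.
Qed.

Lemma gaugeZ s x : 0 <= s -> p (s *: x) = s * p x.
Proof.
have H t y : 0 < t -> p (t *: y) <= t * p y.
  move=> t0; rewrite -ler_pdivrMl//; apply/ler_addgt0Pr => e e0.
  rewrite ler_pdivrMl//.
  have ps : p y < p y + e by rewrite ltrDl.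
  have gs : 0 < p y + e by apply: le_lt_trans ps; exact: gauge_ge0.
  apply: mem_gauge_le; first by rewrite mulr_gt0.
  rewrite scalerA mulrC invfM mulrA divff ?gt_eqF// mul1r.
  exact: gauge_lt_mem.
rewrite le_eqVlt => /predU1P[<-|s0]; first by rewrite scale0r mul0r gauge0.
apply/eqP; rewrite eq_le H//= -ler_pdivlMl//.
have := H s^-1 (s *: x); rewrite invr_gt0 scalerA mulVf ?gt_eqF// scale1r; exact.
Qed.

Lemma coord_le_gauge x i : `|x 0 i| <= rho * p x.
Proof.
case: Ccent => r0 rC Crho.
have rho0 : 0 <= rho.
  by have := Crho _ body0; rewrite /eball /=; apply: le_trans; exact: sqrtr_ge0.
suff H e : 0 < e -> `|x 0 i| <= rho * (p x + e).
  have [z|rhon] := eqVneq rho 0.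
    by have := H 1 ltr01; rewrite z !mul0r.
  have rho1 : 0 < rho by rewrite lt_neqAle eq_sym rhon.
  apply/ler_addgt0Pr => e e0; apply: le_trans (H (e / rho) _) _; first by rewrite divr_gt0.
  by rewrite mulrDr mulrCA divff// mulr1.
move=> e0; have ps : p x < p x + e by rewrite ltrDl.
have gs : 0 < p x + e by apply: le_lt_trans ps; exact: gauge_ge0.
have := Crho _ (gauge_lt_mem ps); rewrite /eball /= => Hn.
have : `|(p x + e)^-1 * x 0 i| <= rho.
  apply: le_trans Hn; rewrite -sqrtr_sqr ler_sqrt; last by apply: sumr_ge0 => j _; rewrite sqr_ge0.
  by rewrite (bigD1 i)//= mxE lerDl sumr_ge0// => j _; rewrite sqr_ge0.
by rewrite normrM ger0_norm ?invr_ge0 ?(ltW gs)// mulrC ler_pdivrMr.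
Qed.

Lemma gauge_le_l1 x : p x <= (\sum_i `|x 0 i|) / r.
Proof.
case: Ccent => r0 rC Crho.
set S := \sum_i _; have S0 : 0 <= S by exact: sumr_ge0.
apply/ler_addgt0Pr => e e0.
have gs : 0 < S / r + e by rewrite ltr_wpDl// divr_ge0 ?(ltW r0).
apply: mem_gauge_le => //; apply: rC; rewrite /eball /=.
under eq_bigr do rewrite mxE exprMn.
rewrite -mulr_sumr sqrtrM ?sqr_ge0// sqrtr_sqr ger0_norm ?invr_ge0 ?(ltW gs)//.
rewrite mulrC ler_pdivrMr//; apply: (@le_trans _ _ S); last first.
  by rewrite mulrDr mulrCA divff ?gt_eqF// mulr1 lerDl mulr_ge0 ?(ltW r0) ?(ltW e0).
rewrite -(ger0_norm S0) -sqrtr_sqr ler_sqrt ?sqr_ge0//.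
rewrite expr2 /S mulr_suml; apply: ler_sum => i _.
rewrite -real_normK ?num_real// expr2 ler_wpM2l//.
by rewrite (bigD1 i)//= lerDl sumr_ge0.
Qed.

Lemma radii_le : (0 < n)%N -> r <= rho.
Proof.
move=> n0; case: (Ccent) => r0 rC Crho.
pose x : 'rV[R]_n := \row_i (if i == Ordinal n0 then r else 0).
have xs : \sum_i x 0 i ^+ 2 = r ^+ 2.
  rewrite (bigD1 (Ordinal n0))//= mxE eqxx big1 ?addr0// => i /negbTE H.
  by rewrite mxE H expr0n.
have /Crho : C x by apply: rC; rewrite /eball /= xs sqrtr_sqr ger0_norm// ltW.
by rewrite /eball /= xs sqrtr_sqr ger0_norm// ltW.
Qed.

End Gauge.

(** * Counting grid points against box covers *)

Lemma prod_perturb (R : realFieldType) (I : Type) (s : seq I) (d : I -> R) (th : R) :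
  (forall i, 0 <= d i) -> 0 < th ->
  exists2 e0, 0 < e0 & forall e, 0 <= e <= e0 ->
    \prod_(i <- s) (d i + e) <= \prod_(i <- s) d i + th.
Proof.
move=> d0; elim: s th => [|j s IH] th th0.
  by exists 1 => // e _; rewrite !big_nil lerDl ltW.
set P := \prod_(i <- s) d i.
have P0 : 0 <= P by exact: prodr_ge0.
have dj1 : 0 < d j + 1 by rewrite ltr_wpDl.
have P1 : 0 < P + 1 by rewrite ltr_wpDl.
have [|e1 e10 H] := IH (th / 2 / (d j + 1)); first by rewrite !divr_gt0.
exists (Num.min e1 (Num.min 1 (th / 2 / (P + 1)))).
  by rewrite !lt_min e10 ltr01 !divr_gt0.
move=> e; rewrite !le_min => /andP[e0 /and3P[ee1 ele1 eth]].
rewrite !big_cons -/P.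
have {}H := H e; rewrite e0 ee1 in H; have {H} := H isT; rewrite -/P.
set Pe := \prod_(i <- s) (d i + e) => HP.
apply: (@le_trans _ _ ((d j + e) * (P + th / 2 / (d j + 1)))).
  by rewrite ler_wpM2l ?addr_ge0.
have E1 : e * P <= th / 2.
  apply: (@le_trans _ _ (e * (P + 1))); first by rewrite ler_wpM2l// lerDl.
  by rewrite -ler_pdivlMr.
have E2 : (d j + e) * (th / 2 / (d j + 1)) <= th / 2.
  rewrite mulrA ler_pdivrMr// mulrC ler_wpM2l ?lerD2l//; lra.
lra.
Qed.

Section Grid.
Context {n : nat}.

Definition gridpts (N : nat) : seq 'rV[int]_n :=
  [seq \row_i ((f i)%:Z - N%:Z) | f : {ffun 'I_n -> 'I_(N + N).+1}].

Lemma gridpts_uniq N : uniq (gridpts N).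
Proof.
rewrite map_inj_uniq ?enum_uniq// => f g /rowP fg.
by apply/ffunP => i; have := fg i; rewrite !mxE => /addIr[] /val_inj.
Qed.

Lemma mem_gridpts N (g : 'rV[int]_n) :
  (forall i, `|g 0 i| <= N%:Z) -> g \in gridpts N.
Proof.
move=> H; apply/mapP; exists [ffun i => inord (absz (g 0 i + N%:Z)%R)]; first by rewrite mem_enum.
apply/rowP => i; rewrite mxE ffunE; have := H i; rewrite ler_norml; move: (g 0 i) => x /andP[? ?]; rewrite inordK; lia.
Qed.

(** An integer point of the box is determined by its offsets from the rounded-up lower bounds, and
    each offset has at most hi - lo + 1 values. *)
Lemma box_count (R : realType) (gs : seq 'rV[int]_n) (lo hi : 'I_n -> R) :
  uniq gs -> (forall i, lo i <= hi i) ->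
  (forall g i, g \in gs -> lo i <= (g 0 i)%:~R <= hi i) ->
  (size gs)%:R <= \prod_i (hi i - lo i + 1).
Proof.
move=> ug lohi H; case: gs => [|g0 gs] in ug H *.
  by apply: prodr_ge0 => i _; rewrite addr_ge0// subr_ge0.
set gs' := g0 :: gs in ug H *.
pose c i := Num.ceil (lo i); pose d i := Num.floor (hi i).
have Hcd g i : g \in gs' -> c i <= g 0 i <= d i.
  by move=> gg; have := H g i gg; rewrite ceil_le_int floor_ge_int.
pose m i := absz (d i - c i).
pose phi (g : 'rV[int]_n) : {dffun forall i, 'I_(m i).+1} :=
  finfun (fun i => inord (absz (g 0 i - c i)%R)).
have phi_inj : {in gs' &, injective phi}.
  move=> g g' gg gg' /ffunP e; apply/rowP => i; have := e i; rewrite !ffunE.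
  move=> /(congr1 val); have := Hcd _ i gg; have := Hcd _ i gg'.
  rewrite /m /=; move: (g 0 i) (g' 0 i) (c i) (d i) => x y a b /andP[? ?] /andP[? ?].
  by rewrite !inordK; lia.
have : (size gs' <= #|{dffun forall i, 'I_(m i).+1}|)%N.
  rewrite -(size_map phi); have/card_uniqP <- : uniq (map phi gs') by rewrite map_inj_in_uniq.
  exact: max_card.
rewrite -(ler_nat R) => /le_trans; apply.
rewrite card_dep_ffun foldrE big_map big_enum /= natr_prod; apply: ler_prod => i _.
rewrite ler0n card_ord /=.
have /andP[H1 H2] := Hcd g0 i (mem_head _ _).
rewrite -addn1 natrD lerD2r.
have -> : (m i)%:R = (d i)%:~R - (c i)%:~R :> R.
  by rewrite /m natr_absz -intrB ger0_norm// subr_ge0 (le_trans H1 H2).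
by rewrite lerB// ?floor_le ?ceil_ge.
Qed.

End Grid.


Section CoverCount.
Context {R : realType} {n : nat}.

Lemma min_pos (e : nat -> R) N : (forall k, 0 < e k) ->
  exists2 h, 0 < h & forall k, (k < N)%N -> h <= e k.
Proof.
move=> e0; elim: N => [|N [h h0 H]]; first by exists 1.
exists (Num.min h (e N)); first by rewrite lt_min h0 e0.
move=> k; rewrite ltnS leq_eqVlt => /predU1P[->|/H kh]; first by rewrite ge_min lexx orbT.
by rewrite ge_min kh.
Qed.

Lemma size_le_cover (T : Type) (gs : seq T) N (P : nat -> pred T) :
  all (fun g => has (P^~ g) (iota 0 N)) gs ->
  (size gs <= \sum_(k < N) count (P k) gs)%N.
Proof.
elim: gs => //= g gs IH /andP[/hasP[k kN Pk] /IH H].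
rewrite big_split /= -add1n leq_add//.
rewrite mem_iota /= add0n in kN.
by rewrite (bigD1 (Ordinal kN))//= Pk leq_addr.
Qed.

Lemma geom_sum_le (th : R) N : 0 <= th -> \sum_(k < N) th / 2 ^+ k.+1 <= th.
Proof.
move=> th0; suff -> : \sum_(k < N) th / 2 ^+ k.+1 = th - th / 2 ^+ N.
  by rewrite gerBl divr_ge0// exprn_ge0.
elim: N => [|N IH]; first by rewrite big_ord0 expr0 divr1 subrr.
rewrite big_ord_recr /= IH exprS; field.
by rewrite expf_neq0.
Qed.

Lemma open_box (a b : 'I_n -> R) : open [set x : 'rV[R]_n | forall i, a i < x 0 i < b i].
Proof.
have -> : [set x : 'rV[R]_n | forall i, a i < x 0 i < b i] =
    [set x : 'rV[R]_n | forall i, ((fun x : 'rV[R]_n => x 0 i) @^-1` `]a i, b i[) x].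
  by apply/seteqP; split => x /= H i; have := H i; rewrite /= in_itv.
rewrite openE => x /= H.
have F : nbhs x [set y : 'rV[R]_n | forall i, y 0 i \in `]a i, b i[].
  apply: (@filter_forall _ _ (fun i => [set y : 'rV[R]_n | y 0 i \in `]a i, b i[]) (nbhs x)).
  move=> i; have := H i; rewrite in_itv /= => Hi.
  have oi : nbhs (x 0 i) `]a i, b i[%classic.
    by apply: open_nbhs_nbhs; split; [exact: interval_open | rewrite /= in_itv].
  exact: (@coord_continuous R 1 n 0 i x _ oi).
exact: F.
Qed.

(** The substitute for comparing volumes. Slightly enlarged open boxes still cover C, so by
    compactness finitely many do. Each of them contains at most (volume + small error) / h^n grid
    points once h is small, and the errors th / 2^(k+1) sum to at most th. *)
Lemma cover_count (C : set 'rV[R]_n) (a b : nat -> 'rV[R]_n) (V th : R) :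
  compact C -> (forall k i, a k 0 i <= b k 0 i) ->
  C `<=` \bigcup_k [set x | forall i, a k 0 i <= x 0 i <= b k 0 i] ->
  (\sum_(0 <= k <oo) (\prod_i (b k 0 i - a k 0 i))%:E <= V%:E)%E -> 0 < th ->
  exists2 h0, 0 < h0 & forall h, 0 < h <= h0 -> forall gs : seq 'rV[int]_n,
    uniq gs -> (forall g, g \in gs -> C (h *: map_mx intr g)) ->
    (size gs)%:R * h ^+ n <= V + th.
Proof.
move=> Ccpt ab Ccov sV th0.
have d0 k i : 0 <= b k 0 i - a k 0 i by rewrite subr_ge0.
have /choice[e He] k : exists e, 0 < e /\ forall h, 0 <= h <= e ->
    \prod_i (b k 0 i - a k 0 i + h) <= \prod_i (b k 0 i - a k 0 i) + th / 2 ^+ k.+1.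
  have [|e e0 H] := prod_perturb (index_enum 'I_n) (d0 k) (th := th / 2 ^+ k.+1).
    by rewrite divr_gt0// exprn_gt0.
  by exists e; split.
(* The allowance e k is split in three: one third enlarges each end of every side, and the last
   third absorbs the grid spacing h, which is the +1 of [box_count] scaled by h. *)
pose box k : set 'rV[R]_n :=
  [set x : 'rV[R]_n | forall i, a k 0 i - e k / 3 < x 0 i < b k 0 i + e k / 3].
have e3 k : 0 < e k / 3 by rewrite divr_gt0//; case: (He k).
have Cc : cover_compact C by rewrite -compact_cover.
have [||D _ CD] := Cc nat setT box.
- by move=> k _; exact: open_box.
- move=> x /Ccov[k _ /= Hx]; exists k => // i; have /andP[? ?] := Hx i; have := e3 k.
  by move=> ?; apply/andP; split; lra.
pose N := (\max_(k <- finmap.enum_fset D) k).+1.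
have [h0 h00 Hh0] := min_pos N e3.
exists h0 => // h /andP[h_gt0 hh0] gs ugs gsC.
pose P k (g : 'rV[int]_n) := `[< box k (h *: map_mx intr g) >].
have Hsize : (size gs <= \sum_(k < N) count (P k) gs)%N.
  apply: size_le_cover; apply/allP => g /gsC /CD[k kD kg]; apply/hasP.
  exists k; last exact/asboolP.
  by rewrite mem_iota /= add0n ltnS /N; apply: leq_bigmax_seq.
apply: (@le_trans _ _ (\sum_(k < N) (count (P k) gs)%:R * h ^+ n)).
  by rewrite -mulr_suml -natr_sum ler_wpM2r ?ler_nat// exprn_ge0// ltW.
apply: (@le_trans _ _ (\sum_(k < N) (\prod_i (b k 0 i - a k 0 i) + th / 2 ^+ k.+1))).
  apply: ler_sum => k _.
  have hk := le_trans hh0 (Hh0 k (ltn_ord k)).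
  apply: (@le_trans _ _ (\prod_i (b k 0 i - a k 0 i + e k))); last first.
    by case: (He k) => e0 H; apply: H; rewrite lexx ltW.
  apply: (@le_trans _ _ (\prod_(i < n)
    (((b k 0 i + e k / 3) / h - (a k 0 i - e k / 3) / h + 1) * h))).
    rewrite big_split /= prodr_const card_ord ler_wpM2r ?exprn_ge0 ?(ltW h_gt0)//.
    rewrite -size_filter; apply: box_count; first exact: filter_uniq.
      move=> i; rewrite ler_pM2r ?invr_gt0//; have := ab k i; have := e3 k; lra.
    move=> g i; rewrite mem_filter => /andP[/asboolP /(_ i) + _].
    by rewrite !mxE ler_pdivrMr// ler_pdivlMr// ![_%:~R * h]mulrC => /andP[/ltW -> /ltW ->].
  apply: ler_prod => i _; have := ab k i; have := e3 k => ek abk.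
  have -> : ((b k 0 i + e k / 3) / h - (a k 0 i - e k / 3) / h + 1) * h =
     b k 0 i - a k 0 i + e k / 3 + e k / 3 + h by field; rewrite gt_eqF.
  by apply/andP; split; lra.
rewrite big_split /= lerD ?geom_sum_le ?(ltW th0)//.
rewrite -lee_fin; apply: le_trans sV; rewrite -sumEFin.
rewrite -(big_mkord xpredT (fun k => (\prod_i (b k 0 i - a k 0 i))%:E)).
apply: nneseries_lim_ge => k _ _; rewrite lee_fin; exact: prodr_ge0.
Qed.
End CoverCount.

(** * The packing bound for gamma-symmetric bodies *)

Section Packing.
Context {R : realType} {n : nat} (C : set 'rV[R]_n) (r rho : R).
Hypothesis n_gt0 : (0 < n)%N.
Hypothesis Cconv : convex_set (C : set (convex_lmodType 'rV[R]_n)).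
Hypothesis Ccent : centered r rho C.
Hypothesis Ccpt : compact C.
Implicit Types (x y : 'rV[R]_n) (g : 'rV[int]_n).
Local Notation p := (gauge C).
Local Notation K := (C `&` (-%R @` C)).
Local Notation toR g := (map_mx intr g : 'rV[R]_n).

Lemma r_gt0 : 0 < r. Proof. by case: Ccent. Qed.

Lemma gauge_small (h : R) y : 0 <= h -> (forall i, `|y 0 i| <= h) -> p y <= n%:R * h / r.
Proof.
move=> h0 H; apply: le_trans (gauge_le_l1 Ccent y) _.
rewrite ler_pM2r ?invr_gt0 ?r_gt0//.
apply: (@le_trans _ _ (\sum_(i < n) h)); first exact: ler_sum.
by rewrite sumr_const card_ord -[X in X <= _]mulr_natl.
Qed.

Lemma gaugeZV x (s : R) : 0 < s -> p (s^-1 *: x) = p x / s.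
Proof. by move=> s0; rewrite (gaugeZ Cconv Ccent) ?invr_ge0 ?(ltW s0)// mulrC. Qed.

Lemma mem_gauge_le1 x : C x -> p x <= 1.
Proof. by move=> Cx; have := gauge_scale_le Ccent Cx ler01; rewrite scale1r. Qed.

(** The grid points of the core C [&] -C scaled by s: since the gauge is not symmetric, both signs
    are tested. *)
Definition core_grid (h s : R) (N : nat) : seq 'rV[int]_n :=
  [seq g <- gridpts N | (p (h *: toR g) <= s) && (p (- (h *: toR g)) <= s)].

(** Cut space into cubes of side m h and round x in K down to the corner m h g. Then h g differs
    from x / m by at most h in each coordinate, which costs at most 1/m in the gauge of either sign.
    So the gauge of h g is at most 2/m in both directions, g lies in the core grid, and the cubes
    attached to the core grid cover K. *)
Lemma vol_core_le (h : R) (m N : nat) : (0 < m)%N -> 0 < h -> n%:R * h * m%:R <= r ->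
  rho / (m%:R * h) + 1 <= N%:R ->
  (vol K <= ((m%:R * h) ^+ n * (size (core_grid h (2 / m%:R) N))%:R)%:E)%E.
Proof.
move=> m0 h0 hr hN; set gs := core_grid _ _ _.
have mR0 : 0 < m%:R :> R by rewrite ltr0n.
have mh0 : 0 < m%:R * h by rewrite mulr_gt0.
(* A cover is an infinite sequence of boxes; past the end of the list both corners are 0, and such a
   box has volume 0 because n > 0. *)
pose a k : 'rV[R]_n := if (k < size gs)%N then (m%:R * h) *: toR (nth 0 gs k) else 0.
pose b k : 'rV[R]_n := if (k < size gs)%N then a k + const_mx (m%:R * h) else 0.
have prodab k : \prod_i (b k 0 i - a k 0 i) = if (k < size gs)%N then (m%:R * h) ^+ n else 0.
  rewrite /b /a; case: ltnP => _.
    under eq_bigr => i _ do rewrite !mxE addrAC subrr add0r.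
    by rewrite prodr_const card_ord.
  under eq_bigr => i _ do rewrite !mxE subrr.
  by rewrite prodr_const card_ord expr0n -[n]prednK.
have -> : ((m%:R * h) ^+ n * (size gs)%:R)%:E =
    (\sum_(0 <= k <oo) (\prod_i (b k 0 i - a k 0 i))%:E)%E.
  rewrite (@nneseries_split _ _ 0 (size gs)); last first.
    move=> k _; rewrite prodab lee_fin; case: ifP => // _.
    by rewrite exprn_ge0// ltW.
  rewrite [X in (_ + X)%E]eseries0 ?adde0; last first.
    by move=> k; rewrite add0n prodab => /leq_gtF ->.
  rewrite add0n big_mkord sumEFin; congr (_%:E).
  under eq_bigr => k _ do rewrite prodab ltn_ord.
  by rewrite sumr_const card_ord mulr_natr.
apply: ereal_inf_lbound; exists a, b; split => //.
- move=> k i; rewrite /b; case: ltnP => H; last by rewrite /a ltnNge H.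
  by rewrite !mxE lerDl ltW.
- move=> x [Cx [c Cc cx]].
  have Cmx : C (- x) by rewrite -cx opprK.
  pose g : 'rV[int]_n := \row_i Num.floor (x 0 i / (m%:R * h)).
  pose y := m%:R^-1 *: x - h *: toR g.
  have xg i : (g 0 i)%:~R * (m%:R * h) <= x 0 i < ((g 0 i)%:~R + 1) * (m%:R * h).
    rewrite mxE -ler_pdivlMr// -ltr_pdivrMr//.
    by have := floor_itv (x 0 i / (m%:R * h)); rewrite intrD.
  have yi i : 0 <= y 0 i <= h.
    have -> : y 0 i = m%:R^-1 * x 0 i - h * (g 0 i)%:~R by rewrite /y !mxE.
    have := xg i => /andP[].
    have -> : m%:R^-1 * x 0 i = x 0 i / m%:R by rewrite mulrC.
    rewrite [m%:R * h]mulrC !mulrA -ler_pdivlMr// -ltr_pdivrMr//.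
    by rewrite [_ * h]mulrC => ? ?; apply/andP; split; nra.
  have yh i : `|y 0 i| <= h by have /andP[? ?] := yi i; rewrite ger0_norm.
  have yh' i : `|(- y) 0 i| <= h by rewrite mxE normrN.
  have nhr : n%:R * h / r <= 1 / m%:R.
    by rewrite ler_pdivrMr ?r_gt0// mulrAC ler_pdivlMr// mul1r.
  have E : h *: toR g = m%:R^-1 *: x + (- y) by rewrite /y opprB addrC subrK.
  clearbody y.
  have gin : g \in gs.
    rewrite mem_filter mem_gridpts ?andbT.
      have := gaugeD Cconv Ccent (m%:R^-1 *: x) (- y).
      have := gaugeD Cconv Ccent (m%:R^-1 *: (- x)) y.
      rewrite !gaugeZV// E opprD opprK -scalerN.
      have := mem_gauge_le1 Cx; have := mem_gauge_le1 Cmx.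
      rewrite -(ler_pM2r (_ : 0 < m%:R^-1)) ?invr_gt0// => ?.
      rewrite -(ler_pM2r (_ : 0 < m%:R^-1)) ?invr_gt0// => ? ? ?.
      have := gauge_small (ltW h0) yh; have := gauge_small (ltW h0) yh'.
      move=> ? ?; apply/andP; split; lra.
    move=> i; rewrite -(ler_int R) -pmulrn intr_norm; apply: le_trans hN.
    have : `|x 0 i| <= rho.
      have := coord_le_gauge Cconv Ccent x i; move/le_trans; apply.
      rewrite -[X in _ <= X]mulr1 ler_wpM2l ?mem_gauge_le1//.
      by rewrite (le_trans (ltW r_gt0))// (radii_le Ccent).
    have /andP[] := xg i; rewrite -ler_pdivlMr// -ltr_pdivrMr// => H1 H2 H3.
    have : `|x 0 i / (m%:R * h)| <= rho / (m%:R * h).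
      by rewrite normrM [X in _ * X]ger0_norm ?invr_ge0 ?(ltW mh0)// ler_pM2r ?invr_gt0.
    by rewrite !ler_norml => /andP[? ?]; apply/andP; split; lra.
  have ig : (index g gs < size gs)%N by rewrite index_mem.
  exists (index g gs) => // i; rewrite /b /a ig nth_index// !mxE.
  have := xg i; rewrite mxE mulrDl mul1r mulrC => /andP[-> /ltW].
  by rewrite [m%:R * h * _]mulrC.
Qed.

End Packing.

Section PackingBound.
Context {R : realType} {n : nat} (C : set 'rV[R]_n) (r rho gamma : R).
Hypothesis n_gt0 : (0 < n)%N.
Hypothesis Cconv : convex_set (C : set (convex_lmodType 'rV[R]_n)).
Hypothesis Ccent : centered r rho C.
Hypothesis Ccpt : compact C.
Hypothesis Csym : gamma_symmetric gamma C.
Implicit Types (x y : 'rV[R]_n) (g : 'rV[int]_n).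
Local Notation p := (gauge C).
Local Notation K := (C `&` (-%R @` C)).
Local Notation toR g := (map_mx intr g : 'rV[R]_n).

Let r0 : 0 < r. Proof. by case: Ccent. Qed.
Let nR : 0 < n%:R :> R. Proof. by rewrite ltr0n. Qed.

Lemma gridpts_range N g : g \in gridpts N -> forall i, `|(g 0 i)%:~R| <= N%:R :> R.
Proof.
case/mapP => f _ -> i; rewrite mxE.
have := ltn_ord (f i); move: (val (f i)) => k kN.
rewrite -intr_norm -[N%:R]/(N%:~R) ler_int; lia.
Qed.

(** The cube of half side u = r / (2 n) lies inside C, and its (2 N + 1)^n grid points of spacing u
    / N already account for (r / n)^n. [cover_count] with slack half of that turns this into a lower
    bound for every cover. *)
Lemma cover_lower (a b : nat -> 'rV[R]_n) (V : R) :
  (forall k i, a k 0 i <= b k 0 i) ->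
  C `<=` \bigcup_k [set x | forall i, a k 0 i <= x 0 i <= b k 0 i] ->
  (\sum_(0 <= k <oo) (\prod_i (b k 0 i - a k 0 i))%:E <= V%:E)%E ->
  (r / n%:R) ^+ n / 2 <= V.
Proof.
move=> ab Cab sV.
have t0 : 0 < (r / n%:R) ^+ n / 2 by rewrite divr_gt0// exprn_gt0// divr_gt0.
have [h0 h00 H] := cover_count Ccpt ab Cab sV t0.
pose u := r / (2 * n%:R).
have u0 : 0 < u by rewrite divr_gt0// mulr_gt0.
pose N := (Num.bound (u / h0)).+1.
have NR : 0 < N%:R :> R by rewrite ltr0n.
pose h := u / N%:R.
have hpos : 0 < h by rewrite divr_gt0.
have hh0 : h <= h0.
  rewrite ler_pdivrMr// -ler_pdivrMl// mulrC ltW//.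
  have /archi_boundP : 0 <= u / h0 by rewrite divr_ge0// ltW.
  by move/lt_le_trans; apply; rewrite ler_nat leqnSn.
have hC g : g \in gridpts N -> C (h *: toR g).
  move=> gN; suff : p (h *: toR g) < 1 by move/(gauge_lt_mem Cconv Ccent); rewrite invr1 scale1r.
  apply: (@le_lt_trans _ _ (n%:R * u / r)).
    apply: (gauge_small Ccent) => [|i]; first exact: ltW.
    rewrite !mxE normrM ger0_norm ?(ltW hpos)// mulrAC ler_pdivrMr//.
    by rewrite ler_wpM2l ?(ltW u0)// gridpts_range.
  have -> : n%:R * u / r = 2^-1 by rewrite /u; field; rewrite !gt_eqF.
  by rewrite invf_lt1// ltr1n.
have {H} := H h _ (gridpts N) (gridpts_uniq N) hC; rewrite hpos hh0 => /(_ isT) H.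
suff : (r / n%:R) ^+ n <= (size (@gridpts n N))%:R * h ^+ n.
  by move=> HH; have := le_trans HH H; lra.
rewrite size_map -cardE card_ffun !card_ord natrX -exprMn lerXn2r ?nnegrE ?mulr_ge0 ?divr_ge0 ?(ltW r0) ?(ltW u0)//.
rewrite /h mulrA ler_pdivlMr// -addn1 natrD natrD.
have -> : r / n%:R = 2 * u by rewrite /u; field; rewrite gt_eqF.
by have := u0; nra.
Qed.

Lemma vol_lower : (((r / n%:R) ^+ n / 2)%:E <= vol C)%E.
Proof.
apply: le_ereal_inf_tmp => v [a [b [ab Cab ->]]].
have S0 : (0 <= \sum_(0 <= k <oo) (\prod_i (b k 0 i - a k 0 i))%:E)%E.
  by apply: nneseries_ge0 => k _ _; rewrite lee_fin prodr_ge0// => i _; rewrite subr_ge0.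
case E : (\sum_(0 <= k <oo) _)%E => [V| |]; rewrite ?leey//; last by move: S0; rewrite E.
by rewrite lee_fin; apply: (cover_lower ab Cab); rewrite E.
Qed.

(** Round the points of W to a grid and add to each the grid points of a core of gauge radius s/4.
    By separation all these sums are distinct, and scaled by 1 / (beta + s) they fall in C.
    [cover_count] bounds their number above by 3 vol(C) / h^n, while [vol_core_le] and
    gamma-symmetry bound the size of the core below; dividing gives the claim. *)
Lemma packing (W : seq 'rV[R]_n) (beta s : R) (m : nat) :
  uniq W -> 0 <= beta -> 0 < s -> (0 < m)%N -> 8 * (beta + s) <= m%:R * s ->
  (forall w, w \in W -> p w <= beta) ->
  {in W &, forall w w', w != w' -> s < Num.max (p (w - w')) (p (w' - w))} ->
  (size W)%:R <= 3 * (m%:R / gamma) ^+ n.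
Proof.
move=> uW beta0 s0 m0 ms Wbeta Wsep.
have mR : 0 < m%:R :> R by rewrite ltr0n.
case: Csym => /andP[gamma0 gamma1] volCK.
have g0 : 0 < gamma ^+ n by rewrite exprn_gt0.
have volC0 := vol_lower.
have t0 : 0 < (r / n%:R) ^+ n / 2 by rewrite divr_gt0// exprn_gt0// divr_gt0.
have volKfin N h : 0 < h -> n%:R * h * m%:R <= r -> rho / (m%:R * h) + 1 <= N%:R ->
    (vol K <= ((m%:R * h) ^+ n * (size (core_grid C h (2 / m%:R) N))%:R)%:E)%E.
  exact: vol_core_le.
(* The volume of C is finite, because gamma^n vol(C) is at most the volume of the core, which
   [vol_core_le] bounds by a real number. *)
have [c cE] : exists c, vol C = c%:E.
  case E : (vol C) => [c| |]; [by exists c | | by move: volC0; rewrite E].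
  pose h1 := r / (n%:R * m%:R).
  have h10 : 0 < h1 by rewrite divr_gt0// mulr_gt0.
  have := volKfin (Num.bound (rho / (m%:R * h1) + 1)) h1 h10.
  have rho0 : 0 <= rho by rewrite (le_trans (ltW r0))// (radii_le Ccent).
  have -> : n%:R * h1 * m%:R = r by rewrite /h1; field; rewrite !gt_eqF.
  have P : 0 <= rho / (m%:R * h1) + 1 by rewrite addr_ge0// divr_ge0// mulr_ge0 ?(ltW mR) ?(ltW h10).
  move=> /(_ (lexx _) (ltW (archi_boundP P))) H.
  by have := le_trans volCK H; rewrite E mulry gtr0_sg// mul1e leye_eq.
have c0 : 0 < c by move: volC0; rewrite cE lee_fin; apply: lt_le_trans.
(* A cover of total volume below 2c, together with the slack c in [cover_count], produces the factor
   3. *)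
have [v [a [b [ab Cab ->]]]] : exists2 v, [set v | exists a b : nat -> 'rV[R]_n,
    [/\ forall k i, a k 0 i <= b k 0 i,
        C `<=` \bigcup_k [set x | forall i, a k 0 i <= x 0 i <= b k 0 i]
      & v = (\sum_(0 <= k <oo) (\prod_i (b k 0 i - a k 0 i))%:E)%E]] v & (v < (2 * c)%:E)%E.
  by apply: ereal_inf_lt; rewrite -/(vol C) cE lte_fin; lra.
move=> /ltW sV.
have [h0 h00 H] := cover_count Ccpt ab Cab sV c0.
pose al := beta + s.
have al0 : 0 < al by rewrite ltr_wpDl.
(* The three bounds on h serve [cover_count], [vol_core_le], and a rounding error of at most s/8 on
   the grid of spacing (beta + s) h. *)
pose h := Num.min h0 (Num.min (r / (n%:R * m%:R)) (s * r / (8 * al * n%:R))).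
have hpos : 0 < h by rewrite !lt_min h00 !divr_gt0 ?mulr_gt0.
have hh0 : h <= h0 by rewrite ge_min lexx.
have hm : n%:R * h * m%:R <= r.
  rewrite mulrAC -ler_pdivlMl ?mulr_gt0// mulrC.
  by rewrite /h !ge_min lexx /= orbT.
have hs : n%:R * (al * h) / r <= s / 8.
  have : h <= s * r / (8 * al * n%:R) by rewrite /h !ge_min lexx !orbT.
  rewrite ler_pdivlMr ?mulr_gt0// => ?.
  rewrite ler_pdivrMr//; lra.
pose hp := al * h; have hp0 : 0 < hp by rewrite mulr_gt0.
pose N := Num.bound (rho / (m%:R * h) + 1).
have hN : rho / (m%:R * h) + 1 <= N%:R.
  rewrite ltW// archi_boundP// addr_ge0// divr_ge0 ?mulr_ge0 ?(ltW mR) ?(ltW hpos)//.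
  by rewrite (le_trans (ltW r0))// (radii_le Ccent).
have := le_trans volCK (volKfin N h hpos hm hN).
rewrite cE -EFinM lee_fin => volK {volKfin volCK}.
set Gs := core_grid C h (2 / m%:R) N in volK.
pose flo (w : 'rV[R]_n) : 'rV[int]_n := \row_i Num.floor (w 0 i / hp).
have flo_err (w : 'rV[R]_n) : p (w - hp *: toR (flo w)) <= s / 8 /\ p (- (w - hp *: toR (flo w))) <= s / 8.
  set y := w - _.
  have yi i : 0 <= y 0 i <= hp.
    have -> : y 0 i = w 0 i - hp * (Num.floor (w 0 i / hp))%:~R by rewrite /y !mxE.
    have := floor_itv (w 0 i / hp); rewrite intrD ler_pdivlMr// ltr_pdivrMr// => /andP[? ?].
    by apply/andP; split; lra.
  have yh i : `|y 0 i| <= hp by have /andP[? ?] := yi i; rewrite ger0_norm.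
  have yh' i : `|(- y) 0 i| <= hp by rewrite mxE normrN.
  have gsm := gauge_small Ccent (ltW hp0).
  by split; apply: le_trans hs; apply: gsm.
have GsP g : g \in Gs -> p (hp *: toR g) <= s / 4 /\ p (- (hp *: toR g)) <= s / 4.
  rewrite mem_filter => /andP[/andP[H1 H2] _].
  have hm4 : al * (2 / m%:R) <= s / 4 by rewrite mulrA ler_pdivrMr//; rewrite -/al in ms; lra.
  rewrite /hp -scalerA -scalerN !(gaugeZ Cconv Ccent _ (ltW al0)).
  by split; apply: le_trans hm4; rewrite ler_wpM2l ?(ltW al0).
(* Equal sums would put w and w' within s/8 + s/8 + s/4 + s/4 < s of each other in both directions,
   against the separation. *)
pose gs := [seq flo w + g | w <- W, g <- Gs].
have pD := gaugeD Cconv Ccent.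
have ugs : uniq gs.
  apply: allpairs_uniq => //; first by rewrite filter_uniq// gridpts_uniq.
  move=> [w1 g1] [w2 g2] /allpairsP[[w g] /= [wW gG [-> ->]]] /allpairsP[[w' g'] /= [wW' gG' [-> ->]]] e.
  suff ww : w = w' by move: e; rewrite ww => /addrI ->.
  apply/eqP/negPn/negP => /(Wsep _ _ wW wW').
  have E : hp *: toR (flo w) + hp *: toR g = hp *: toR (flo w') + hp *: toR g'.
    by rewrite -!scalerDr -!map_mxD e.
  have key u g1' u2 g2' : hp *: toR (flo u) + hp *: toR g1' = hp *: toR (flo u2) + hp *: toR g2' ->
      u \in W -> u2 \in W -> g1' \in Gs -> g2' \in Gs -> p (u - u2) < s.
    move=> Euv uW' vW' G1 G2.
    have -> : u - u2 = (u - hp *: toR (flo u)) + (- (u2 - hp *: toR (flo u2)))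
        + (hp *: toR g2' + - (hp *: toR g1')).
      have -> : hp *: toR g2' = hp *: toR (flo u) + hp *: toR g1' - hp *: toR (flo u2).
        by rewrite Euv addrAC subrr add0r.
      apply/rowP => i; rewrite !mxE; ring.
    have [? _] := flo_err u; have [_ ?] := flo_err u2.
    have [? _] := GsP _ G2; have [_ ?] := GsP _ G1.
    apply: le_lt_trans (pD _ _) _; apply: (@le_lt_trans _ _ (s / 8 + s / 8 + (s / 4 + s / 4))).
      by rewrite lerD// (le_trans (pD _ _))// lerD.
    by have := s0; lra.
  by rewrite lt_max ltNge (ltW (key _ _ _ _ E _ _ _ _))// ltNge (ltW (key _ _ _ _ (esym E) _ _ _ _)).
have gsC g : g \in gs -> C (h *: toR g).
  case/allpairsP => -[w g'] /= [wW gG ->].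
  have -> : h *: toR (flo w + g') = al^-1 *: (hp *: toR (flo w + g')).
    by rewrite scalerA /hp mulrA mulVf ?mul1r// gt_eqF.
  apply: (gauge_lt_mem Cconv Ccent).
  have -> : hp *: toR (flo w + g') = w + (- (w - hp *: toR (flo w))) + hp *: toR g'.
    by rewrite opprB addrCA subrr addr0 -scalerDr -map_mxD.
  have [_ ?] := flo_err w; have [? _] := GsP _ gG.
  apply: (@le_lt_trans _ _ (beta + s / 8 + s / 4)).
    by rewrite (le_trans (pD _ _))// lerD// (le_trans (pD _ _))// lerD// Wbeta.
  by rewrite /al; have := s0; lra.
have := H h _ gs ugs gsC; rewrite hpos hh0 => /(_ isT).
rewrite size_allpairs natrM => count.
have hn0 : 0 <= h ^+ n by rewrite exprn_ge0// ltW.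
have mn0 : 0 <= m%:R ^+ n :> R by rewrite exprn_ge0// ltW.
rewrite expr_div_n mulrA ler_pdivlMr// -(ler_pM2r c0).
apply: (@le_trans _ _ ((size W)%:R * ((m%:R * h) ^+ n * (size Gs)%:R))).
  by rewrite -mulrA ler_wpM2l.
rewrite exprMn.
have -> : (size W)%:R * (m%:R ^+ n * h ^+ n * (size Gs)%:R) =
  m%:R ^+ n * ((size W)%:R * (size Gs)%:R * h ^+ n) :> R by ring.
have -> : 3 * m%:R ^+ n * c = m%:R ^+ n * (2 * c + c) by ring.
by rewrite ler_wpM2l.
Qed.
End PackingBound.

(** * Bounds from the rational basis by Cramer's rule *)

Section BasisBound.
Context {R : realType} {n : nat} (B : 'M[rat]_n).
Local Notation Br := (map_mx ratr B : 'M[R]_n).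

(** A single number that the machine gets from the input by additions and multiplications, and that
    dominates the dimension, the entries, and the scaled cofactors at once. *)
Definition size_bound : R :=
  \prod_i \prod_j ((1 + (numq (B i j))%:~R ^+ 2) * (1 + (denq (B i j))%:~R ^+ 2)).

(** Expanding the product of row sums gives a term for every function from rows to columns, and the
    permutations are among them. *)
Lemma perm_sum_le (a : 'I_n -> 'I_n -> R) : (forall i j, 0 <= a i j) ->
  \sum_(s : 'S_n) \prod_i a i (s i) <= \prod_i \sum_j a i j.
Proof.
move=> a0; rewrite bigA_distr_bigA /= (bigID (fun f : {ffun 'I_n -> 'I_n} => injectiveb f)) /=.
rewrite [X in _ <= X + _](reindex (@pval _)) /=; last first.
  pose in_Sn := insubd (1%g : 'S_n).
  by exists in_Sn => /= f Uf; first apply: val_inj; apply: insubdK.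
rewrite ler_wpDr//; first by apply: sumr_ge0 => f _; apply: prodr_ge0.
rewrite le_eqVlt; apply/orP; left; apply/eqP; apply: eq_big => /= [s|s _]; first by rewrite (valP s).
by apply: eq_bigr => i _; rewrite pvalE.
Qed.

Lemma sum_le_prod1 (I : finType) (f : I -> R) : (forall i, 0 <= f i) ->
  1 + \sum_i f i <= \prod_i (1 + f i).
Proof.
move=> f0; elim: (index_enum I) => [|j s IH]; first by rewrite !big_nil addr0.
rewrite !big_cons; apply: (@le_trans _ _ ((1 + f j) * (1 + \sum_(i <- s) f i))).
  have : 0 <= \sum_(i <- s) f i by apply: sumr_ge0.
  have := f0 j; nra.
by rewrite ler_wpM2l// addr_ge0.
Qed.

(** Replacing row k by the unit vector at j writes the cofactor as a sum over permutations of the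
    modified matrix, to which [perm_sum_le] applies. *)
Lemma cofactor_le (A : 'M[R]_n) k j :
  `|cofactor A k j| <= \prod_i \prod_l (1 + `|A i l|).
Proof.
pose a i l : R := if i == k then (l == j)%:R else `|A i l|.
have a0 i l : 0 <= a i l by rewrite /a; case: ifP.
rewrite expand_cofactor; apply: le_trans (ler_norm_sum _ _ _) _.
apply: (@le_trans _ _ (\sum_(s : 'S_n) \prod_i a i (s i))).
  rewrite big_mkcond; apply: ler_sum => s _; case: eqP => [skj|_]; last exact: prodr_ge0.
  rewrite normrM normrX normrN1 expr1n mul1r normr_prod [X in _ <= X](bigD1 k)//=.
  rewrite {1}/a eqxx skj eqxx mul1r le_eqVlt; apply/orP; left; apply/eqP.
  apply: eq_big => i; rewrite eq_sym// => ik.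
  by rewrite /a -if_neg ik.
apply: le_trans (perm_sum_le a0) _; apply: ler_prod => i _; rewrite sumr_ge0//=.
apply: (@le_trans _ _ (1 + \sum_l `|A i l|)); last exact: sum_le_prod1.
have [ik|ik] := eqVneq i k.
  rewrite (bigD1 j)//= big1 => [|l /negbTE lj]; rewrite /a ik eqxx ?lj// eqxx addr0 lerDl.
  exact: sumr_ge0.
by rewrite -[X in X <= _]add0r lerD//; apply: ler_sum => l _; rewrite /a (negbTE ik).
Qed.

(** Multiplied by the product of all denominators, the determinant becomes a nonzero integer. *)
Lemma det_scaled_ge1 : B \in unitmx ->
  1 <= `|\det B| * \prod_i \prod_j (denq (B i j))%:~R.
Proof.
rewrite unitmxE unitfE => detB.
set D := \prod_i _.
have D0 : 0 < D by apply: prodr_gt0 => i _; apply: prodr_gt0 => j _; rewrite ltr0z.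
rewrite -[X in _ * X]gtr0_norm// -normrM; apply: norm_intr_ge1; last first.
  by rewrite mulf_neq0// gt_eqF.
rewrite mulr_suml; apply: rpred_sum => s _; rewrite -mulrA.
apply: rpredM; first by rewrite rpredX// rpredN1.
rewrite -big_split; apply: rpred_prod => i _ /=.
rewrite (bigD1 (s i))//= mulrA -numqE; apply: rpredM; first exact: intr_int.
by apply: rpred_prod => j _; exact: intr_int.
Qed.

Let sqn (x : int) : `|x%:~R| <= x%:~R ^+ 2 :> R.
Proof.
have [->|x0] := eqVneq x 0; first by rewrite normr0 expr0n.
rewrite -real_normK ?num_real// expr2 ler_peMl// norm_intr_ge1 ?intr_int//.
by rewrite intr_eq0.
Qed.

Let num_le i j : `|Br i j| <= (numq (B i j))%:~R ^+ 2.
Proof.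
have d1 : 1 <= (denq (B i j))%:~R :> R by rewrite (ler_int _ 1) -gtz0_ge1 denq_gt0.
apply: le_trans (sqn _); rewrite mxE /ratr normrM normfV.
rewrite ler_pdivrMr ?normr_gt0 ?gt_eqF ?(lt_le_trans ltr01)//.
by rewrite ler_peMr// (le_trans d1) ?ler_norm.
Qed.

Let entry_le i j : (denq (B i j))%:~R * (1 + `|Br i j|) <=
  (1 + (numq (B i j))%:~R ^+ 2) * (1 + (denq (B i j))%:~R ^+ 2) :> R.
Proof.
have := num_le i j; have := sqn (denq (B i j)); have := ler_norm ((denq (B i j))%:~R : R).
have := sqr_ge0 ((numq (B i j))%:~R : R).
have : 0 <= (denq (B i j))%:~R :> R by rewrite ler0z denq_ge0.
have := normr_ge0 (Br i j).
move: (`|Br i j|) (_%:~R) (_%:~R) => a b c *; nra.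
Qed.

Lemma size_bound_ge1 : 1 <= size_bound.
Proof.
apply: (big_ind (fun y : R => 1 <= y)) => // [x y|i _]; first exact: mulr_ege1.
apply: (big_ind (fun y : R => 1 <= y)) => // [x y|j _]; first exact: mulr_ege1.
by rewrite mulr_ege1// lerDl sqr_ge0.
Qed.

Lemma dim_le_size_bound : n%:R <= size_bound.
Proof.
have H : \prod_(i < n) \prod_(j < n) 2 <= size_bound.
  apply: ler_prod => i _; rewrite prodr_ge0//=; apply: ler_prod => j _.
  rewrite ler0n /=.
  have : 0 <= (numq (B i j))%:~R ^+ 2 :> R by rewrite sqr_ge0.
  have d1 : 1 <= (denq (B i j))%:~R :> R by rewrite (ler_int _ 1) -gtz0_ge1 denq_gt0.
  move: (_%:~R) (_%:~R ^+ 2) d1 => d m *; nra.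
apply: le_trans H; rewrite !prodr_const card_ord -exprM -natrX ler_nat.
apply: leq_trans (ltnW (ltn_expl (n * n) (ltnSn 1))).
by case: (n) => // m; rewrite leq_pmulr.
Qed.

(** Cramer's rule: z times det(B) is x times the adjugate. The determinant is bounded below by
    [det_scaled_ge1], the cofactors above by [cofactor_le], and each denominator is paired with its
    entry inside [size_bound]. *)
Lemma coord_basis_le (z x : 'rV[R]_n) (k : 'I_n) : B \in unitmx -> x = z *m Br ->
  `|z 0 k| <= size_bound * \sum_j `|x 0 j|.
Proof.
move=> uB xz.
have E : z 0 k * \det Br = \sum_j x 0 j * cofactor Br k j.
  have : x *m \adj Br = \det Br *: z by rewrite xz -mulmxA mul_mx_adj mul_mx_scalar.
  move/rowP/(_ k); rewrite !mxE mulrC => <-; apply: eq_bigr => j _; by rewrite mxE.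
have D1 := det_scaled_ge1 uB.
have {}D1 : 1 <= `|\det Br| * \prod_i \prod_j (denq (B i j))%:~R.
  rewrite det_map_mx -[X in X <= _](rmorph1 (@ratr R)).
  move: D1; rewrite -(ler_rat R) rmorphM /= ratr_norm; congr (_ <= _ * _).
  rewrite rmorph_prod; apply: eq_bigr => i _; rewrite rmorph_prod; apply: eq_bigr => j _.
  exact: ratr_int.
set D := \prod_i _ in D1.
have D0 : 0 < D by apply: prodr_gt0 => i _; apply: prodr_gt0 => j _; rewrite ltr0z.
have zD : `|z 0 k| <= `|z 0 k * \det Br| * D by rewrite normrM -mulrA ler_peMr.
apply: (le_trans zD); rewrite E.
apply: (@le_trans _ _ ((\sum_j `|x 0 j| * \prod_i \prod_l (1 + `|Br i l|)) * D)).
  rewrite ler_pM2r//; apply: le_trans (ler_norm_sum _ _ _) _; apply: ler_sum => j _.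
  by rewrite normrM ler_wpM2l// cofactor_le.
rewrite -mulr_suml -mulrA [_ * D]mulrC [X in X <= _]mulrC ler_wpM2r ?sumr_ge0//.
rewrite /D -big_split; apply: ler_prod => i _ /=.
rewrite -big_split /= prodr_ge0 => [|j _] /=; last first.
  by rewrite mulr_ge0 ?ler0z ?denq_ge0// addr_ge0.
by apply: ler_prod => j _; rewrite entry_le mulr_ge0 ?ler0z ?denq_ge0// addr_ge0.
Qed.

Lemma entry_sum_le : \sum_i \sum_j `|Br i j| <= size_bound.
Proof.
apply: (@le_trans _ _ (\prod_i (1 + \sum_j `|Br i j|))).
  by apply: le_trans (sum_le_prod1 _); rewrite ?lerDr// => i; exact: sumr_ge0.
apply: ler_prod => i _; rewrite addr_ge0 ?sumr_ge0//=.
apply: (@le_trans _ _ (\prod_j (1 + `|Br i j|))); first exact: sum_le_prod1.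
apply: ler_prod => j _; rewrite addr_ge0//=; apply: le_trans (entry_le i j).
rewrite ler_peMl ?addr_ge0//.
by rewrite (ler_int _ 1) -gtz0_ge1 denq_gt0.
Qed.
End BasisBound.

(** * Nets of lattice vectors: sumset, pruning, change of norm *)

Section Nets.
Context {R : realType} {n : nat} (q : 'rV[int]_n -> R).
Implicit Types (z w d : 'rV[int]_n) (W O : seq 'rV[int]_n) (v s t : R).

Definition mabs z : R := \big[Num.max/0]_i `|(z 0 i)%:~R|.

Lemma mabs_ge0 z : 0 <= mabs z.
Proof. by rewrite /mabs; elim/big_ind : _ => // x y x0 y0; rewrite le_max x0. Qed.

Lemma mabs_ge z i : `|(z 0 i)%:~R| <= mabs z.
Proof. exact: (@le_bigmax _ _ _ 0 (fun i => `|(z 0 i)%:~R|)). Qed.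

Lemma mabs_le z t : 0 <= t -> (forall i, `|(z 0 i)%:~R| <= t) -> mabs z <= t.
Proof. by move=> t0 H; apply: bigmax_le. Qed.

Lemma mabs0 : mabs 0 = 0.
Proof. by apply/eqP; rewrite eq_le mabs_ge0 andbT mabs_le// => i; rewrite mxE normr0. Qed.

Lemma mabsN z : mabs (- z) = mabs z.
Proof. by apply: eq_bigr => i _; rewrite mxE rmorphN normrN. Qed.

Lemma mabsD z w : mabs (z + w) <= mabs z + mabs w.
Proof.
apply: mabs_le => [|i]; first by rewrite addr_ge0 ?mabs_ge0.
by rewrite mxE rmorphD (le_trans (ler_normD _ _))// lerD ?mabs_ge.
Qed.

Lemma mabs_lt1 z : mabs z < 1 -> z = 0.
Proof.
move=> H; apply/rowP => i; rewrite mxE; have := le_lt_trans (mabs_ge z i) H.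
by rewrite -intr_norm (ltr_int _ _ 1); lia.
Qed.

Hypotheses (q_ge0 : forall z, 0 <= q z) (qD : forall z w, q (z + w) <= q z + q w).
Hypothesis q_0 : q 0 = 0.

(** Interpolates between v times the sup norm of the coordinates (v large) and q (v small); lowering
    v deforms the first into the second. *)
Definition nrm v z := Num.max (q z) (v * mabs z).
Definition snrm v z := Num.max (nrm v z) (nrm v (- z)).

Lemma nrm_le v z t : (nrm v z <= t) = (q z <= t) && (v * mabs z <= t).
Proof. by rewrite ge_max. Qed.

Lemma snrm_le v z t : (snrm v z <= t) = [&& q z <= t, q (- z) <= t & v * mabs z <= t].
Proof.
by rewrite ge_max !nrm_le mabsN; case: (q z <= t); case: (q (-z) <= t); case: (_ <= t).
Qed.

Lemma nrm_ge0 v z : 0 <= nrm v z. Proof. by rewrite le_max q_ge0. Qed.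

Lemma nrm_le_snrm v z : nrm v z <= snrm v z.
Proof. by rewrite le_max lexx. Qed.

Lemma snrmN v z : snrm v (- z) = snrm v z.
Proof. by rewrite /snrm opprK maxC. Qed.

Lemma snrm0 v : snrm v 0 = 0.
Proof. by rewrite /snrm /nrm oppr0 q_0 mabs0 mulr0 !maxxx. Qed.

Lemma nrmD v z w : 0 <= v -> nrm v (z + w) <= nrm v z + nrm v w.
Proof.
move=> v0; rewrite nrm_le; apply/andP; split.
  by apply: le_trans (qD _ _) _; rewrite lerD// le_max lexx.
apply: (@le_trans _ _ (v * mabs z + v * mabs w)).
  by rewrite -mulrDr ler_wpM2l// mabsD.
by rewrite lerD// le_max lexx orbT.
Qed.

Lemma snrmD v z w : 0 <= v -> snrm v (z + w) <= snrm v z + snrm v w.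
Proof.
move=> v0; rewrite ge_max; apply/andP; split.
  by rewrite (le_trans (nrmD _ _ v0))// lerD// le_max lexx.
by rewrite opprD (le_trans (nrmD _ _ v0))// lerD// le_max lexx orbT.
Qed.

(** The range is one-sided but the error two-sided: z - w must be a legal argument for the next net,
    and its negative is also added to z in estimates. *)
Definition covers v t s W := forall z, nrm v z <= t -> exists2 w, w \in W & snrm v (z - w) <= s.

(** The gaps between b / 2 and b, and between sg / 2 and sg, leave room for a machine that knows the
    norm only up to a factor 2. *)
Definition pruned v (b sg : R) (D O : seq 'rV[int]_n) :=
  [/\ forall u, u \in D -> nrm v u <= b / 2 -> exists2 w, w \in O & snrm v (u - w) <= sg,
      forall w, w \in O -> nrm v w <= b
    & pairwise (fun w w' => sg / 2 < snrm v (w' - w)) O].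

Definition sumset (W W' : seq 'rV[int]_n) := [seq x + y | x <- W, y <- W'].

(** Successive approximation: x approximates z, then y approximates the remainder z - x, so x + y is
    within s2 of z, and pruning moves x + y by at most sg. The condition on b / 2 says that x + y is
    short enough not to be discarded. *)
Lemma prune_covers v t s1 s2 b sg W1 W0 O : 0 <= v ->
  covers v t s1 W1 -> covers v s1 s2 W0 -> t + s2 <= b / 2 ->
  pruned v b sg (sumset W1 W0) O -> covers v t (s2 + sg) O.
Proof.
move=> v0 c1 c0 tb [prO _ _] z zt.
have [x xW zx] := c1 _ zt.
have [y yW zy] := c0 _ (le_trans (nrm_le_snrm _ _) zx).
have xyD : x + y \in sumset W1 W0 by apply: allpairs_f.
have E : x + y = z + (- (z - x - y)) by apply/rowP => i; rewrite !mxE; ring.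
have [|w wO xyw] := prO _ xyD.
  rewrite E (le_trans (nrmD _ _ v0))// (le_trans _ tb)// lerD//.
  by rewrite (le_trans (nrm_le_snrm _ _))// snrmN.
exists w => //.
have -> : z - w = (z - x - y) + (x + y - w) by apply/rowP => i; rewrite !mxE; ring.
by rewrite (le_trans (snrmD _ _ v0))// lerD.
Qed.

Lemma covers_mono v t s t' s' W : t' <= t -> s <= s' -> covers v t s W -> covers v t' s' W.
Proof.
move=> tt ss c z zt; have [w wW H] := c _ (le_trans zt tt).
by exists w => //; apply: le_trans ss.
Qed.

Lemma covers_level v v' t s W : 0 <= v' -> v' <= v -> 3 * v <= 4 * v' ->
  covers v t s W -> covers v' (3 / 4 * t) s W.
Proof.
move=> v0 vv v34 c z; rewrite nrm_le => /andP[qz mz].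
have m0 := mabs_ge0.
have [|w wW] := c z.
  rewrite nrm_le; apply/andP; split; first by have := q_ge0 z; lra.
  have : 0 <= mabs z by []. nra.
rewrite snrm_le => /and3P[H1 H2 H3]; exists w => //; rewrite snrm_le H1 H2 /=.
by apply: le_trans H3; rewrite ler_wpM2r.
Qed.

(** The factor 3/4 makes scale 0 trivial: norm at most (3/4) v forces all coordinates below 1, so
    only z = 0 qualifies. *)
Definition tau v (l : nat) := v * (3 / 4) * 2 ^+ l.

Lemma tau_gt0 v l : 0 < v -> 0 < tau v l.
Proof. by move=> v0; rewrite mulr_gt0 ?exprn_gt0// mulr_gt0// divr_gt0. Qed.

Lemma tauS v l : tau v l.+1 = 2 * tau v l.
Proof. by rewrite /tau exprS; ring. Qed.

(** In units of T = tau v' l, the old nets at scales l+1 and l have errors 8/9 and 4/9 and, for the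
    new norm, ranges 2 and 1. So the error of the first is within the range of the second. The sum
    is then within 4/9, pruning adds 2/9, and the total 2/3 is a third of the new scale 2 T. *)
Lemma level_covers v l W1 W0 O : 0 < v ->
  covers v (tau v l.+1) (tau v l.+1 / 3) W1 -> covers v (tau v l) (tau v l / 3) W0 ->
  pruned (v * (3 / 4)) (3 * tau (v * (3 / 4)) l.+1) (tau (v * (3 / 4)) l.+1 / 9) (sumset W1 W0) O ->
  covers (v * (3 / 4)) (tau (v * (3 / 4)) l.+1) (tau (v * (3 / 4)) l.+1 / 3) O.
Proof.
move=> v0 c1 c0 prO; set v' := v * (3 / 4).
have v'0 : 0 < v' by rewrite mulr_gt0// divr_gt0.
have T0 := tau_gt0 l v'0.
have tE k : tau v k = 4 / 3 * tau v' k by rewrite /v' /tau; field.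
have {}c1 : covers v' (tau v' l.+1) (tau v' l) W1.
  apply: covers_mono (covers_level _ _ _ c1); rewrite ?(ltW v'0)// ?tE ?tauS /v'; lra.
have {}c0 : covers v' (tau v' l) (4 / 9 * tau v' l) W0.
  apply: covers_mono (covers_level _ _ _ c0); rewrite ?(ltW v'0)// ?tE /v'; lra.
apply: covers_mono (prune_covers (ltW v'0) c1 c0 _ prO); rewrite -/v' ?tauS; lra.
Qed.

(** A net whose range is exactly the present error s reduces it to s/3; pruning adds s/6, so the
    error halves. *)
Lemma refine_covers v t s W1 W0 O : 0 < v -> 0 < s -> 2 * s <= t ->
  covers v t s W1 -> covers v s (s / 3) W0 -> pruned v (3 * t) (s / 6) (sumset W1 W0) O ->
  covers v t (s / 2) O.
Proof.
move=> v0 s0 st c1 c0 prO.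
by apply: covers_mono (prune_covers (ltW v0) c1 c0 _ prO); lra.
Qed.

Lemma covers_zero v : 0 < v -> covers v (tau v 0) (tau v 0 / 3) [:: 0].
Proof.
move=> v0 z; rewrite nrm_le => /andP[_].
rewrite /tau expr0 mulr1 ler_pM2l// => H.
have -> : z = 0 by apply: mabs_lt1; apply: le_lt_trans H _; lra.
exists 0; first by rewrite inE.
by rewrite subr0 snrm0 divr_ge0// mulr_ge0 ?(ltW v0)// divr_ge0.
Qed.

End Nets.

Section BaseNet.
Context {n : nat}.
Implicit Types (z w g : 'rV[int]_n) (W : seq 'rV[int]_n).

Definition adjoin_shift g W := W ++ [seq w + g | w <- W].

Definition axis (c : int) (k : 'I_n) : 'rV[int]_n := c *: delta_mx 0 k.

Definition base_gens (c : int) (ks : seq 'I_n) :=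
  flatten [seq [:: axis c k; axis (- c) k] | k <- ks].

Definition base_list (c : int) (ks : seq 'I_n) := foldl (fun W g => adjoin_shift g W) [:: 0] (base_gens c ks).

Lemma mem_adjoin_shift g W w : w \in W -> w \in adjoin_shift g W.
Proof. by move=> wW; rewrite mem_cat wW. Qed.

Lemma mem_adjoin_shiftD g W w : w \in W -> w + g \in adjoin_shift g W.
Proof. by move=> wW; rewrite mem_cat (map_f (fun w => w + g) wW) orbT. Qed.

Lemma base_list_rcons c ks k : base_list c (rcons ks k) =
  adjoin_shift (axis (- c) k) (adjoin_shift (axis c k) (base_list c ks)).
Proof. by rewrite /base_list /base_gens map_rcons -cats1 flatten_cat foldl_cat. Qed.

Lemma size_base_list c ks : size (base_list c ks) = (4 ^ size ks)%N.
Proof.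
elim/last_ind: ks => // ks k IH.
rewrite base_list_rcons /adjoin_shift !size_cat !size_map size_cat size_map IH size_rcons expnS; lia.
Qed.

Lemma base_list_bound c ks w i : uniq ks -> w \in base_list c ks ->
  (if i \in ks then `|w 0 i| <= `|c| else w 0 i == 0).
Proof.
elim/last_ind: ks w => [|ks k IH] w; first by rewrite inE => _ /eqP->; rewrite mxE.
rewrite rcons_uniq mem_rcons inE => /andP[kks uks].
have ax d : axis d k 0 i = if i == k then d else 0.
  by rewrite !mxE /= eq_sym; case: eqP => _; rewrite ?mulr1 ?mulr0.
have addE (x y : 'rV[int]_n) : (x + y) 0 i = x 0 i + y 0 i by rewrite mxE.
have E w' : w' \in base_list c ks -> if i == k then w' 0 i == 0 else
   (if i \in ks then `|w' 0 i| <= `|c| else w' 0 i == 0).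
  by move=> /(IH _ uks); have [->|//] := eqVneq i k; rewrite (negbTE kks).
rewrite base_list_rcons /adjoin_shift !mem_cat map_cat mem_cat => H.
have {H} [w' /E w'E [->|[->|[->|->]]]] : exists2 w', w' \in base_list c ks &
    w = w' \/ w = w' + axis c k \/ w = w' + axis (- c) k \/ w = w' + axis c k + axis (- c) k.
  case/orP: H => [/orP[H|/mapP[w' w'W ->]]|/orP[/mapP[w' w'W ->]|/mapP[x /mapP[w' w'W ->] ->]]].
  - by exists w => //; left.
  - by exists w' => //; right; left.
  - by exists w' => //; right; right; left.
  - by exists w' => //; right; right; right.
all: rewrite ?addE ?ax; move: w'E.
all: case: (i == k) => /=; rewrite ?addr0//.
all: by move/eqP->; rewrite ?add0r ?normrN// ?subrr normr0.
Qed.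

Lemma base_list_digits c ks (a : 'I_n -> int) : uniq ks ->
  (forall i, a i \in [:: 0; 1; -1]) ->
  \row_i (if i \in ks then c * a i else 0) \in base_list c ks.
Proof.
move=> + a01; elim/last_ind: ks => [|ks k IH].
  by rewrite inE => _; apply/eqP/rowP => i; rewrite !mxE.
rewrite rcons_uniq => /andP[kks /IH {}IH].
rewrite base_list_rcons.
have -> : \row_i (if i \in rcons ks k then c * a i else 0) =
    \row_i (if i \in ks then c * a i else 0) + axis (c * a k) k.
  apply/rowP => i; rewrite !mxE /= mem_rcons inE; case: eqP => [->|_]; first by rewrite (negbTE kks) mulr1 add0r.
  by rewrite mulr0 addr0.
have := a01 k; rewrite !inE => /or3P[] /eqP->.
- rewrite mulr0 /axis scale0r addr0; do 2! apply: mem_adjoin_shift; exact: IH.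
- rewrite mulr1; apply: mem_adjoin_shift; apply: mem_adjoin_shiftD; exact: IH.
- rewrite mulrN1; apply: mem_adjoin_shiftD; apply: mem_adjoin_shift; exact: IH.
Qed.
End BaseNet.


Lemma greedy_separated (T : eqType) (close : rel T) (O : seq T) :
  reflexive close -> symmetric close -> uniq O ->
  exists W, [/\ uniq W, {subset W <= O},
    {in W &, forall w w', w != w' -> ~~ close w w'} &
    forall w, w \in O -> exists2 w', w' \in W & close w w'].
Proof.
move=> cr cs; elim: O => [|x O IH] /= => [_|/andP[xO uO]]; first by exists [::].
have [W [uW WO Ws Wc]] := IH uO.
have [/hasP[y yW xy]|nx] := boolP (has (close x) W).
  exists W; split => // w; first by move/WO; rewrite inE => ->; rewrite orbT.
  by rewrite inE => /predU1P[->|/Wc//]; exists y.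
have xW : x \notin W by apply: contra xO; exact: WO.
exists (x :: W); split => [|w|w w'|w] /=.
- by rewrite xW.
- by rewrite !inE => /predU1P[->|/WO ->]; rewrite ?eqxx ?orbT.
- rewrite !inE => /predU1P[->|wW] /predU1P[->|wW']; rewrite ?eqxx// => ww.
  + by have := hasPn nx _ wW'.
  + by rewrite cs; have := hasPn nx _ wW.
  + exact: Ws.
- rewrite inE => /predU1P[->|/Wc[w' w'W ww']]; first by exists x => //; rewrite mem_head.
  by exists w' => //; rewrite inE w'W orbT.
Qed.

Lemma pairwise_in (T : eqType) (r : rel T) (s : seq T) : symmetric r ->
  pairwise r s -> {in s &, forall x y, x != y -> r x y}.
Proof.
move=> rs; elim: s => //= a s IH /andP[/allP ra /IH H] x y.
rewrite !inE => /predU1P[->|xs] /predU1P[->|ys]; rewrite ?eqxx// => xy.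
- exact: ra.
- by rewrite rs; exact: ra.
- exact: H.
Qed.

(** * Cardinality of base nets and pruned nets *)

Section NetSize.
Context {R : realType} {n : nat} (q : 'rV[int]_n -> R) (gamma : R).
Implicit Types (z w d : 'rV[int]_n) (W O D : seq 'rV[int]_n) (v s t b sg : R).
Hypotheses (q_ge0 : forall z, 0 <= q z) (qD : forall z w, q (z + w) <= q z + q w).
Hypothesis q_0 : q 0 = 0.
Hypothesis pack : forall W b s (m : nat), uniq W -> 0 <= b -> 0 < s -> (0 < m)%N ->
  8 * (b + s) <= m%:R * s -> (forall w, w \in W -> q w <= b) ->
  {in W &, forall w w', w != w' -> s < Num.max (q (w - w')) (q (w' - w))} ->
  (size W)%:R <= 3 * (m%:R / gamma) ^+ n.

(** For v >= U the gauge is dominated by v times the sup norm, so it is enough to round every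
    coordinate separately. *)
Lemma base_covers (U v : R) l : (forall z, q z <= U * mabs z) -> 0 < v -> U <= v ->
  covers q v (tau v l.+1) (tau v l.+1 / 3) (base_list (2 ^ l)%N%:Z (enum 'I_n)).
Proof.
move=> qU v0 Uv z; rewrite nrm_le => /andP[_].
pose c : int := (2 ^ l)%N%:Z.
have cR : c%:~R = 2 ^+ l :> R by rewrite /c -natrX.
rewrite /tau -mulrA ler_pM2l// exprS -cR => mz.
(* The range gives |z_i| <= 3c/2, and rounding to the nearest of -c, 0, c leaves an error of at most
   c/2 = (2c)(3/4)/3. *)
pose a i : int := if c < 2 * z 0 i then 1 else if 2 * z 0 i < - c then -1 else 0.
have zc i : `|2 * z 0 i| <= 3 * c.
  have := le_trans (mabs_ge z i) mz.
  rewrite -intr_norm => H.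
  have : (2 * `|z 0 i|)%:~R <= (3 * c)%:~R :> R by rewrite !rmorphM /=; lra.
  by rewrite ler_int normrM.
have ac i : `|2 * (z 0 i - c * a i)| <= c.
  by have := zc i; rewrite /a; case: ltP => ?; [|case: ltP => ?]; rewrite ?mulr1 ?mulrN1 ?mulr0; lia.
have := @base_list_digits n c (enum 'I_n) a (enum_uniq _).
set w := \row_i _ => wB; exists w.
  by apply: wB => i; rewrite /a; case: ifP => _; [|case: ifP => _]; rewrite !inE.
have mw : mabs (z - w) <= c%:~R / 2 :> R.
  apply: mabs_le => [|i]; first by rewrite divr_ge0// ler0z.
  rewrite !mxE mem_enum inE /= ler_pdivlMr// -[2]/(2%:~R) -[X in _ * X]ger0_norm//.
  by rewrite -normrM -intrM -intr_norm ler_int mulrC.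
have mw' : mabs (w - z) <= c%:~R / 2 :> R by rewrite -mabsN opprB.
have vE : v * (3 / 4 * (2 * c%:~R)) / 3 = v * (c%:~R / 2) by field.
have m0 := @mabs_ge0 R n.
have qv d : mabs d <= c%:~R / 2 :> R -> q d <= v * (c%:~R / 2).
  move=> md; apply: le_trans (qU d) _; apply: le_trans (_ : v * mabs d <= _).
    by rewrite ler_wpM2r.
  by rewrite ler_pM2l.
by rewrite snrm_le vE opprB !qv// ler_pM2l.
Qed.

Let sepP v sg O : pairwise (fun w w' => sg / 2 < snrm q v (w' - w)) O ->
  {in O &, forall w w', w != w' -> sg / 2 < snrm q v (w - w')}.
Proof.
move=> H x y xO yO xy; have := pairwise_in _ H xO yO xy; rewrite -snrmN opprB; apply.
by move=> a a'; rewrite -snrmN opprB.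
Qed.

Lemma separated_uniq v sg O : 0 < sg -> pairwise (fun w w' => sg / 2 < snrm q v (w' - w)) O -> uniq O.
Proof.
move=> sg0; rewrite uniq_pairwise; apply: sub_pairwise => x y /= H.
by apply: contraTneq H => ->; rewrite subrr snrm0// -leNgt divr_ge0// ltW.
Qed.

(** Here [nrm] coincides with q, so separation in the norm is separation in q and [packing] applies
    directly. *)
Lemma pruned_size_core v b sg D O m : 0 <= v -> 0 <= b -> 0 < sg -> (0 < m)%N ->
  8 * (b + sg / 2) <= m%:R * (sg / 2) -> (forall z, v * mabs z <= q z) ->
  pruned q v b sg D O -> (size O)%:R <= 3 * (m%:R / gamma) ^+ n.
Proof.
move=> v0 b0 sg0 m0 mb vq [_ Ob Os].
apply: (pack (separated_uniq sg0 Os) b0 _ m0 mb); first by rewrite divr_gt0.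
  by move=> w /Ob; rewrite nrm_le => /andP[].
move=> x y xO yO /(sepP Os xO yO); rewrite lt_max /snrm /nrm !lt_max opprB.
case/orP => /orP[->//|H]; rewrite ?orbT// ?(lt_le_trans H (vq _))// ?orbT//.
Qed.

(** Separation may come from the coordinate part of the norm, which [packing] does not see. Send
    each point to the pair of a representative in a maximal q-separated subset and the sup-norm cell
    containing it. Two points with the same pair would be within sg / 2 in both parts of the norm,
    so the map is injective. *)
Lemma pruned_size v b sg D O (m M : nat) : 0 < v -> 0 <= b -> 0 < sg -> (0 < m)%N ->
  8 * (b + sg / 4) <= m%:R * (sg / 4) -> 2 * b <= M%:R * sg ->
  pruned q v b sg D O -> (size O)%:R <= 3 * (m%:R / gamma) ^+ n * ((M + M).+1)%:R ^+ n.
Proof.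
move=> v0 b0 sg0 m0 mb Mb [_ Ob Os].
have uO := separated_uniq sg0 Os.
pose close w w' := (q (w - w') <= sg / 4) && (q (w' - w) <= sg / 4).
have cr : reflexive close by move=> w; rewrite /close subrr q_0 divr_ge0// ltW.
have cs : symmetric close by move=> w w'; rewrite /close andbC.
have [W [uW WO Ws Wc]] := greedy_separated cr cs uO.
have szW : (size W)%:R <= 3 * (m%:R / gamma) ^+ n.
  apply: (pack uW b0 _ m0 mb); first by rewrite divr_gt0.
    by move=> w /WO /Ob; rewrite nrm_le => /andP[].
  by move=> w w' wW wW' /(Ws _ _ wW wW'); rewrite negb_and -!ltNge lt_max.
(* Cells of this side have v-weighted sup diameter sg / 2, and |z_i| <= b / v leaves at most 2M + 1
   cells per coordinate. *)
pose side := sg / (2 * v).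
have side0 : 0 < side by rewrite divr_gt0// mulr_gt0.
pose ix (x : int) : int := Num.floor (x%:~R / side).
pose cell w : {ffun 'I_n -> 'I_(M + M).+1} := [ffun i => inord (absz (ix (w 0 i) + M%:Z)%R)].
have ixM w i : w \in O -> `|ix (w 0 i)| <= M%:Z.
  move=> /Ob; rewrite nrm_le => /andP[_ vb].
  have : `|(w 0 i)%:~R| <= b / v.
    by rewrite ler_pdivlMr// mulrC (le_trans _ vb)// ler_pM2l// mabs_ge.
  have bs : b / v / side <= M%:R.
    rewrite /side; have -> : b / v / (sg / (2 * v)) = 2 * b / sg by field; rewrite !gt_eqF.
    by rewrite ler_pdivrMr.
  rewrite -(ler_pM2r (_ : 0 < side^-1)) ?invr_gt0// => /le_trans/(_ bs).
  rewrite -[X in _ * X]gtr0_norm ?invr_gt0// -normrM ler_norml => /andP[H1 H2].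
  rewrite ler_norml floor_ge_int -(ler_int R) rmorphN /= H1 /=.
  by apply: le_trans (floor_le _) H2.
have cell_inj w w' : w \in O -> w' \in O -> cell w = cell w' -> v * mabs (w - w') <= sg / 2.
  move=> wO wO' /ffunP cw.
  have -> : sg / 2 = v * side by rewrite /side; field; rewrite gt_eqF.
  rewrite ler_pM2l//; apply: mabs_le => [|i]; first exact: ltW.
  have := cw i; rewrite !ffunE => /(congr1 val) /=.
  have := ixM w i wO; have := ixM w' i wO'; rewrite !ler_norml => /andP[? ?] /andP[? ?].
  rewrite !inordK; [move=> E | lia | lia].
  have {}E : ix (w 0 i) = ix (w' 0 i) by lia.
  have F (x : int) : (ix x)%:~R * side <= x%:~R /\ x%:~R < (ix x)%:~R * side + side.
    have := floor_itv (x%:~R / side : R); rewrite intrD ler_pdivlMr// ltr_pdivrMr//.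
    by rewrite mulrDl mul1r => /andP.
  have [? ?] := F (w 0 i); have := F (w' 0 i); rewrite -E => -[? ?].
  have -> : ((w - w') 0 i)%:~R = (w 0 i)%:~R - (w' 0 i)%:~R :> R.
    by rewrite !mxE intrD mulrNz.
  by apply/andP; split; lra.
pose rep w := nth 0 W (find (close w) W).
have repP w : w \in O -> rep w \in W /\ close w (rep w).
  move=> /Wc[w' wW ww]; have H : has (close w) W by apply/hasP; exists w'.
  by split; [rewrite mem_nth// -has_find | exact: nth_find].
have phi_inj : {in O &, injective (fun w => (rep w, cell w))}.
  move=> w w' wO wO' [rw cw]; apply/eqP/negPn/negP => /(sepP Os wO wO').
  apply/negP; rewrite -leNgt snrm_le (cell_inj _ _ wO wO' cw) andbT.
  have [_ /andP[A1 A2]] := repP w wO; have [_ /andP[B1 B2]] := repP w' wO'.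
  rewrite -rw in B1 B2.
  have E1 : w - w' = (w - rep w) + (rep w - w') by rewrite addrA subrK.
  have E2 : - (w - w') = (w' - rep w) + (rep w - w) by rewrite addrA subrK opprB.
  rewrite E2 E1; apply/andP; split; apply: le_trans (qD _ _) _; lra.
have : (size O <= size W * #|{ffun 'I_n -> 'I_(M + M).+1}|)%N.
  rewrite cardE -(size_allpairs pair) -(size_map (fun w => (rep w, cell w))).
  apply: uniq_leq_size; first by rewrite map_inj_in_uniq.
  move=> _ /mapP[w wO ->]; apply/allpairsP; exists (rep w, cell w); rewrite mem_enum.
  by have [] := repP w wO.
rewrite card_ffun !card_ord -(ler_nat R) natrM natrX => /le_trans; apply.
by rewrite ler_wpM2r// exprn_ge0.
Qed.

End NetSize.

(** * A timed program logic *)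

Section Wp.
Context {R : realType} {n : nat} (oracle : 'rV[R]_n -> R).
Implicit Types (s : state R) (c : cmd) (Q : state R -> Prop).

Definition wp c s (b : nat) Q :=
  exists t s', [/\ (t <= b)%N, exec oracle c s t s' & Q s'].

Lemma wp_weaken c s b b' Q Q' : wp c s b Q -> (b <= b')%N -> (forall s', Q s' -> Q' s') ->
  wp c s b' Q'.
Proof.
by move=> [t [s' [tb e q]]] bb QQ; exists t, s'; split; [exact: leq_trans bb | | exact: QQ].
Qed.

Lemma wp_le c s b b' Q : wp c s b Q -> (b <= b')%N -> wp c s b' Q.
Proof. by move=> w bb; exact: wp_weaken w bb _. Qed.

Lemma wp_seq c1 c2 s b1 b2 Q : wp c1 s b1 (fun s' => wp c2 s' b2 Q) ->
  wp (Seq c1 c2) s (b1 + b2) Q.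
Proof.
move=> [t [s1 [tb e [t' [s' [tb' e' q]]]]]]; exists (t + t')%N, s'; split => //.
  exact: leq_add.
exact: ESeq e e'.
Qed.

Lemma wp_if b c1 c2 s bd Q : wp (if do_test b s then c1 else c2) s bd Q ->
  wp (If b c1 c2) s bd.+1 Q.
Proof. by move=> [t [s1 [tb e q]]]; exists t.+1, s1; split => //; exact: EIf. Qed.

Lemma wp_skip s b Q : Q s -> wp Skip s b Q.
Proof. by move=> q; exists 0%N, s; split => //; exact: ESkip. Qed.

(** The invariant carries the number of completed passes and determines the guard from it. The loop
    therefore makes exactly m passes, which yields termination and the time bound together. *)
Lemma wp_while b c (I : nat -> state R -> Prop) m tb s Q :
  (forall k s, I k s -> do_test b s = (k < m)%N) ->
  (forall k s, (k < m)%N -> I k s -> wp c s tb (I k.+1)) ->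
  I 0%N s -> (forall s, I m s -> Q s) -> wp (While b c) s (m * tb.+1).+1 Q.
Proof.
move=> Ib Ic I0 IQ; have /(_ m) H : forall j k s, (j + k = m)%N -> I k s ->
    exists t s', [/\ (t <= j * tb.+1 + 1)%N, exec oracle (While b c) s t s' & I m s'].
  elim=> [|j IH] k s1 jk Is.
    rewrite add0n in jk; rewrite jk in Is.
    exists 1%N, s1; split => //; apply: EWhileF.
    by rewrite (Ib _ _ Is) ltnn.
  have km : (k < m)%N by rewrite -jk ltnS leq_addl.
  have [t1 [s2 [t1b e1 I2]]] := Ic _ _ km Is.
  have [|t2 [s3 [t2b e2 I3]]] := IH k.+1 s2 _ I2; first by rewrite -jk addnS.
  exists (t1 + t2).+1, s3; split => //.
    by rewrite mulSn; move: t1b t2b; move: (j * tb.+1)%N => x; lia.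
  apply: EWhileT e1 e2; by rewrite (Ib _ _ Is).
have [t [s' [tb' e Is]]] := H 0%N s (addn0 m) I0.
by exists t, s'; split; [rewrite -addn1 | | exact: IQ].
Qed.

Definition block (l : seq instr) : cmd := foldr (fun i c => Seq (Do i) c) Skip l.
Definition run (l : seq instr) s : state R :=
  foldl (fun s i => odflt s (do_instr oracle i s)) s l.
Arguments block : simpl never.
Arguments run : simpl never.
Definition flipless i := if i is Flip _ then false else true.

Lemma wp_block l s Q : all flipless l -> Q (run l s) -> wp (block l) s (size l) Q.
Proof.
elim: l s => [|i l IH] s; first by move=> _; exact: wp_skip.
rewrite /run /block /= -/(block l) -/(run l _).
move=> /andP[fi fl] q; have [t [s' [tb e q']]] := IH (odflt s (do_instr oracle i s)) fl q.
exists (1 + t)%N, s'; split => //; apply: ESeq e; apply: EDo.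
by case: i fi {q}.
Qed.

Lemma wp_cons i l s b Q : flipless i -> wp (block l) (odflt s (do_instr oracle i s)) b Q ->
  wp (block (i :: l)) s b.+1 Q.
Proof.
move=> fi [t [s' [tb e q']]]; exists (1 + t)%N, s'; split => //; apply: ESeq e; apply: EDo.
by case: i fi.
Qed.

Lemma wp_nil s b Q : Q s -> wp (block [::]) s b Q.
Proof. exact: wp_skip. Qed.

(** Routines work in high-numbered registers and callers keep their data in low ones, so
    preservation is a threshold. The tape clause records that no coin is consumed. *)
Definition frame (ki kr : nat) s s' :=
  [/\ forall i, (i < ki)%N -> ireg s' i = ireg s i,
      forall i, (i < kr)%N -> rreg s' i = rreg s i & tape s' = tape s].

Lemma frame_refl ki kr s : frame ki kr s s. Proof. by []. Qed.

Lemma frame_trans ki kr s1 s2 s3 : frame ki kr s1 s2 -> frame ki kr s2 s3 -> frame ki kr s1 s3.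
Proof.
move=> [i1 r1 t1] [i2 r2 t2]; split; last by rewrite t2.
- by move=> i ik; rewrite i2 ?i1.
- by move=> i ik; rewrite r2 ?r1.
Qed.

Lemma frame_le ki kr ki' kr' s s' : (ki' <= ki)%N -> (kr' <= kr)%N -> frame ki kr s s' -> frame ki' kr' s s'.
Proof.
move=> ii rr [i1 r1 t1]; split => // i ik; first by apply: i1; exact: leq_trans ii.
by apply: r1; exact: leq_trans rr.
Qed.

End Wp.

Ltac slia := repeat match goal with
  | H : is_true (leq _ _) |- _ => revert H
  | H : is_true (andb _ _) |- _ => revert H
  | H : is_true (negb _) |- _ => revert H
  | H : is_true (orb _ _) |- _ => revert H
  | H : @eq nat _ _ |- _ => revert H
  end; clear; lia.
Ltac istep := apply: wp_cons; [by [] |]; rewrite /= /set_ireg /set_rreg /set_imem /set_rmem /upd /=.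
Ltac isteps := repeat istep; apply: wp_nil.
Ltac iframe := let i := fresh "i" in let H := fresh "H" in
  move=> i H /=; repeat match goal with |- context [i == ?k] => rewrite (_ : (i == k) = false); [|by apply/eqP; move: H; clear; lia] end; try done.

#[global] Arguments block : simpl never.

(** * Vector routines: linear combination, dot product, sup norm *)

Section Macros.
Context {R : realType} {n : nat} (oracle : 'rV[R]_n -> R).
Implicit Types (s : state R).
Local Notation wp := (wp oracle).

(** Calling convention: index registers 40 to 43 hold the destination, the two sources and the
    length; real register 40 holds the coefficient of the second source. *)
Definition axpy : cmd :=
  Seq (block [:: ISet 44 0; ISet 46 1])
      (While (ILt 44 43) (block [:: IAdd 45 41 44; RLoad 41 45; IAdd 45 42 44; RLoad 42 45;
         RMul 42 42 40; RAdd 41 41 42; IAdd 45 40 44; RStore 45 41; IAdd 44 44 46])).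

(** Updating a source in place is allowed, because each cell is read before it is written; partial
    overlap is excluded. *)
Definition apart (d len a : nat) := [|| d == a, (a + len <= d)%N | (d + len <= a)%N].

Lemma wp_axpy_frame s d a b len : ireg s 40 = d -> ireg s 41 = a -> ireg s 42 = b -> ireg s 43 = len ->
  apart d len a -> apart d len b ->
  wp axpy s (10 * len + 3) (fun s' => [/\ frame 44 41 s s', imem s' = imem s,
    forall i, i != 41%N -> i != 42%N -> rreg s' i = rreg s i &
    rmem s' = fun x => if (d <= x < d + len)%N
      then rmem s (a + (x - d))%N + rreg s 40 * rmem s (b + (x - d))%N else rmem s x]).
Proof.
move=> hd ha hb hl da db.
apply: (@wp_weaken _ _ _ _ _ (2 + (len * 10).+1)); last 2 first.
- by rewrite mulnC; lia.
- by move=> s'; exact.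
apply: wp_seq; isteps.
pose I k s' := [/\ ireg s' 44 = k /\ ireg s' 46 = 1%N, frame 44 41 s s', imem s' = imem s /\
  (forall i, i != 41%N -> i != 42%N -> rreg s' i = rreg s i) &
  rmem s' = fun x => if (d <= x < d + k)%N
      then rmem s (a + (x - d))%N + rreg s 40 * rmem s (b + (x - d))%N else rmem s x].
apply: (wp_while (I := I)).
- by move=> k s' [[h44 h46] [fi fr ft] _ _] /=; rewrite h44 fi// hl.
- move=> k s' kl [[h44 h46] [fi fr ft] [im rr] mem]. isteps.
  split => /=; first by rewrite h44 h46 addn1.
  - by split => //=; iframe; [exact: fi | exact: fr].
  - by split => // i i1 i2 /=; rewrite !ifF ?rr//; apply/negbTE.
  apply/funext => x; rewrite h44 !fi// !fr// ha hb hd mem.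
  have -> : (d <= x < d + k.+1)%N = (x == d + k)%N || (d <= x < d + k)%N by apply/idP/idP; lia.
  case: eqP => [->|_] //=.
  move: da db; rewrite /apart => da db.
  have -> : (d <= a + k < d + k)%N = false by apply/negbTE; lia.
  have -> : (d <= b + k < d + k)%N = false by apply/negbTE; lia.
  by rewrite addKn [X in _ + X]mulrC.
- split => //=; first by split => //=; iframe.
  by apply/funext => x; rewrite ifF//; apply/negbTE; lia.
- by move=> s' [_ [fi fr ft] [im rr] mem].
Qed.

Lemma wp_axpy s d a b len : ireg s 40 = d -> ireg s 41 = a -> ireg s 42 = b -> ireg s 43 = len ->
  apart d len a -> apart d len b ->
  wp axpy s (10 * len + 3) (fun s' => [/\ frame 44 41 s s', imem s' = imem s &
    rmem s' = fun x => if (d <= x < d + len)%N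
      then rmem s (a + (x - d))%N + rreg s 40 * rmem s (b + (x - d))%N else rmem s x]).
Proof.
by move=> h1 h2 h3 h4 h5 h6; apply: wp_weaken (wp_axpy_frame h1 h2 h3 h4 h5 h6) (leqnn _) _ => s' [].
Qed.

Definition dot : cmd :=
  Seq (block [:: RSet 40 0; ISet 44 0; ISet 46 1])
      (While (ILt 44 42) (block [:: IAdd 45 40 44; RLoad 41 45; IAdd 45 41 44; RLoad 42 45;
         RMul 42 42 41; RAdd 40 40 42; IAdd 44 44 46])).

Lemma wp_dot s a b len : ireg s 40 = a -> ireg s 41 = b -> ireg s 42 = len ->
  wp dot s (8 * len + 4) (fun s' => [/\ frame 44 40 s s', imem s' = imem s, rmem s' = rmem s &
    rreg s' 40 = \sum_(i < len) rmem s (a + i)%N * rmem s (b + i)%N]).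
Proof.
move=> ha hb hl.
apply: (@wp_weaken _ _ _ _ _ (3 + (len * 8).+1)); last 2 first.
- by rewrite mulnC; lia.
- by move=> s'; exact.
apply: wp_seq; isteps.
pose I k s' := [/\ ireg s' 44 = k /\ ireg s' 46 = 1%N, frame 44 40 s s', imem s' = imem s,
  rmem s' = rmem s & rreg s' 40 = \sum_(i < k) rmem s (a + i)%N * rmem s (b + i)%N].
apply: (wp_while (I := I)).
- by move=> k s' [[h44 h46] [fi fr ft] _ _ _] /=; rewrite h44 fi// hl.
- move=> k s' kl [[h44 h46] [fi fr ft] im mem r40]. isteps.
  split => //=; first by rewrite h44 h46 addn1.
  - by split => //=; iframe; [exact: fi | exact: fr].
  by rewrite r40 big_ord_recr /= mem h44 !fi// ha hb [X in _ + X]mulrC.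
- split => //=; [split => //=; iframe | by rewrite big_ord0].
- by move=> s' [_ [fi fr ft] im mem].
Qed.

Lemma bigmaxS (F : nat -> R) k : (forall i, 0 <= F i) ->
  \big[Num.max/0]_(i < k.+1) F i = Num.max (\big[Num.max/0]_(i < k) F i) (F k).
Proof.
move=> F0; apply/le_anti/andP; split.
  apply: bigmax_le => [|i _]; first by rewrite le_max F0 orbT.
  have := ltn_ord i; rewrite ltnS leq_eqVlt le_max => /predU1P[->|ik]; first by rewrite lexx orbT.
  by rewrite (@le_bigmax _ _ _ 0 (fun i : 'I_k => F i) (Ordinal ik)).
rewrite ge_max; apply/andP; split.
  apply: bigmax_le => [|i _]; first exact: bigmax_ge_id.
  exact: (@le_bigmax _ _ _ 0 (fun i : 'I_k.+1 => F i) (widen_ord (leqnSn k) i)).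
exact: (@le_bigmax _ _ _ 0 (fun i : 'I_k.+1 => F i) ord_max).
Qed.

Definition rcopy (d a : nat) := [:: RSet d 0; RAdd d d a].

(** There is no absolute value instruction, so each entry and its negative are compared with the
    running maximum in real register 43. *)
Definition maxabs : cmd :=
  Seq (block [:: RSet 43 0; ISet 44 0; ISet 46 1])
      (While (ILt 44 0) (Seq (block [:: IAdd 45 40 44; RLoad 41 45; RSet 42 0; RSub 42 42 41])
         (Seq (If (RLt 43 41) (block (rcopy 43 41)) Skip)
         (Seq (If (RLt 43 42) (block (rcopy 43 42)) Skip)
         (block [:: IAdd 44 44 46]))))).

Lemma wp_maxabs s a len : ireg s 40 = a -> ireg s 0 = len ->
  wp maxabs s (12 * len + 4) (fun s' => [/\ frame 44 40 s s', imem s' = imem s, rmem s' = rmem s &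
    rreg s' 43 = \big[Num.max/0]_(i < len) `|rmem s (a + i)%N| ]).
Proof.
move=> ha hl.
apply: (@wp_weaken _ _ _ _ _ (3 + (len * 12).+1)); last 2 first.
- by rewrite mulnC; lia.
- by move=> s'; exact.
apply: wp_seq; isteps.
pose I k s' := [/\ ireg s' 44 = k /\ ireg s' 46 = 1%N, frame 44 40 s s', imem s' = imem s,
  rmem s' = rmem s & rreg s' 43 = \big[Num.max/0]_(i < k) `|rmem s (a + i)%N| ].
apply: (wp_while (I := I)).
- by move=> k s' [[h44 h46] [fi fr ft] _ _ _] /=; rewrite h44 fi// hl.
- move=> k s' kl [[h44 h46] [fi fr ft] im mem r43].
  apply: (@wp_weaken _ _ _ _ _ (4 + (3 + (3 + 1))) _ (I k.+1)) => //.
  apply: wp_seq; isteps.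
  set x := rmem s' _; rewrite sub0r.
  have xE : x = rmem s (a + k)%N by rewrite /x fi// ha h44 mem.
  have fin s2 : frame 44 40 s s2 -> ireg s2 44 = k -> ireg s2 46 = 1%N -> imem s2 = imem s ->
      rmem s2 = rmem s -> rreg s2 43 = Num.max (rreg s' 43) `|x| ->
      wp (block [:: IAdd 44 44 46]) s2 1 (I k.+1).
    move=> [fi2 fr2 ft2] k2 o2 im2 mem2 r2; isteps; split => //=; first by rewrite k2 o2 addn1.
    - by split => //=; iframe; exact: fi2.
    - by rewrite r2 r43 (bigmaxS (F := fun i => `|rmem s (a + i)%N|))// xE.
  have M0 : 0 <= rreg s' 43 by rewrite r43; exact: bigmax_ge_id.
  apply: wp_seq; apply: wp_if => /=.
  have [x1|x1] := ltP (rreg s' 43) x.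
    have ax : `|x| = x by rewrite ger0_norm// (le_trans M0)// ltW.
    isteps; apply: wp_seq; apply: wp_if => /=; rewrite add0r ltNge.
    have -> /= : - x <= x by lra.
    apply: wp_skip; apply: fin => //=; last by rewrite ax (max_idPr (ltW x1)).
    by split => //=; iframe; [exact: fi | exact: fr].
  apply: wp_skip; apply: wp_seq; apply: wp_if => /=.
  have [x2|x2] := ltP (rreg s' 43) (- x).
    isteps; apply: fin => //=.
      by split => //=; iframe; [exact: fi | exact: fr].
    by rewrite add0r (max_idPr _) ?ltr0_norm ?(ltW x2)//; lra.
  apply: wp_skip; apply: fin => //=.
    by split => //=; iframe; [exact: fi | exact: fr].
  by rewrite (max_idPl _)// ler_norml x1 andbT; lra.
- by split => //=; [split => //=; iframe | rewrite big_ord0].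
- by move=> s' [_ [fi fr ft] im mem].
Qed.

End Macros.

(** * Memory layout of lattice vectors *)

Section Encoding.
Context {R : realType} {n : nat} (Br : 'M[R]_n).
Implicit Types (z w : 'rV[int]_n) (m : nat -> R).

Definition rowfun k (x : 'rV[R]_k) (i : nat) : R := if insub i is Some j then x 0 j else 0.

Lemma rowfunE k (x : 'rV[R]_k) (j : 'I_k) : rowfun x j = x 0 j.
Proof. by rewrite /rowfun valK. Qed.

Definition latpt z : 'rV[R]_n := map_mx intr z *m Br.
(** A vector is stored with both its integer coordinates and its point in space. One linear
    combination updates the two halves, so neither a product with the basis nor the solution of a
    linear system is ever needed again. *)
Definition enc z : nat -> R := rowfun (row_mx (map_mx intr z) (latpt z)).

Lemma latptD z w : latpt (z + w) = latpt z + latpt w.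
Proof. by rewrite /latpt map_mxD mulmxDl. Qed.

Lemma latptN z : latpt (- z) = - latpt z.
Proof. by rewrite /latpt map_mxN mulNmx. Qed.

Lemma latptMz z (c : int) : latpt (c *: z) = c%:~R *: latpt z.
Proof. by rewrite /latpt map_mxZ scalemxAl. Qed.

Lemma enc_lin z w (c : int) i : enc (z + c *: w) i = enc z i + c%:~R * enc w i.
Proof.
rewrite /enc /rowfun; case: (insub i : option 'I_(n + n)) => [j|]; last by rewrite mulr0 addr0.
case: (split_ordP j) => k ->; rewrite ?row_mxEl ?row_mxEr ?latptD ?latptMz !mxE//.
by rewrite intrD intrM.
Qed.

Lemma enc_coord z (k : 'I_n) : enc z k = (z 0 k)%:~R.
Proof.
have -> : (k : nat) = lshift n k :> nat by [].
by rewrite /enc rowfunE row_mxEl mxE.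
Qed.

Lemma enc_pt z (k : 'I_n) : enc z (n + k) = latpt z 0 k.
Proof.
have -> : (n + k)%N = rshift n k :> nat by [].
by rewrite /enc rowfunE row_mxEr.
Qed.

Definition stored m a z := forall i, (i < n + n)%N -> m (a + i)%N = enc z i.

Definition vlist m a (W : seq 'rV[int]_n) :=
  forall k, (k < size W)%N -> stored m (a + (n + n) * k)%N (nth 0 W k).

Lemma stored_frame m m' a z : (forall i, (i < n + n)%N -> m' (a + i)%N = m (a + i)%N) ->
  stored m a z -> stored m' a z.
Proof. by move=> H st i il; rewrite H// st. Qed.

Lemma stored_below m m' h a z : (forall i, (i < h)%N -> m' i = m i) ->
  (a + (n + n) <= h)%N -> stored m a z -> stored m' a z.
Proof. by move=> H ah; apply: stored_frame => i il; apply: H; apply: leq_trans ah; rewrite ltn_add2l. Qed.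

Lemma vlist_below m m' h a W : (forall i, (i < h)%N -> m' i = m i) ->
  (a + (n + n) * size W <= h)%N -> vlist m a W -> vlist m' a W.
Proof.
move=> H ah vl k kW; apply: stored_below H _ (vl k kW).
apply: leq_trans ah; rewrite -addnA leq_add2l -mulnSr leq_mul2l kW orbT//.
Qed.

Lemma vlist_rcons m a W z : vlist m a W -> stored m (a + (n + n) * size W)%N z ->
  vlist m a (rcons W z).
Proof.
move=> vl st k; rewrite size_rcons ltnS leq_eqVlt nth_rcons => /predU1P[->|kW].
  by rewrite ltnn eqxx.
by rewrite kW; exact: vl.
Qed.

Lemma stored_mabs m a z : stored m a z -> \big[Num.max/0]_(i < n) `|m (a + i)%N| = mabs z.
Proof.
move=> st; apply: eq_bigr => i _.
by rewrite st ?enc_coord// (leq_trans (ltn_ord i))// leq_addr.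
Qed.

Lemma stored_rvec (s : state R) a z : stored (rmem s) a z -> rvec (n := n) s (a + n) = latpt z.
Proof.
by move=> st; apply/rowP => k; rewrite mxE -addnA st ?ltn_add2l// enc_pt.
Qed.

End Encoding.

(** * The pruning program *)

Section Prune.
Context {R : realType} {n : nat} (oracle : 'rV[R]_n -> R) (Br : 'M[R]_n).
Variables (q : 'rV[int]_n -> R) (zmax dl : R) (tg : nat) (gcmd : cmd) (env : state R -> Prop).
Implicit Types (z w u : 'rV[int]_n) (s : state R).
Local Notation wp := (wp oracle).
Local Notation stored := (stored Br).
Local Notation vlist := (vlist Br).
Hypothesis q_ge0 : forall z, 0 <= q z.
Hypothesis dl01 : 0 <= dl <= 1.
Hypothesis env_frame : forall s s', frame 20 20 s s' -> env s -> env s'.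
Hypothesis envE : forall s, env s -> ireg s 0 = n /\ ireg s 1 = (n + n)%N.

(** Index register 39 marks the beginning of the scratch space that an evaluation of the norm may
    overwrite. *)
Definition keeps s s' := [/\ frame 40 39 s s', imem s' = imem s & forall a, (a < ireg s 39)%N -> rmem s' a = rmem s a].

Hypothesis gauge_spec : forall s z, env s -> stored (rmem s) (ireg s 38) z -> mabs z <= zmax ->
  (ireg s 38 + (n + n) <= ireg s 39)%N ->
  wp gcmd s tg (fun s' => keeps s s' /\ q z <= rreg s' 39 <= (1 + dl) * q z).

(** Evaluates the interpolated norm of the vector at the address in index register 38, with v in
    real register 7 and the result in real register 39. The coordinate part is exact, so the maximum
    inherits the relative error of the gauge. *)
Definition nu : cmd :=
  Seq gcmd (Seq (block [:: ISet 40 0; IAdd 40 38 40]) (Seq maxabs (Seq (block [:: RMul 43 43 7])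
   (If (RLt 39 43) (block (rcopy 39 43)) Skip)))).

Lemma wp_nu s z : env s -> stored (rmem s) (ireg s 38) z -> mabs z <= zmax -> 0 <= rreg s 7 ->
  (ireg s 38 + (n + n) <= ireg s 39)%N ->
  wp nu s (tg + 12 * n + 10) (fun s' => keeps s s' /\
    nrm q (rreg s 7) z <= rreg s' 39 <= (1 + dl) * nrm q (rreg s 7) z).
Proof.
move=> es st zm v0 sep.
apply: (@wp_le _ _ _ _ _ (tg + (2 + (12 * n + 4 + (1 + 3))))); last by lia.
apply: wp_seq; apply: wp_weaken (gauge_spec es st zm sep) (leqnn _) _.
move=> s1 [[[fi fr ft] im1 m1] g1]; apply: wp_seq; isteps.
have [n1 _] := envE es.
apply: wp_seq; apply: wp_weaken (@wp_maxabs _ _ _ _ (ireg s 38) n _ _) (leqnn _) _ => /=.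
- by rewrite addn0 fi.
- by rewrite fi.
move=> s3 [[fi3 fr3 ft3] im3 m3 r3]; apply: wp_seq; isteps.
apply: wp_if => /=.
have st2 : stored (rmem s1) (ireg s 38) z by exact: stored_below m1 sep st.
rewrite (stored_mabs st2) in r3.
have r7 : rreg s3 7 = rreg s 7 by rewrite fr3 //= fr.
have r39 : rreg s3 39 = rreg s1 39 by rewrite fr3.
have kp s4 : frame 40 39 s3 s4 -> imem s4 = imem s3 -> rmem s4 = rmem s3 -> keeps s s4.
  move=> [fi4 fr4 ft4] im4 m4; split; first split.
  - by move=> i ik; rewrite fi4// fi3 /= ?(leq_trans ik)// !ifF ?fi//; apply/negbTE; lia.
  - by move=> i ik; rewrite fr4// fr3 /= ?(leq_trans ik)// fr.
  - by rewrite ft4 ft3.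
  - by rewrite im4 im3.
  - by move=> a ah; rewrite m4 m3 /= m1.
rewrite r3 r7 r39 mulrC.
case/andP: g1 => g1 g2; case/andP: dl01 => dl0 dl1.
have vm : 0 <= rreg s 7 * mabs z by rewrite mulr_ge0 ?mabs_ge0.
rewrite /nrm; have [lt|le] := ltP (rreg s1 39) (rreg s 7 * mabs z).
  isteps; split; first by apply: kp => //=; split => //=; iframe.
  rewrite /= add0r ge_max lexx (le_trans g1 (ltW lt)) andbT /=.
  apply: (@le_trans _ _ ((1 + dl) * (rreg s 7 * mabs z))).
    by rewrite mulrDl mul1r lerDl mulr_ge0.
  by rewrite ler_wpM2l ?addr_ge0// le_max lexx orbT.
apply: wp_skip; split; first by apply: kp => //=; split => //=; iframe.
rewrite /= r39 ge_max g1 le /= (le_trans g2)// ler_wpM2l ?addr_ge0// le_max lexx //.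
Qed.
End Prune.

Definition framex {R : realType} (ex : seq nat) (ki kr : nat) (s s' : state R) :=
  [/\ forall i, (i < ki)%N && (i \notin ex) -> ireg s' i = ireg s i,
      forall i, (i < kr)%N -> rreg s' i = rreg s i & tape s' = tape s].

Lemma framex_trans (R : realType) ex ki kr (s1 s2 s3 : state R) :
  framex ex ki kr s1 s2 -> framex ex ki kr s2 s3 -> framex ex ki kr s1 s3.
Proof.
move=> [i1 r1 t1] [i2 r2 t2]; split; last by rewrite t2.
- by move=> i ik; rewrite i2 ?i1.
- by move=> i ik; rewrite r2 ?r1.
Qed.

Ltac iframex := let i := fresh "i" in let H := fresh "H" in
  move=> i H /=; rewrite ?inE in H;
  repeat match goal with |- context [i == ?k] => rewrite (_ : (i == k) = false); [|by apply/eqP; move: H; clear; lia] end;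
  try done.

(** Compares the candidate at the top of the heap with one element of the output list. Both
    differences are formed because the gauge is asymmetric, and flag 30 drops to 0 exactly when both
    estimates are at most the threshold in real register 21. *)
Definition scan_body (nu : cmd) : cmd :=
  Seq (block [:: RSet 40 0; RSet 41 1; RSub 40 40 41; IAdd 40 31 36; IAdd 41 28 36; IAdd 42 29 36; IAdd 43 1 36])
  (Seq axpy
  (Seq (block [:: RSet 40 0; RSet 41 1; RSub 40 40 41; IAdd 40 32 36; IAdd 41 29 36; IAdd 42 28 36; IAdd 43 1 36])
  (Seq axpy
  (Seq (block [:: IAdd 38 31 36; IAdd 39 33 36])
  (Seq nu
  (Seq (If (RLt 21 39) Skip
         (Seq (block [:: IAdd 38 32 36]) (Seq nu (If (RLt 21 39) Skip (block [:: ISet 30 0])))))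
  (block [:: IAdd 29 29 1]))))))).

Section Scan.
Context {R : realType} {n : nat} (oracle : 'rV[R]_n -> R) (Br : 'M[R]_n).
Variables (q : 'rV[int]_n -> R) (zmax dl : R) (tn : nat) (nu : cmd) (env : state R -> Prop).
Implicit Types (z w u : 'rV[int]_n) (s : state R).
Local Notation wp := (wp oracle).
Local Notation stored := (stored Br).
Local Notation vlist := (vlist Br).
Hypothesis q_ge0 : forall z, 0 <= q z.
Hypothesis dl01 : 0 <= dl <= 1.
Hypothesis env_frame : forall s s', frame 20 20 s s' -> env s -> env s'.
Hypothesis envE : forall s, env s -> ireg s 0 = n /\ ireg s 1 = (n + n)%N.
Hypothesis nu_spec : forall s z, env s -> stored (rmem s) (ireg s 38) z -> mabs z <= zmax ->
  0 <= rreg s 7 -> (ireg s 38 + (n + n) <= ireg s 39)%N ->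
  wp nu s tn (fun s' => keeps s s' /\
    nrm q (rreg s 7) z <= rreg s' 39 <= (1 + dl) * nrm q (rreg s 7) z).
Local Notation L := (n + n)%N.

(** Overestimation is by a factor at most 1 + dl <= 2; this is the origin of the halved thresholds
    in [pruned]. *)
Lemma nrm_approx_gt v z (x y : R) : y < x -> x <= (1 + dl) * nrm q v z -> y / 2 < nrm q v z.
Proof.
move=> yx xz; rewrite ltr_pdivrMr//; apply: lt_le_trans yx _; apply: le_trans xz _.
by rewrite mulrC ler_wpM2l ?nrm_ge0//; case/andP: dl01; lra.
Qed.

Lemma stored_sub m a b d u w : stored m a u -> stored m b w ->
  stored (fun x => if (d <= x < d + L)%N then m (a + (x - d))%N + -1 * m (b + (x - d))%N else m x)
    d (u - w).
Proof.
move=> su sw i il.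
have -> : (d <= d + i < d + L)%N by rewrite leq_addr ltn_add2l.
have -> : u - w = u + (-1) *: w by rewrite scaleN1r.
by rewrite addKn su// sw// enc_lin rmorphN1.
Qed.

Lemma env_framex ex s s' : all (fun i => (20 <= i)%N) ex -> framex ex 40 39 s s' -> env s -> env s'.
Proof.
move=> exl [fi fr ft]; apply: env_frame; split => // i i20; last by rewrite fr// (leq_trans i20).
apply: fi; rewrite (leq_trans i20)//=; apply: contraTN i20 => /(allP exl).
by rewrite leqNgt.
Qed.

Lemma wp_scan_body s u w h o : env s -> 0 <= rreg s 7 ->
  ireg s 28 = h -> ireg s 31 = (h + L)%N -> ireg s 32 = (h + L + L)%N ->
  ireg s 33 = (h + L + L + L)%N -> ireg s 36 = 0%N -> ireg s 29 = o -> (o + L <= h)%N ->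
  stored (rmem s) h u -> stored (rmem s) o w -> mabs (u - w) <= zmax ->
  wp (scan_body nu) s (20 * L + 2 * tn + 30) (fun s' =>
    [/\ framex [:: 29; 30; 38; 39] 40 39 s s', imem s' = imem s,
        forall a, (a < h + L)%N -> rmem s' a = rmem s a, ireg s' 29 = (o + L)%N &
        (ireg s' 30 = 0%N /\ snrm q (rreg s 7) (u - w) <= rreg s 21) \/
        (ireg s' 30 = ireg s 30 /\ rreg s 21 / 2 < snrm q (rreg s 7) (u - w))]).
Proof.
move=> es v0 hh h1 h2 h3 h36 ho oh su sw zm.
have [_ eL] := envE es.
apply: (@wp_le _ _ _ _ _ (7 + (10 * L + 3 + (7 + (10 * L + 3 + (2 + (tn + ((1 + (tn + 2)).+1 + 1)))))))); last slia.
apply: wp_seq; isteps.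
apply: wp_seq; apply: wp_weaken (@wp_axpy _ _ _ _ (h + L)%N h o L _ _ _ _ _ _) (leqnn _) _;
  rewrite /= ?h1 ?hh ?ho ?eL ?h36 ?addn0// /apart ?leqnn ?orbT//; try by (apply/orP; right; apply/orP; left; slia).
move=> s1 [[/= fi1 fr1 ft1] im1 m1].
apply: wp_seq; isteps.
have e1 i : (i < 40)%N -> ireg s1 i = ireg s i.
  by move=> ik; rewrite fi1 ?(leq_trans ik)//= !ifF//; apply/negbTE; slia.
have r1 i : (i < 40)%N -> rreg s1 i = rreg s i.
  by move=> ik; rewrite fr1 ?(leq_trans ik)//= !ifF//; apply/negbTE; slia.
apply: wp_seq; apply: wp_weaken (@wp_axpy _ _ _ _ (h + L + L)%N o h L _ _ _ _ _ _) (leqnn _) _;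
  rewrite /= ?e1// ?h2 ?hh ?ho ?eL ?h36 ?addn0// /apart; try by (apply/orP; right; apply/orP; left; slia).
move=> s2 [[/= fi2 fr2 ft2] im2 m2].
have e2 i : (i < 40)%N -> ireg s2 i = ireg s i.
  move=> ik; rewrite fi2 ?(leq_trans ik)//= !ifF ?e1//; apply/negbTE; slia.
have r2 i : (i < 40)%N -> rreg s2 i = rreg s i.
  move=> ik; rewrite fr2 ?(leq_trans ik)//= !ifF ?r1//; apply/negbTE; slia.
have mlow a : (a < h + L)%N -> rmem s2 a = rmem s a.
  by move=> ah; rewrite m2 m1 /= !ifF//; apply/negbTE; slia.
rewrite sub0r in m1; rewrite /= sub0r in m2.
have su1 : stored (rmem s1) h u by apply: stored_frame su => i il; rewrite m1 ifF//; apply/negbTE; slia.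
have sw1 : stored (rmem s1) o w by apply: stored_frame sw => i il; rewrite m1 ifF//; apply/negbTE; slia.
have sd2 : stored (rmem s2) (h + L + L)%N (w - u) by rewrite m2; exact: stored_sub.
have sd1 : stored (rmem s2) (h + L)%N (u - w).
  have : stored (rmem s1) (h + L)%N (u - w) by rewrite m1; exact: stored_sub.
  by apply: stored_frame => i il; rewrite m2 ifF//; apply/negbTE; slia.
have zm' : mabs (w - u) <= zmax by rewrite -opprB mabsN.
have frs : framex [:: 29; 30; 38; 39] 40 39 s s2.
  split; last by rewrite ft2 /= ft1.
  - by move=> i /andP[ik _]; exact: e2.
  - by move=> i ik; rewrite r2// (leq_trans ik).
apply: wp_seq; isteps.
set s3 := State _ _ _ _ _.
have frs3 : framex [:: 29; 30; 38; 39] 40 39 s s3.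
  by apply: framex_trans frs _; split => //=; iframex.
have m3 : rmem s3 = rmem s2 by [].
have im3 : imem s3 = imem s by rewrite /= im2 /= im1.
have h38 : ireg s3 38 = (h + L)%N by rewrite /= !e2// h1 h36 addn0.
have h39 : ireg s3 39 = (h + L + L + L)%N by rewrite /= !e2// h3 h36 addn0.
have h329 : ireg s3 29 = o by rewrite /= !e2.
have h330 : ireg s3 30 = ireg s 30 by rewrite /= !e2.
clearbody s3; move: frs3 => /[dup] frs3 [fi3 fr3 ft3].
have r37 : rreg s3 7 = rreg s 7 by rewrite fr3.
have es3 : env s3 by apply: env_framex frs3 es.
apply: wp_seq; apply: wp_weaken (@nu_spec s3 (u - w) es3 _ zm _ _) (leqnn _) _.
- by rewrite h38 m3.
- by rewrite r37.
- by rewrite h38 h39; slia.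
move=> s4 [[[fi4 fr4 ft4] im4 m4] /andP[g4 g4']]; rewrite r37 in g4 g4'.
have frs4 : framex [:: 29; 30; 38; 39] 40 39 s s4.
  by apply: framex_trans frs3 _; split => // i /andP[ik _]; exact: fi4.
have fin s5 : framex [:: 29; 30; 38; 39] 40 39 s s5 -> imem s5 = imem s ->
    (forall a, (a < h + L)%N -> rmem s5 a = rmem s a) -> ireg s5 29 = o ->
    (ireg s5 30 = 0%N /\ snrm q (rreg s 7) (u - w) <= rreg s 21) \/
        (ireg s5 30 = ireg s 30 /\ rreg s 21 / 2 < snrm q (rreg s 7) (u - w)) ->
    wp (block [:: IAdd 29 29 1]) s5 1 (fun s' =>
    [/\ framex [:: 29; 30; 38; 39] 40 39 s s', imem s' = imem s,
        forall a, (a < h + L)%N -> rmem s' a = rmem s a, ireg s' 29 = (o + L)%N &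
        (ireg s' 30 = 0%N /\ snrm q (rreg s 7) (u - w) <= rreg s 21) \/
        (ireg s' 30 = ireg s 30 /\ rreg s 21 / 2 < snrm q (rreg s 7) (u - w))]).
  move=> fr5 im5 m5 o5 c5; isteps; split => //=.
  - by apply: framex_trans fr5 _; split => //=; iframex.
  - by case: fr5 => fi5 _ _; rewrite o5 fi5// eL.
have m4' a : (a < h + L)%N -> rmem s4 a = rmem s a.
  by move=> ah; rewrite m4 ?h39 ?m3 ?mlow//; slia.
have o4 : ireg s4 29 = o by rewrite fi4.
have r421 : rreg s4 21 = rreg s 21 by case: frs4 => _ ->.
have im4' : imem s4 = imem s by rewrite im4.
apply: wp_seq; apply: wp_if => /=; rewrite r421.
have [lt|le] := ltP (rreg s 21) (rreg s4 39).
  apply: wp_skip; apply: fin => //; right; split; first by rewrite fi4.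
  by apply: lt_le_trans (nrm_approx_gt lt g4') _; exact: nrm_le_snrm.
apply: wp_seq; isteps.
have [fi4' fr4' ft4'] := frs4.
set s5 := State _ _ _ _ _.
have frs5 : framex [:: 29; 30; 38; 39] 40 39 s s5.
  by apply: framex_trans frs4 _; split => //=; iframex.
have h538 : ireg s5 38 = (h + L + L)%N by rewrite /= !fi4'// h2 h36 addn0.
have h539 : ireg s5 39 = (h + L + L + L)%N by rewrite /= fi4.
have h529 : ireg s5 29 = o by rewrite /= o4.
have h530 : ireg s5 30 = ireg s 30 by rewrite /= fi4.
have m5 : rmem s5 = rmem s4 by [].
have im5 : imem s5 = imem s by [].
clearbody s5; move: frs5 => /[dup] frs5 [fi5 fr5 ft5].
have r57 : rreg s5 7 = rreg s 7 by rewrite fr5.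
have es5 : env s5 by apply: env_framex frs5 es.
apply: wp_seq; apply: wp_weaken (@nu_spec s5 (w - u) es5 _ zm' _ _) (leqnn _) _.
- rewrite h538 m5; apply: (@stored_below _ _ _ _ _ (h + L + L + L)%N) _ _ sd2 => //.
  by move=> i ih; rewrite m4 ?h39// m3.
- by rewrite r57.
- by rewrite h538 h539; slia.
move=> s6 [[[fi6 fr6 ft6] im6 m6] /andP[g6 g6']]; rewrite r57 in g6 g6'.
have frs6 : framex [:: 29; 30; 38; 39] 40 39 s s6.
  by apply: framex_trans frs5 _; split => // i /andP[ik _]; exact: fi6.
have r621 : rreg s6 21 = rreg s 21 by case: frs6 => _ ->.
have m6' a : (a < h + L)%N -> rmem s6 a = rmem s a.
  by move=> ah; rewrite m6 ?h539 ?m5 ?m4'//; slia.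
have im6' : imem s6 = imem s by rewrite im6.
have o6 : ireg s6 29 = o by rewrite fi6.
apply: wp_if => /=; rewrite r621.
have [lt|le'] := ltP (rreg s 21) (rreg s6 39).
  apply: wp_skip; apply: fin => //; right; split; first by rewrite fi6.
  apply: lt_le_trans (nrm_approx_gt lt g6') _.
  by rewrite -opprB /snrm le_max lexx orbT.
isteps; apply: fin; rewrite /=.
- by apply: framex_trans frs6 _; split => //=; iframex.
- exact: im6'.
- exact: m6'.
- exact: o6.
left; split => //; rewrite ge_max opprB; apply/andP; split; first exact: le_trans g4 le.
exact: le_trans g6 le'.
Qed.

End Scan.

(** The candidate x + y is written just past the output list. Accepting it only means advancing
    register 28; a rejected candidate is overwritten by the next one. *)
Definition pair_cmd (nu : cmd) : cmd :=
  Seq (block [:: IAdd 31 28 1; IAdd 32 31 1; IAdd 33 32 1; ISet 36 0;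
        IAdd 40 28 36; IAdd 41 23 36; IAdd 42 25 36; IAdd 43 1 36; RSet 40 1])
  (Seq axpy
  (Seq (block [:: IAdd 38 28 36; IAdd 39 33 36])
  (Seq nu
  (Seq (block [:: ISet 30 1; IAdd 29 27 36])
  (Seq (If (RLt 20 39) (block [:: ISet 30 0]) Skip)
  (Seq (While (ILt 29 28) (scan_body nu))
  (If (ILt 36 30) (block [:: IAdd 28 28 1]) Skip))))))).

Definition prune_step {R : realType} {n : nat} (q : 'rV[int]_n -> R) (v b sg : R) (u : 'rV[int]_n)
    (O O' : seq 'rV[int]_n) :=
  (O' = O /\ (nrm q v u <= b / 2 -> exists2 w, w \in O & snrm q v (u - w) <= sg)) \/
  [/\ O' = rcons O u, nrm q v u <= b & all (fun w => sg / 2 < snrm q v (u - w)) O].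

Section Pair.
Context {R : realType} {n : nat} (oracle : 'rV[R]_n -> R) (Br : 'M[R]_n).
Variables (q : 'rV[int]_n -> R) (zmax dl : R) (tn : nat) (nu : cmd) (env : state R -> Prop).
Implicit Types (z w u : 'rV[int]_n) (s : state R).
Local Notation wp := (wp oracle).
Local Notation stored := (stored Br).
Local Notation vlist := (vlist Br).
Hypothesis n_gt0 : (0 < n)%N.
Hypothesis q_ge0 : forall z, 0 <= q z.
Hypothesis dl01 : 0 <= dl <= 1.
Hypothesis env_frame : forall s s', frame 20 20 s s' -> env s -> env s'.
Hypothesis envE : forall s, env s -> ireg s 0 = n /\ ireg s 1 = (n + n)%N.
Hypothesis nu_spec : forall s z, env s -> stored (rmem s) (ireg s 38) z -> mabs z <= zmax ->
  0 <= rreg s 7 -> (ireg s 38 + (n + n) <= ireg s 39)%N ->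
  wp nu s tn (fun s' => keeps s s' /\
    nrm q (rreg s 7) z <= rreg s' 39 <= (1 + dl) * nrm q (rreg s 7) z).
Local Notation L := (n + n)%N.

Lemma wp_pair s x y O h a b o0 : env s -> 0 <= rreg s 7 ->
  ireg s 28 = h -> ireg s 23 = a -> ireg s 25 = b -> ireg s 27 = o0 ->
  h = (o0 + L * size O)%N -> (a + L <= h)%N -> (b + L <= h)%N ->
  stored (rmem s) a x -> stored (rmem s) b y -> vlist (rmem s) o0 O ->
  mabs (x + y) <= zmax -> (forall w, w \in O -> mabs (x + y - w) <= zmax) ->
  wp (pair_cmd nu) s (size O * (20 * L + 2 * tn + 31) + (10 * L + tn + 30))
   (fun s' => exists O', [/\ prune_step q (rreg s 7) (rreg s 20) (rreg s 21) (x + y) O O',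
      vlist (rmem s') o0 O' /\ ireg s' 28 = (o0 + L * size O')%N,
      framex [::] 28 39 s s', imem s' = imem s & forall a, (a < h)%N -> rmem s' a = rmem s a]).
Proof.
move=> es v0 hh ha hb ho hO ah bh sx sy vO zu zO.
have [_ eL] := envE es.
have L0 : (0 < L)%N by slia.
set u := x + y.
apply: (@wp_le _ _ _ _ _ (9 + (10 * L + 3 + (2 + (tn + (2 + (2 + ((size O * (20 * L + 2 * tn + 30).+1).+1 + 2)))))))); last first.
  by rewrite -addnS; move: (size O * _)%N => X; slia.
apply: wp_seq; isteps.
apply: wp_seq; apply: wp_weaken (@wp_axpy _ _ _ _ h a b L _ _ _ _ _ _) (leqnn _) _;
  rewrite /= ?hh ?ha ?hb ?eL ?addn0// /apart; try by (apply/orP; right; apply/orP; left; slia).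
move=> s1 [[/= fi1 fr1 ft1] im1 m1].
have e1 i : (i < 28)%N -> ireg s1 i = ireg s i.
  move=> ik; rewrite fi1 ?(leq_trans ik)//= !ifF//; apply/negbTE; slia.
have r1 i : (i < 40)%N -> rreg s1 i = rreg s i.
  move=> ik; rewrite fr1 ?(leq_trans ik)//= !ifF//; apply/negbTE; slia.
have h28 : ireg s1 28 = h by rewrite fi1.
have h31 : ireg s1 31 = (h + L)%N by rewrite fi1.
have h32 : ireg s1 32 = (h + L + L)%N by rewrite fi1.
have h33 : ireg s1 33 = (h + L + L + L)%N by rewrite fi1.
have h36 : ireg s1 36 = 0%N by rewrite fi1.
have mlow i : (i < h)%N -> rmem s1 i = rmem s i.
  by move=> ih; rewrite m1 ifF//; apply/negbTE; slia.
have su : stored (rmem s1) h u.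
  move=> i il; rewrite m1 leq_addr ltn_add2l il addKn sx// sy//.
  have -> : u = x + 1 *: y by rewrite scale1r.
  by rewrite enc_lin.
clear fi1 fr1 m1.
apply: wp_seq; isteps; set s2 := State _ _ _ _ _.
have es2 : env s2.
  apply: env_frame es; split => [i ik|i ik|] /=; last by rewrite ft1.
    by rewrite !ifF ?e1 ?(leq_trans ik)//; apply/negbTE; slia.
  by rewrite r1// (leq_trans ik).
have m2 : rmem s2 = rmem s1 by [].
have im2 : imem s2 = imem s by [].
have h38 : ireg s2 38 = h by rewrite /= h28 h36 addn0.
have h39 : ireg s2 39 = (h + L + L + L)%N by rewrite /= h33 h36 addn0.
have fr2 : framex [:: 38; 39] 40 40 s1 s2 by split => //=; iframex.
have t2 : tape s2 = tape s by [].
clearbody s2.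
have r2 i : (i < 40)%N -> rreg s2 i = rreg s i by move=> ik; case: fr2 => _ H _; rewrite H// r1.
apply: wp_seq; apply: wp_weaken (@nu_spec s2 u es2 _ zu _ _) (leqnn _) _.
- by rewrite h38 m2.
- by rewrite r2.
- by rewrite h38 h39; slia.
move=> s3 [[[fi3 fr3 ft3] im3 m3] g3]; rewrite r2// in g3.
apply: wp_seq; isteps; set s4 := State _ _ _ _ _.
have e3 i : (i < 38)%N -> ireg s3 i = ireg s1 i.
  move=> ik; rewrite fi3 ?(leq_trans ik)//; case: fr2 => H _ _; rewrite H//.
  by rewrite !inE; slia.
have k4 i : (i < 38)%N -> i != 29%N -> i != 30%N -> ireg s4 i = ireg s1 i.
  by move=> ik i1 i2 /=; rewrite !ifF ?e3//; apply/negbTE.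
have r4 i : (i < 39)%N -> rreg s4 i = rreg s i.
  by move=> ik; rewrite /= fr3// r2// (leq_trans ik).
have g4 : rreg s4 39 = rreg s3 39 by [].
have h429 : ireg s4 29 = o0 by rewrite /= !e3// e1// ho h36 addn0.
have h430 : ireg s4 30 = 1%N by [].
have m4 i : (i < h + L)%N -> rmem s4 i = rmem s1 i.
  by move=> ih; rewrite /= m3 ?h39 ?m2//; slia.
have im4 : imem s4 = imem s by rewrite /= im3.
have t4 : tape s4 = tape s by rewrite /= ft3.
clearbody s4.
have {}fr2 : framex [::29;30] 38 39 s1 s4.
  split; last by rewrite t4.
  - by move=> i /andP[ik]; rewrite !inE negb_or => /andP[? ?]; rewrite k4.
  - by move=> i ik; rewrite r4// r1// (leq_trans ik).
apply: wp_seq.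
have {g3 g4} : wp (If (RLt 20 39) (block [:: ISet 30 0]) Skip) s4 2 (fun s5 =>
   framex [:: 29; 30] 38 39 s1 s5 /\ rmem s5 = rmem s4 /\ imem s5 = imem s4 /\ ireg s5 29 = o0 /\
   ((ireg s5 30 = 0%N /\ rreg s 20 / 2 < nrm q (rreg s 7) u) \/
    (ireg s5 30 = 1%N /\ nrm q (rreg s 7) u <= rreg s 20))).
  apply: wp_if => /=; rewrite r4// g4; case/andP: g3 => g3 g3'.
  have [lt|le] := ltP (rreg s 20) (rreg s3 39).
    isteps; split; first by apply: framex_trans fr2 _; split => //=; iframex.
    do ! split => //; left; split => //; exact: (nrm_approx_gt q_ge0 dl01 lt g3').
  apply: wp_skip; do ! split => //; right; split => //; exact: le_trans g3 le.
move=> H; apply: wp_weaken H (leqnn _) _ => {fr2 k4 h429 h430 r4}.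
move=> s5 [fr5 [m5 [im5 [h529 c5]]]].
pose I k s' := [/\ framex [:: 29; 30] 38 39 s1 s', imem s' = imem s4,
   forall a, (a < h + L)%N -> rmem s' a = rmem s1 a, ireg s' 29 = (o0 + L * k)%N &
   (ireg s' 30 = 0%N /\ (rreg s 20 / 2 < nrm q (rreg s 7) u \/
        exists2 w, w \in O & snrm q (rreg s 7) (u - w) <= rreg s 21)) \/
   [/\ ireg s' 30 = 1%N, nrm q (rreg s 7) u <= rreg s 20 &
     all (fun w => rreg s 21 / 2 < snrm q (rreg s 7) (u - w)) (take k O)]].
apply: wp_seq; apply: (wp_while (I := I)).
- move=> k s' [[fi _ _] _ _ h29 _] /=; rewrite h29 fi// h28 hO ltn_add2l ltn_mul2l L0 //.
- move=> k s' kO [fr im m h29 c]; have [fi frr ft] := fr.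
  have kO' : (L * k.+1 <= L * size O)%N by rewrite leq_mul2l kO orbT.
  rewrite mulnS in kO'.
  have r7 : rreg s' 7 = rreg s 7 by rewrite frr// r1.
  have es' : env s'.
    apply: env_frame es; split => [i ik|i ik|]; last by rewrite ft ft1.
      by rewrite fi ?e1 ?(leq_trans ik)//= !inE; slia.
    by rewrite frr ?r1 ?(leq_trans ik).
  have wk : nth 0 O k \in O by rewrite mem_nth.
  have := @wp_scan_body _ _ oracle Br q zmax dl tn nu env q_ge0 dl01 env_frame envE nu_spec
    s' u (nth 0 O k) h (o0 + L * k)%N es'; rewrite r7.
  have k28 : ireg s' 28 = h by rewrite fi.
  have k31 : ireg s' 31 = (h + L)%N by rewrite fi.
  have k32 : ireg s' 32 = (h + L + L)%N by rewrite fi.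
  have k33 : ireg s' 33 = (h + L + L + L)%N by rewrite fi.
  have k36 : ireg s' 36 = 0%N by rewrite fi.
  move=> H; apply: wp_weaken (H v0 k28 k31 k32 k33 k36 h29 _ _ _ _) (leqnn _) _.
  + slia.
  + apply: stored_frame su => i il; apply: m; slia.
  + apply: stored_frame (vO k kO) => i il; rewrite m; [apply: mlow|]; slia.
  + exact: zO.
  move=> s6 [[fi6 fr6 ft6] im6 m6 h629 c6]; split.
  + split; last by rewrite ft6 ft.
    * move=> i; rewrite !inE => /andP[ik ne]; rewrite fi6 ?fi ?inE ?ik//=; slia.
    * by move=> i ik; rewrite fr6// frr.
  + by rewrite im6 im.
  + by move=> i ih; rewrite m6// m.
  + by rewrite h629 mulnS; slia.
  rewrite frr// r1// in c6.
  case: c6 => [[f0 cl]|[f0 cl]].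
    left; split => //; right; exists (nth 0 O k) => //.
  rewrite f0; case: c => [c|[c1 c2 al]]; [by left | right; split => //].
  by rewrite (take_nth 0)// all_rcons cl.
- split => //.
  + by move=> i ih; rewrite m5 m4.
  + by rewrite muln0 addn0.
  + by case: c5 => [[? ?]|[? ?]]; [left; split => //; left | right; split; rewrite ?take0].
move=> s6 [[fi6 fr6 ft6] im6 m6 h629 c6].
have fin s7 : framex [:: 28] 29 39 s6 s7 -> framex [::] 28 39 s s7.
  move=> [fi7 fr7 ft7]; split; last by rewrite ft7 ft6 ft1.
  - move=> i /andP[ik _]; rewrite fi7 ?fi6 ?e1 ?inE ?(leq_trans ik)//=; slia.
  - by move=> i ik; rewrite fr7// fr6// r1// (leq_trans ik).
have vO6 : vlist (rmem s6) o0 O.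
  apply: (@vlist_below _ _ _ _ _ h) vO; last by rewrite hO.
  by move=> i ih; rewrite m6 ?mlow//; slia.
apply: wp_if => /=; rewrite fi6// h36; case: c6 => [[-> c6]|[-> c6 c7]] /=.
  apply: wp_skip; exists O; split => //; [| | exact: fin | by rewrite im6 | ].
  - left; split => // nu2; case: c6 => // c6; by move: (lt_le_trans c6 nu2); rewrite ltxx.
  - by split => //; rewrite fi6// h28.
  - by move=> i ih; rewrite m6 ?mlow//; slia.
isteps; exists (rcons O u); split => //=.
- by right; split => //; rewrite -(take_size O).
- split; last by rewrite !fi6// h28 e1// eL hO size_rcons mulnS; slia.
  apply: vlist_rcons => //; rewrite -hO; apply: stored_frame su => i il; apply: m6; slia.
- by apply: fin; split => //=; iframex.
- by rewrite im6.
- by move=> i ih; rewrite m6 ?mlow//; slia.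
Qed.

End Pair.

(** Index registers 21 and 22 name the two input lists, and real registers 20 and 21 hold the radius
    b and the separation sg. The result becomes a new list at the end of the heap. *)
Definition prune_cmd (nu : cmd) : cmd :=
  Seq (block [:: ISet 37 1; ILoad 23 21; IAdd 36 21 37; ILoad 24 36; IAdd 36 22 37; ILoad 26 36;
        ISet 36 0; IAdd 27 28 36])
  (Seq (While (ILt 23 24)
    (Seq (block [:: ILoad 25 22])
    (Seq (While (ILt 25 26) (Seq (pair_cmd nu) (block [:: IAdd 25 25 1])))
    (block [:: IAdd 23 23 1]))))
  (block [:: ISet 36 1; IAdd 20 20 36; IStore 20 28])).

Section PruneStep.
Context {R : realType} {n : nat} (q : 'rV[int]_n -> R).
Implicit Types (D O : seq 'rV[int]_n).

Lemma pruned_sub v b sg D D' O : {subset D' <= D} -> pruned q v b sg D O -> pruned q v b sg D' O.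
Proof. by move=> DD [H1 H2 H3]; split => // u /DD; exact: H1. Qed.

Lemma pruned_nil v b sg : pruned q v b sg [::] [::].
Proof. by split. Qed.

Lemma pruned_step v b sg D u O O' : q 0 = 0 -> 0 <= sg ->
  pruned q v b sg D O -> prune_step q v b sg u O O' -> pruned q v b sg (rcons D u) O'.
Proof.
move=> q0 sg0 [H1 H2 H3] [[-> cl]|[-> ub far]]; split => //.
- by move=> u'; rewrite mem_rcons inE => /predU1P[->|] //; exact: H1.
- move=> u'; rewrite mem_rcons inE => /predU1P[->|uD] u'b.
    by exists u; rewrite ?mem_rcons ?mem_head// subrr snrm0.
  by have [w wO H] := H1 _ uD u'b; exists w; rewrite // mem_rcons inE wO orbT.
- by move=> w; rewrite mem_rcons inE => /predU1P[->|] //; exact: H2.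
- by rewrite pairwise_rcons far.
Qed.

End PruneStep.

Section Heap.
Context {R : realType} {n : nat} (Br : 'M[R]_n).
Implicit Types (s : state R) (ALL : seq (seq 'rV[int]_n)).
Local Notation vlist := (vlist Br).
Local Notation L := (n + n)%N.

(** The lists lie one after another, and [imem] is the table of their start addresses. The entry
    after the last list is the first free cell, so the next entry always marks where a list ends. *)
Definition heap ALL s := [/\ ireg s 20 = size ALL, imem s (size ALL) = ireg s 28,
  forall e, (e < size ALL)%N -> imem s e.+1 = (imem s e + L * size (nth [::] ALL e))%N &
  forall e, (e < size ALL)%N -> vlist (rmem s) (imem s e) (nth [::] ALL e)].

Lemma heap_le ALL s e : heap ALL s -> (e <= size ALL)%N -> (imem s e <= ireg s 28)%N.
Proof.
move=> [_ hl hs _] el; rewrite -hl.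
have H d : (e + d <= size ALL)%N -> (imem s e <= imem s (e + d))%N.
  elim: d => [|d IH] H; first by rewrite addn0.
  by rewrite addnS hs ?(leq_trans (IH _))// ?leq_addr//; slia.
by have := H (size ALL - e)%N; rewrite subnKC//; apply.
Qed.

Lemma heap_list_le ALL s e : heap ALL s -> (e < size ALL)%N ->
  (imem s e + L * size (nth [::] ALL e) <= ireg s 28)%N.
Proof. by move=> hp el; have := heap_le hp el; case: hp => _ _ -> . Qed.

End Heap.

Section PruneCmd.
Context {R : realType} {n : nat} (oracle : 'rV[R]_n -> R) (Br : 'M[R]_n).
Variables (q : 'rV[int]_n -> R) (zmax dl : R) (tn : nat) (nu : cmd) (env : state R -> Prop).
Implicit Types (z w u : 'rV[int]_n) (s : state R) (ALL : seq (seq 'rV[int]_n)).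
Local Notation wp := (wp oracle).
Local Notation stored := (stored Br).
Local Notation vlist := (vlist Br).
Hypothesis n_gt0 : (0 < n)%N.
Hypothesis q_ge0 : forall z, 0 <= q z.
Hypothesis q_0 : q 0 = 0.
Hypothesis dl01 : 0 <= dl <= 1.
Hypothesis env_frame : forall s s', frame 20 20 s s' -> env s -> env s'.
Hypothesis envE : forall s, env s -> ireg s 0 = n /\ ireg s 1 = (n + n)%N.
Hypothesis nu_spec : forall s z, env s -> stored (rmem s) (ireg s 38) z -> mabs z <= zmax ->
  0 <= rreg s 7 -> (ireg s 38 + (n + n) <= ireg s 39)%N ->
  wp nu s tn (fun s' => keeps s s' /\
    nrm q (rreg s 7) z <= rreg s' 39 <= (1 + dl) * nrm q (rreg s 7) z).
Local Notation L := (n + n)%N.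
Local Notation heap := (heap Br).

(** The norm is evaluated on x + y and on x + y - w (and its negative) for elements with coordinates
    at most Z, hence the requirement 3 Z <= zmax. *)
Lemma wp_prune s ALL e1 e2 (Z : R) (S : nat) : env s -> 0 < rreg s 7 -> heap ALL s ->
  ireg s 21 = e1 -> ireg s 22 = e2 -> (e1 < size ALL)%N -> (e2 < size ALL)%N ->
  0 <= rreg s 21 -> rreg s 20 <= rreg s 7 * Z -> 3 * Z <= zmax ->
  (forall x, x \in nth [::] ALL e1 -> mabs x <= Z) ->
  (forall y, y \in nth [::] ALL e2 -> mabs y <= Z) ->
  (forall D O, pruned q (rreg s 7) (rreg s 20) (rreg s 21) D O -> (size O <= S)%N) ->
  wp (prune_cmd nu) s (size (nth [::] ALL e1) *
     (size (nth [::] ALL e2) * (S * (20 * L + 2 * tn + 31) + (10 * L + tn + 32)) + 5) + 15)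
   (fun s' => exists O, [/\ pruned q (rreg s 7) (rreg s 20) (rreg s 21)
        (sumset (nth [::] ALL e1) (nth [::] ALL e2)) O,
      heap (rcons ALL O) s', frame 20 39 s s',
      forall a, (a <= size ALL)%N -> imem s' a = imem s a &
      forall a, (a < ireg s 28)%N -> rmem s' a = rmem s a]).
Proof.
move=> es v0 hp he1 he2 l1 l2 sg0 bZ Zz XZ YZ cap.
set X := nth [::] ALL e1; set Y := nth [::] ALL e2.
set tp := (S * (20 * L + 2 * tn + 31) + (10 * L + tn + 30))%N.
have [_ eL] := envE es.
have L0 : (0 < L)%N by lia.
have [hIT hend hstep hvl] := hp.
set h := ireg s 28 in hend *.
have sX := hvl _ l1; have sY := hvl _ l2; rewrite -/X in sX; rewrite -/Y in sY.
have bX : (imem s e1 + L * size X <= h)%N := heap_list_le hp l1.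
have bY : (imem s e2 + L * size Y <= h)%N := heap_list_le hp l2.
have nX : imem s e1.+1 = (imem s e1 + L * size X)%N := hstep _ l1.
have nY : imem s e2.+1 = (imem s e2 + L * size Y)%N := hstep _ l2.
apply: (@wp_le _ _ _ _ _ (8 + ((size X * (1 + ((size Y * (tp + 1).+1).+1 + 1)).+1).+1 + 3))); last first.
  have -> : (S * (20 * L + 2 * tn + 31) + (10 * L + tn + 32) = (tp + 1).+1)%N by rewrite /tp; lia.
  move: (size Y * _)%N => B.
  have -> : (1 + (B.+1 + 1)).+1 = (B + 4)%N by lia.
  have : (size X * (B + 4) <= size X * (B + 5))%N by rewrite leq_mul2l leq_add2l orbT.
  by lia.
apply: wp_seq; isteps; set s1 := State _ _ _ _ _.
have h22 : ireg s1 22 = e2 by rewrite /= he2.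
have h23 : ireg s1 23 = imem s e1 by rewrite /= he1.
have h24 : ireg s1 24 = (imem s e1 + L * size X)%N by rewrite /= he1 addn1 nX.
have h26 : ireg s1 26 = (imem s e2 + L * size Y)%N by rewrite /= he2 addn1 nY.
have h27 : ireg s1 27 = h by rewrite /= addn0.
have k1 : framex [:: 23; 24; 25; 26; 27; 36; 37] 40 40 s s1 by split => //=; iframex.
have im1 : imem s1 = imem s by [].
have m1 : rmem s1 = rmem s by [].
have h28 : ireg s1 28 = h by [].
clearbody s1; have [ki kr kt] := k1.
have v1 : rreg s1 7 = rreg s 7 by rewrite kr.
set v := rreg s 7 in v0 bZ cap v1 *; set b := rreg s 20 in bZ cap *; set sg := rreg s 21 in sg0 cap *.
pose core D s' O := [/\ pruned q v b sg D O, vlist (rmem s') h O /\ ireg s' 28 = (h + L * size O)%N,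
  framex [:: 23; 25] 28 39 s1 s', imem s' = imem s & forall a, (a < h)%N -> rmem s' a = rmem s a].
pose I i s' := (exists O, core (sumset (take i X) Y) s' O) /\ ireg s' 23 = (imem s e1 + L * i)%N.
apply: wp_seq; apply: (wp_while (I := I)).
- move=> k s' [[Q' [_ _ [fi _ _] _ _]] h23'] /=; rewrite h23' fi// h24.
  by rewrite ltn_add2l ltn_mul2l L0.
- move=> i s' iX [[Q0 [pO0 vO0 fr0 im0 m0]] h23'].
  have x0 := mem_nth 0 iX; set x := nth 0 X i in x0.
  apply: wp_seq; isteps; set s2 := State _ _ _ _ _.
  pose J k s' := (exists O, core (sumset (take i X) Y ++ [seq x + y | y <- take k Y]) s' O) /\
     ireg s' 25 = (imem s e2 + L * k)%N /\ ireg s' 23 = (imem s e1 + L * i)%N.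
  apply: wp_seq; apply: (wp_while (I := J)).
  + move=> k s3 [[Q' [_ _ [fi _ _] _ _]] [h25 _]] /=; rewrite h25 fi// h26.
    by rewrite ltn_add2l ltn_mul2l L0.
  + move=> k s3 kY [[ O [pO [vO hO] fr im m]] [h25 h233]]; have [fi frr ft] := fr.
    have y0 := mem_nth 0 kY; set y := nth 0 Y k in y0.
    have kY' : (L * k.+1 <= L * size Y)%N by rewrite leq_mul2l kY orbT.
    have iX' : (L * i.+1 <= L * size X)%N by rewrite leq_mul2l iX orbT.
    rewrite !mulnS in kY' iX'.
    have es3 : env s3.
      apply: env_frame es; split => [j j20|j j20|]; last by rewrite ft kt.
      * rewrite fi ?ki ?inE ?(leq_trans j20)//=; move: j20; clear; lia.
      * by rewrite frr ?kr ?(leq_trans j20).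
    have r7 : rreg s3 7 = v by rewrite frr// kr.
    have r20 : rreg s3 20 = b by rewrite frr// kr.
    have r21 : rreg s3 21 = sg by rewrite frr// kr.
    have h273 : ireg s3 27 = h by rewrite fi.
    have OZ w : w \in O -> mabs w <= Z.
      case: pO => _ Ob _ /Ob; rewrite nrm_le => /andP[_ /le_trans/(_ bZ)].
      by rewrite ler_pM2l.
    have xZ := XZ _ x0; have yZ := YZ _ y0; have xyZ := le_trans (mabsD x y) (lerD xZ yZ).
    have Z0 : 0 <= Z := le_trans (@mabs_ge0 R n x) xZ.
    (* Every partial output is itself pruned with respect to the pairs processed so far, so the cap
       bounds each inner scan and not only the final list. *)
    have OS : (size O <= S)%N := cap _ _ pO.
    apply: wp_seq.
    have := @wp_pair _ _ oracle Br q zmax dl tn nu env n_gt0 q_ge0 dl01 env_frame envE nu_spec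
      s3 x y O _ _ _ h es3; rewrite r7 r20 r21.
    move=> H; have {}H := H _ _ _ (ltW v0) hO h233 h25 h273 erefl.
    apply: wp_weaken (H _ _ _ _ vO _ _) _ _.
    * slia.
    * slia.
    * apply: stored_frame (sX i iX) => j jl; apply: m; slia.
    * apply: stored_frame (sY k kY) => j jl; apply: m; slia.
    * apply: le_trans xyZ _; lra.
    * move=> w /OZ wZ; apply: le_trans (mabsD _ _) _; rewrite mabsN.
      by apply: le_trans (lerD xyZ wZ) _; lra.
    * apply: (leq_trans (n := (S * (20 * L + 2 * tn + 31) + (10 * L + tn + 30)))%N).
        by rewrite leq_add2r leq_mul2r OS orbT.
      exact: leqnn.
    * move=> s4 [ O' [st [vO' hO'] fr4 im4 m4]]; have [fi4 fr4' ft4] := fr4.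
      isteps; split; last first.
        by rewrite /= !fi4// h25 h233 fi// ki// eL mulnS; split => //; slia.
      exists O'; split => /=.
      - have := pruned_step q_0 sg0 pO st.
        by rewrite (take_nth 0)// map_rcons -cats1 -cats1 catA.
      - by [].
      - split => /=; last by rewrite ft4 ft.
          move=> j H'; have jk : (j < 28)%N && (j \notin [::]) by case/andP: H' => ->.
          rewrite ifF ?fi4 ?fi//; apply/eqP => jj; by move: H'; rewrite jj.
        by move=> j j39; rewrite fr4'// frr.
      - by rewrite im4 im.
      - by move=> a ah; rewrite m4 ?m//; slia.
  + split; last split.
    * exists Q0; split => //=; first by rewrite take0 cats0.
      by case: fr0 => fi0 fr0 ft0; split => //= j H'; rewrite ifF ?fi0//; apply/eqP => jj; move: H'; rewrite jj.
    * by case: fr0 => fi0 _ _; rewrite /= fi0// h22 im0 muln0 addn0.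
    * by [].
  move=> s3 [[ O [pO [vO hO] fr im m]] [h25 h233]]; have [fi frr ft] := fr.
  isteps; split; last by rewrite /= h233 fi// ki// eL mulnS; slia.
  exists O; split => //=.
  - apply: pruned_sub pO => _ /allpairsP[[x' y'] /= [xX yY ->]].
    rewrite take_size mem_cat; move: xX; rewrite (take_nth 0)// mem_rcons inE => /predU1P[->|xX].
      by rewrite (map_f (fun y => x + y) yY) orbT.
    by rewrite allpairs_f.
  - by split => //= j H'; rewrite ifF ?fi//; apply/eqP => jj; move: H'; rewrite jj.
- split; last by rewrite muln0 addn0.
  exists [::]; split => //=; last by move=> a _; rewrite m1.
    by rewrite take0; exact: pruned_nil.
  by rewrite muln0 addn0.
move=> s2 [[ O [pO [vO hO] fr im m]] h233]; have [fi frr ft] := fr.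
isteps; exists O; split => //=.
- by rewrite take_size in pO.
- have hIT2 : ireg s2 20 = size ALL by rewrite fi// ki.
  split => /=.
  + by rewrite hIT2 size_rcons addn1.
  + by rewrite size_rcons hIT2 addn1 /upd eqxx.
  + move=> e; rewrite size_rcons ltnS hIT2 addn1 nth_rcons => el.
    case: ltngtP el => // [el _|-> _]; last first.
      by rewrite eqxx im hend hO ltn_eqF.
    by rewrite im hstep// !ltn_eqF//; slia.
  + move=> e; rewrite size_rcons ltnS hIT2 addn1 nth_rcons => el.
    case: ltngtP el => // [el _|-> _]; rewrite im; last first.
      by rewrite ltn_eqF// hend.
    rewrite ltn_eqF ?ltnS ?(ltnW el)//; apply: (@vlist_below _ _ _ (rmem s) _ h) (hvl _ el) => //.
    exact: (heap_list_le hp el).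
- split => /=; last by rewrite ft kt.
    move=> i i20; rewrite ifF ?ifF ?fi ?ki ?inE ?(leq_trans i20)//=; move: i20; clear; lia.
  by move=> i i39; rewrite frr// kr// (leq_trans i39).
- by move=> a aA; rewrite fi// ki// hIT addn1 ifF ?im//; apply/negbTE; slia.
Qed.
End PruneCmd.

(** * Evaluating the gauge *)

Definition gauge_by_membership : cmd :=
  Seq (block [:: IAdd 41 38 0; ISet 42 0; IAdd 42 41 42; ISet 40 0; IAdd 40 39 40; ISet 43 0;
         IAdd 43 0 43; RDiv 43 6 5; RSet 44 1; RSet 45 0])
  (Seq (While (RLt 45 44) (Seq (block [:: RMul 43 43 5; RDiv 40 44 43; RSub 40 40 44])
          (Seq axpy (block [:: Query 45 40]))))
  (If (RLt 6 43) (block [:: RSet 39 0; RAdd 39 39 43]) (block [:: RSet 39 0]))).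

Definition gauge_by_value : cmd := block [:: IAdd 40 38 0; Query 39 40].

Definition genv {R : realType} (n : nat) (fac s0 : R) (s : state R) :=
  [/\ ireg s 0 = n, ireg s 1 = (n + n)%N, rreg s 5 = fac & rreg s 6 = s0].

Section GaugeCmd.
Context {R : realType} {n : nat} (C : set 'rV[R]_n) (r rho : R) (Br : 'M[R]_n).
Hypothesis Cconv : convex_set (C : set (convex_lmodType 'rV[R]_n)).
Hypothesis Ccent : centered r rho C.
Variables (zmax dl s0 : R) (Kmax : nat).
Local Notation q := (fun z => gauge C (latpt Br z)).
Local Notation fac := (1 + dl).
Local Notation L := (n + n)%N.

Lemma genv_frame fc s s' : frame 20 20 s s' -> genv n fc s0 s -> genv n fc s0 s'.
Proof. by move=> [fi fr ft] [h1 h2 h3 h4]; split; rewrite ?fi ?fr. Qed.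

Lemma wp_gauge_by_value fc s z : genv n fc s0 s -> stored Br (rmem s) (ireg s 38) z ->
  wp (gauge C) gauge_by_value s 2 (fun s' => keeps s s' /\ q z <= rreg s' 39 <= (1 + 0) * q z).
Proof.
move=> [h0 _ _ _] st; isteps; split.
  by split => //; split => //=; iframe.
rewrite /= h0.
have := stored_rvec st; rewrite /rvec /= => ->.
by rewrite addr0 mul1r lexx.
Qed.

Hypotheses (dl0 : 0 < dl) (s00 : 0 < s0).
Hypothesis q_min : forall z, z != 0 -> s0 < q z.
Hypothesis q_max : forall z, mabs z <= zmax -> q z < s0 * fac ^+ Kmax.

(** Geometric search over the scales s0 fac^k, stopping at the first one accepted by the oracle.
    Acceptance bounds the gauge above by that scale, and rejection of the preceding one bounds it
    below by a factor fac less. The search register starts at s0 / fac, so that the first trial is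
    s0. *)
Lemma wp_gauge_by_membership s z : genv n fac s0 s -> stored Br (rmem s) (ireg s 38) z ->
  mabs z <= zmax -> (ireg s 38 + L <= ireg s 39)%N ->
  wp (membership_oracle C) gauge_by_membership s (Kmax.+1 * (10 * n + 8) + 14)
    (fun s' => keeps s s' /\ q z <= rreg s' 39 <= fac * q z).
Proof.
move=> [h0 h1 h5 h6] st zm sep.
have fac1 : 1 < fac by rewrite ltrDl.
have fac0 : 0 < fac by rewrite (lt_trans ltr01).
set x := latpt Br z.
pose P k := `[< C ((s0 * fac ^+ k)^-1 *: x) >].
have exP : exists k, P k by exists Kmax; apply/asboolP; apply: (gauge_lt_mem Cconv Ccent); exact: q_max.
have [k0 Pk0 mink] := ex_minnP exP.
have k0K : (k0 <= Kmax)%N.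
  by apply: mink; apply/asboolP; apply: (gauge_lt_mem Cconv Ccent); exact: q_max.
have fk k : 0 < s0 * fac ^+ k by rewrite mulr_gt0// exprn_gt0.
apply: (@wp_le _ _ _ _ _ (10 + ((k0.+1 * (3 + (10 * n + 3 + 1)).+1).+1 + 3))); last first.
  have -> : (3 + (10 * n + 3 + 1)).+1 = (10 * n + 8)%N by lia.
  have : (k0.+1 * (10 * n + 8) <= Kmax.+1 * (10 * n + 8))%N by rewrite leq_mul2r ltnS k0K orbT.
  lia.
apply: wp_seq; isteps; set s1 := State _ _ _ _ _.
have h40 : ireg s1 40 = ireg s 39 by rewrite /= addn0.
have h41 : ireg s1 41 = (ireg s 38 + n)%N by rewrite /= h0.
have h42 : ireg s1 42 = (ireg s 38 + n)%N by rewrite /= h0 addn0.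
have h43 : ireg s1 43 = n by rewrite /= h0 addn0.
have r43 : rreg s1 43 = s0 / fac by rewrite /= h5 h6.
have r44 : rreg s1 44 = 1 by [].
have r45 : rreg s1 45 = 0 by [].
have f1 : frame 40 40 s s1 by split => //=; iframe.
have m1 : rmem s1 = rmem s by []. have im1 : imem s1 = imem s by [].
clearbody s1; have [fi1 fr1 ft1] := f1.
pose I k s' := [/\ frame 44 40 s1 s', imem s' = imem s,
  forall a, (a < ireg s 39)%N -> rmem s' a = rmem s a,
  rreg s' 43 = s0 * fac ^+ k / fac /\ rreg s' 44 = 1 &
  rreg s' 45 = (if k is k'.+1 then P k' else false)%:R /\ (k <= k0.+1)%N].
apply: wp_seq; apply: (wp_while (m := k0.+1) (I := I)).
- move=> k s' [_ _ _ [_ r44'] [r45' kk]] /=; rewrite r44' r45'.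
  case: k kk {r45'} => [|k] kk /=; first by rewrite ltr01.
  rewrite ltnS in kk; rewrite ltnS; case Pk: (P k); first by rewrite ltxx ltnNge mink.
  by rewrite ltr01; symmetry; rewrite ltn_neqAle kk andbT; apply: contraFneq Pk => ->.
- move=> k s' kk [[fi fr ft] im m [r43' r44'] [r45' _]].
  have r5' : rreg s' 5 = fac by rewrite fr// fr1.
  apply: wp_seq; isteps; set s2 := State _ _ _ _ _.
  have E : rreg s2 43 = s0 * fac ^+ k by rewrite /= r43' r5' divfK// gt_eqF.
  (* [axpy] is called with the same vector as both sources, so the coefficient c - 1 produces c
     x. *)
  have r40 : rreg s2 40 = (s0 * fac ^+ k)^-1 - 1 by rewrite -E /= r44' div1r.
  have r442 : rreg s2 44 = 1 by [].
  have f2 : frame 44 40 s' s2 by split => //=; iframe.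
  have m2 : rmem s2 = rmem s' by []. have im2 : imem s2 = imem s' by [].
  clearbody s2; have [fi2 fr2 ft2] := f2.
  apply: wp_seq; apply: wp_weaken (@wp_axpy_frame _ _ _ s2 (ireg s 39) (ireg s 38 + n)%N
    (ireg s 38 + n)%N n _ _ _ _ _ _) (leqnn _) _; rewrite ?fi2 ?fi//.
  + by rewrite /apart; apply/orP; right; apply/orP; left; move: sep; clear; lia.
  + by rewrite /apart; apply/orP; right; apply/orP; left; move: sep; clear; lia.
  move=> s3 [[fi3 fr3 ft3] im3 rr3 m3].
  isteps; split => /=.
  + split => /= [i ik|i ik|]; last by rewrite ft3 ft2.
      by rewrite fi3// fi2// fi.
    by rewrite ifF ?fr3 ?fr2 ?fr ?(leq_trans ik)//; apply/eqP => ii; move: ik; rewrite ii.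
  + by rewrite im3 im2.
  + by move=> a ah; rewrite m3 ifF ?m2 ?m//; apply/negbTE; rewrite leqNgt ah.
  + by rewrite !rr3// E r442 exprSr mulrA mulfK// gt_eqF.
  split => //; rewrite /membership_oracle /P.
  have -> : rvec s3 (ireg s3 40) = (s0 * fac ^+ k)^-1 *: x.
    apply/rowP => i; rewrite [LHS]mxE [RHS]mxE fi3// fi2// fi// h40 m3 leq_addr ltn_add2l ltn_ord addKn /= r40.
    have -> : rmem s2 (ireg s 38 + n + i)%N = x 0 i.
      rewrite m2 m -?addnA; last by rewrite (leq_trans _ sep)// ltn_add2l ltn_add2l.
      by rewrite st ?enc_pt// ltn_add2l.
    by rewrite mulrBl mul1r addrC subrK.
  by congr (_%:R); apply/idP/asboolP => [/set_mem//|]; exact: mem_set.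
- split => //.
  + by move=> a _; rewrite m1.
  + by rewrite r43 expr0 mulr1.
move=> s2 [[fi fr ft] im m [r43' r44'] [r45' _]].
have kp s3 : frame 40 39 s2 s3 -> imem s3 = imem s2 -> rmem s3 = rmem s2 -> keeps s s3.
  move=> [fi3 fr3 ft3] im3 m3; split; last by move=> a ah; rewrite m3 m.
    split => [i ik|i ik|]; last by rewrite ft3 ft ft1.
      by rewrite fi3// fi ?fi1// (leq_trans ik).
    by rewrite fr3// fr ?fr1// (leq_trans ik).
  by rewrite im3.
apply: wp_if => /=; rewrite fr// fr1// h6 r43' exprSr mulrA mulfK ?gt_eqF//.
have px : q z <= s0 * fac ^+ k0 by apply: (mem_gauge_le Ccent) => //; move: Pk0 => /asboolP.
clear I; case: k0 Pk0 mink k0K r43' r45' px => [|k0] Pk0 mink k0K r43' r45' px.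
  rewrite expr0 mulr1 ltxx /=; isteps; split; first by apply: kp => //; split => //=; iframe.
  (* Acceptance of the very first scale means q z <= s0, which by the choice of s0 happens only for
     z = 0; the value returned is then exactly 0. *)
  rewrite /=; have [z0|/q_min] := eqVneq z 0; last first.
    by move=> H; move: (lt_le_trans H px); rewrite expr0 mulr1 ltxx.
  have -> : gauge C x = 0 by rewrite /x z0 /latpt map_mx0 mul0mx (gauge0 Ccent).
  by rewrite mulr0 lexx.
have -> : s0 < s0 * fac ^+ k0.+1 by rewrite ltr_pMr// exprn_egt1.
isteps; split; first by apply: kp => //; split => //=; iframe.
rewrite /= add0r r43' exprSr mulrA mulfK ?gt_eqF// px /= exprSr mulrA mulrC ler_pM2l//.
rewrite leNgt; apply/negP => /(gauge_lt_mem Cconv Ccent) H.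
by have /mink : P k0 by [apply/asboolP]; rewrite ltnn.
Qed.
End GaugeCmd.

(** * Membership in M by Gram-Schmidt *)

Section DotProduct.
Context {R : realType} {n : nat}.
Implicit Types (x y u : 'rV[R]_n) (M U : 'M[R]_n).

Definition dotv x y : R := \sum_i x 0 i * y 0 i.

Lemma dotvBl x y u : dotv (x - y) u = dotv x u - dotv y u.
Proof. by rewrite -sumrB; apply: eq_bigr => i _; rewrite !mxE mulrBl. Qed.

Lemma dotvZl c x u : dotv (c *: x) u = c * dotv x u.
Proof. by rewrite mulr_sumr; apply: eq_bigr => i _; rewrite !mxE mulrA. Qed.

Lemma dotvC x y : dotv x y = dotv y x.
Proof. by apply: eq_bigr => i _; rewrite mulrC. Qed.

Lemma dotv_ge0 x : 0 <= dotv x x.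
Proof. by apply: sumr_ge0 => i _; rewrite -expr2 sqr_ge0. Qed.

Lemma dotv_eq0 x : dotv x x = 0 -> x = 0.
Proof.
move=> /eqP; rewrite psumr_eq0 => [/allP H|i _]; last by rewrite -expr2 sqr_ge0.
apply/rowP => i; rewrite mxE; have := H i; rewrite mem_index_enum => /(_ isT).
by rewrite -expr2 sqrf_eq0 => /eqP.
Qed.

(** Also true for u = 0, where the quotient is 0 by convention: dependent rows of M become zero rows
    and do no harm. *)
Lemma dotv_proj x u : dotv (x - (dotv x u / dotv u u) *: u) u = 0.
Proof.
rewrite dotvBl dotvZl; have [u0|u0] := eqVneq (dotv u u) 0; last by rewrite divfK// subrr.
by rewrite u0 mulr0 subr0 (dotv_eq0 u0) /dotv big1// => i _; rewrite mxE mulr0.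
Qed.

(** If x lies in the row space, then the residual y both lies in it and is orthogonal to it, so y is
    orthogonal to itself. *)
Lemma residual_mem U x y : (forall j, dotv y (row j U) = 0) -> (x - y <= U)%MS ->
  (x <= U)%MS = (dotv y y == 0).
Proof.
move=> yU xy; apply/idP/idP => [xU|/eqP/dotv_eq0 y0]; last by move: xy; rewrite y0 subr0.
have /submxP[c yc] : (y <= U)%MS by rewrite -(subKr x y) addmx_sub// eqmx_opp.
apply/eqP; have -> : dotv y y = \sum_j c 0 j * dotv y (row j U).
  under [RHS]eq_bigr => j _ do rewrite mulr_sumr.
  rewrite exchange_big /=; apply: eq_bigr => i _.
  under eq_bigr => j _ do rewrite mulrCA.
  rewrite -mulr_sumr; congr (_ * _); rewrite {1}yc mxE; apply: eq_bigr => j _.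
  by rewrite !mxE.
by rewrite big1// => j _; rewrite yU mulr0.
Qed.

Lemma replace_row_eqmx U U' (a : 'I_n) (c : nat -> R) :
  (forall j, j != a -> row j U' = row j U) ->
  row a U' = row a U - \sum_(j < n | (j < a)%N) c j *: row j U -> (U' :=: U)%MS.
Proof.
move=> H Ha; apply/eqmxP/andP; split; apply/row_subP => j.
  have [->|/H ->] := eqVneq j a; last exact: row_sub.
  rewrite Ha addmx_sub ?row_sub// eqmx_opp summx_sub// => k _.
  by rewrite scalemx_sub// row_sub.
have [->|/H <-] := eqVneq j a; last exact: row_sub.
rewrite -(subrK (\sum_(j < n | (j < a)%N) c j *: row j U) (row a U)) -Ha addmx_sub ?row_sub//.
rewrite summx_sub// => k ka; rewrite scalemx_sub// -H ?row_sub//.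
by apply: contraTneq ka => ->; rewrite ltnn.
Qed.

End DotProduct.

(** Subtracts from the vector at address register 21 its projections on the rows stored from
    register 5 up to register 22. *)
Definition residual_cmd : cmd :=
  Seq (block [:: ISet 36 0; IAdd 23 5 36])
  (While (ILt 23 22)
    (Seq (block [:: IAdd 40 23 36; IAdd 41 23 36; IAdd 42 0 36])
    (Seq dot
    (Seq (block [:: RSet 38 0; RAdd 38 38 40; IAdd 40 21 36; IAdd 41 23 36; IAdd 42 0 36])
    (Seq dot
    (Seq (block [:: RDiv 40 40 38; RSet 41 0; RSub 40 41 40; IAdd 40 21 36; IAdd 41 21 36;
            IAdd 42 23 36; IAdd 43 0 36])
    (Seq axpy (block [:: IAdd 23 23 0])))))))).

(** Gram-Schmidt in place without normalization, since the machine has no square roots; each row is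
    reduced against the rows before it. *)
Definition orthogonalize : cmd :=
  Seq (block [:: ISet 36 0; IAdd 21 5 36])
  (While (ILt 21 6) (Seq (block [:: ISet 36 0; IAdd 22 21 36])
    (Seq residual_cmd (block [:: IAdd 21 21 0])))).

Section Orthogonalize.
Context {R : realType} {n : nat} (oracle : 'rV[R]_n -> R).
Implicit Types (s : state R).
Local Notation wp := (wp oracle).
Local Notation vec s a := (rvec (n := n) s a).

Lemma dot_vec s a b : \sum_(i < n) rmem s (a + i)%N * rmem s (b + i)%N = dotv (vec s a) (vec s b).
Proof. by apply: eq_bigr => i _; rewrite !mxE. Qed.

Lemma vec_eq s s' a : (forall i, (i < n)%N -> rmem s' (a + i)%N = rmem s (a + i)%N) -> vec s' a = vec s a.
Proof. by move=> H; apply/rowP => i; rewrite !mxE H. Qed.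

Lemma wp_residual s b t k : ireg s 0 = n -> (0 < n)%N -> ireg s 5 = b -> ireg s 21 = t ->
  ireg s 22 = (b + n * k)%N -> ((t + n <= b) || (b + n * k <= t))%N ->
  (forall i j, (i < j)%N -> (j < k)%N -> dotv (vec s (b + n * i)) (vec s (b + n * j)) = 0) ->
  wp residual_cmd s (k * (26 * n + 30) + 3) (fun s' =>
    [/\ framex [:: 23; 36] 38 38 s s', imem s' = imem s,
      forall a, ((a < t) || (t + n <= a))%N -> rmem s' a = rmem s a &
      exists2 c : nat -> R, vec s' t = vec s t - \sum_(j < k) c j *: vec s (b + n * j) &
        forall j, (j < k)%N -> dotv (vec s' t) (vec s (b + n * j)) = 0]).
Proof.
move=> h0 n0 hb ht he dis orth.
apply: (@wp_le _ _ _ _ _ (2 + (k * (3 + (8 * n + 4 + (5 + (8 * n + 4 + (7 + (10 * n + 3 + 1)))))).+1).+1)); last first.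
  have -> : (3 + (8 * n + 4 + (5 + (8 * n + 4 + (7 + (10 * n + 3 + 1)))))).+1 = (26 * n + 28)%N by lia.
  have : (k * (26 * n + 28) <= k * (26 * n + 30))%N by rewrite leq_mul2l leq_add2l orbT.
  lia.
apply: wp_seq; isteps; set s1 := State _ _ _ _ _.
pose I j s' := [/\ framex [:: 23; 36] 38 38 s s', imem s' = imem s,
   forall a, ((a < t) || (t + n <= a))%N -> rmem s' a = rmem s a,
   exists2 c : nat -> R, vec s' t = vec s t - \sum_(i < j) c i *: vec s (b + n * i) &
        forall i, (i < j)%N -> dotv (vec s' t) (vec s (b + n * i)) = 0 &
   ireg s' 23 = (b + n * j)%N /\ ireg s' 36 = 0%N].
apply: (wp_while (I := I)).
- move=> j s' [[fi _ _] _ _ _ [h23 _]] /=.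
  by rewrite h23 fi// he ltn_add2l ltn_mul2l n0.
- move=> j s' jk [[fi fr ft] im m [c cE cO] [h23 h36]].
  have jk' : (n * j.+1 <= n * k)%N by rewrite leq_mul2l jk orbT.
  rewrite mulnS in jk'.
  have rowdis i : (i < k)%N -> forall l, (l < n)%N ->
      ((b + n * i + l < t) || (t + n <= b + n * i + l))%N.
    move=> ik l ln; have : (n * i.+1 <= n * k)%N by rewrite leq_mul2l ik orbT.
    by rewrite mulnS => H; move: dis; slia.
  have vrow s2 i : (forall a, ((a < t) || (t + n <= a))%N -> rmem s2 a = rmem s a) ->
      (i < k)%N -> vec s2 (b + n * i) = vec s (b + n * i).
    by move=> m2 ik; apply: vec_eq => l ln; apply: m2; exact: rowdis.
  apply: wp_seq; isteps.
  apply: wp_seq; apply: wp_weaken (@wp_dot _ _ _ _ (b + n * j)%N (b + n * j)%N n _ _ _) (leqnn _) _;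
    rewrite /= ?h23 ?h36 ?addn0 ?fi//.
  move=> s2 [[fi2 fr2 ft2] im2 m2 r2]; rewrite dot_vec /= in r2.
  have vj := vrow s' j m jk; set V := vec s (b + n * j) in vj.
  have E (s3 : state R) a : rmem s3 = rmem s' -> vec s3 a = vec s' a by move=> ms; apply: vec_eq => i _; rewrite ms.
  rewrite vj in r2.
  have e2 i : (i < 40)%N -> ireg s2 i = ireg s' i.
    by move=> ik; rewrite fi2 ?(leq_trans ik)//= !ifF//; apply/negbTE; slia.
  have r2k i : (i < 40)%N -> rreg s2 i = rreg s' i by move=> ik; rewrite fr2.
  apply: wp_seq; isteps.
  apply: wp_seq; apply: wp_weaken (@wp_dot _ _ _ _ t (b + n * j)%N n _ _ _) (leqnn _) _;
    rewrite /= ?e2// ?h23 ?h36 ?addn0 ?fi//.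
  move=> s3 [[fi3 fr3 ft3] im3 m3 r3]; rewrite dot_vec /= in r3.
  rewrite /= in m3.
  rewrite !(E s2 _ m2) vj in r3.
  have e3 i : (i < 40)%N -> ireg s3 i = ireg s' i.
    by move=> ik; rewrite fi3 ?(leq_trans ik)//= !ifF ?e2//; apply/negbTE; slia.
  have r3k i : (i < 38)%N -> rreg s3 i = rreg s' i.
    by move=> ik; rewrite fr3 ?(leq_trans ik)//= !ifF ?r2k ?(leq_trans ik)//; apply/negbTE; slia.
  have r338 : rreg s3 38 = dotv V V by rewrite fr3//= add0r.
  apply: wp_seq; isteps; set s4 := State _ _ _ _ _.
  have r440 : rreg s4 40 = - (dotv (vec s' t) V / dotv V V) by rewrite /= sub0r r3 r338.
  have m4 : rmem s4 = rmem s' by rewrite /= m3 m2.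
  have im4 : imem s4 = imem s by rewrite /= im3 /= im2.
  have h40 : ireg s4 40 = t by rewrite /= !e3// fi// h36 addn0.
  have h41 : ireg s4 41 = t by rewrite /= !e3// fi// h36 addn0.
  have h42 : ireg s4 42 = (b + n * j)%N by rewrite /= !e3// h23 h36 addn0.
  have h43 : ireg s4 43 = n by rewrite /= !e3// fi// h36 addn0.
  have e4 i : (i < 40)%N -> ireg s4 i = ireg s' i.
    by move=> ik /=; rewrite !ifF ?e3//; apply/negbTE; slia.
  have r4k i : (i < 38)%N -> rreg s4 i = rreg s' i.
    by move=> ik /=; rewrite !ifF ?r3k//; apply/negbTE; slia.
  have t4 : tape s4 = tape s by rewrite /= ft3 /= ft2.
  clearbody s4; clear s1 fi2 fr2 r2 fi3 fr3 r3 m2 m3.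
  apply: wp_seq; apply: wp_weaken (@wp_axpy _ _ oracle s4 t t (b + n * j)%N n h40 h41 h42 h43 _ _) (leqnn _) _.
  - by rewrite /apart eqxx.
  - rewrite /apart; apply/orP; right; move: (rowdis j jk 0%N n0) (rowdis j jk n.-1).
    move: jk' dis n0; clear; move: (n * j)%N (n * k)%N => x y; lia.
  move=> s5 [[fi5 fr5 ft5] im5 m5]; rewrite r440 m4 in m5.
  have v5 : vec s5 t = vec s' t - (dotv (vec s' t) V / dotv V V) *: V.
    apply/rowP => i; rewrite -vj !mxE m5 leq_addr ltn_add2l ltn_ord addKn /=.
    by rewrite mulNr vj.
  have m5' a : ((a < t) || (t + n <= a))%N -> rmem s5 a = rmem s a.
    by move=> H; rewrite m5 ifF ?m//; apply/negbTE; move: H; clear; lia.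
  have P5 : exists2 c0 : nat -> R, vec s5 t = vec s t - \sum_(i < j.+1) c0 i *: vec s (b + n * i) &
        forall i, (i < j.+1)%N -> dotv (vec s5 t) (vec s (b + n * i)) = 0.
    exists (fun i => if i == j then dotv (vec s' t) V / dotv V V else c i).
      rewrite v5 cE big_ord_recr /= eqxx opprD addrA; congr (_ - _ - _).
      by apply: eq_bigr => i _; rewrite ltn_eqF.
    (* The new projection direction is orthogonal to the earlier rows, so the orthogonality already
       achieved survives. *)
    move=> i; rewrite ltnS leq_eqVlt v5 => /predU1P[->|ij]; first exact: dotv_proj.
    by rewrite dotvBl dotvZl (cO i ij) (dotvC V (vec s (b + n * i))) (orth i j ij jk) mulr0 subr0.
  isteps; split => /=.
  - split => /= [i /andP[ik ne]|i ik|]; last by rewrite ft5 t4.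
      rewrite ifF ?fi5 ?e4 ?fi ?ik ?(leq_trans ik)//; apply/eqP => ii; by move: ne; rewrite ii.
    by rewrite fr5 ?r4k ?fr ?(leq_trans ik)//.
  - by rewrite im5 im4.
  - exact: m5'.
  - exact: P5.
  - split; last by rewrite fi5// e4.
    by rewrite fi5// e4// h23 fi5// e4// fi// h0 mulnS; clear; lia.
- split => //.
  + split => //= i /andP[ik ne]; rewrite !ifF//; apply/eqP => ii; by move: ne; rewrite ii.
  + by exists (fun=> 0) => //; rewrite big_ord0 subr0; apply: vec_eq.
  + by rewrite /= hb muln0.
- by move=> s' [fr im m ex _].
Qed.

Lemma wp_orthogonalize s b (M : 'M[R]_n) : ireg s 0 = n -> (0 < n)%N -> ireg s 5 = b ->
  ireg s 6 = (b + n * n)%N -> (forall j : 'I_n, vec s (b + n * j) = row j M) ->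
  wp orthogonalize s (n * (n * (26 * n + 30) + 8) + 3) (fun s' =>
    [/\ framex [:: 21; 22; 23; 36] 38 38 s s', imem s' = imem s,
      forall a, ((a < b) || (b + n * n <= a))%N -> rmem s' a = rmem s a &
      exists U : 'M[R]_n, [/\ (U :=: M)%MS, forall j : 'I_n, vec s' (b + n * j) = row j U &
        forall i j : 'I_n, (i < j)%N -> dotv (row i U) (row j U) = 0]]).
Proof.
move=> h0 n0 hb he hM.
apply: (@wp_le _ _ _ _ _ (2 + (n * (2 + (n * (26 * n + 30) + 3 + 1)).+1).+1)); last first.
  move: (n * (26 * n + 30))%N => X; have : (n * (2 + (X + 3 + 1)).+1 <= n * (X + 8))%N.
    by rewrite leq_mul2l; apply/orP; right; lia.
  lia.
apply: wp_seq; isteps; set s1 := State _ _ _ _ _.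
pose I j s' := [/\ framex [:: 21; 22; 23; 36] 38 38 s s', imem s' = imem s,
   forall a, ((a < b) || (b + n * n <= a))%N -> rmem s' a = rmem s a,
   exists U : 'M[R]_n, [/\ (U :=: M)%MS, forall j : 'I_n, vec s' (b + n * j) = row j U &
        forall i i' : 'I_n, (i < i')%N -> (i' < j)%N -> dotv (row i U) (row i' U) = 0] &
   ireg s' 21 = (b + n * j)%N].
apply: (wp_while (m := n) (I := I)).
- move=> j s' [[fi _ _] _ _ _ h21] /=.
  by rewrite h21 fi// he ltn_add2l ltn_mul2l n0.
- move=> j s' jn [fr im m [U [UM hU UO]] h21]; have [fi frr ft] := fr.
  have jn' : (n * j.+1 <= n * n)%N by rewrite leq_mul2l jn orbT.
  rewrite mulnS in jn'.
  apply: wp_seq; isteps; set s2 := State _ _ _ _ _.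
  have e2 i : (i < 38)%N -> i != 22%N -> i != 36%N -> ireg s2 i = ireg s' i.
    by move=> ik /negbTE i1 /negbTE i2 /=; rewrite i1 i2.
  have h22 : ireg s2 22 = (b + n * j)%N by rewrite /= h21 addn0.
  have m2 : rmem s2 = rmem s' by [].
  have v2 a : vec s2 a = vec s' a by apply: vec_eq => i _; rewrite m2.
  have im2 : imem s2 = imem s' by []. have t2 : tape s2 = tape s' by [].
  have r2 : rreg s2 = rreg s' by [].
  clearbody s2.
  apply: wp_seq; apply: wp_weaken (@wp_residual s2 b (b + n * j)%N j _ n0 _ _ h22 _ _) _ _.
  - by rewrite e2// fi.
  - by rewrite e2// fi.
  - by rewrite e2.
  - by rewrite leqnn orbT.
  - move=> i i' ii ij; rewrite !v2.
    have i'n := ltn_trans ij jn; have in' := ltn_trans ii i'n.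
    by have := UO (Ordinal in') (Ordinal i'n) ii ij; rewrite -!hU.
  - by rewrite leq_add2r leq_mul2r (ltnW jn) orbT.
  move=> s3 [fr3 im3 m3 [c cE cO]]; have [fi3 frr3 ft3] := fr3.
  have m3' a : ((a < b) || (b + n * n <= a))%N -> rmem s3 a = rmem s a.
    by move=> H; rewrite m3 ?m2 ?m//; slia.
  have other (i : 'I_n) : i != j :> nat -> vec s3 (b + n * i) = row i U.
    move=> ij; rewrite -hU -v2; apply: vec_eq => l ln; apply: m3.
    case: (ltngtP i j) ij => // ij _.
      have : (n * i.+1 <= n * j)%N by rewrite leq_mul2l ij orbT.
      by rewrite mulnS => H; slia.
    have : (n * j.+1 <= n * i)%N by rewrite leq_mul2l ij orbT.
    by rewrite mulnS => H; slia.
  pose U' : 'M[R]_n := \matrix_i vec s3 (b + n * i).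
  have rU' i : row i U' = vec s3 (b + n * i) by rewrite rowK.
  have P3 : exists U : 'M[R]_n, [/\ (U :=: M)%MS, forall j : 'I_n, vec s3 (b + n * j) = row j U &
        forall i i' : 'I_n, (i < i')%N -> (i' < j.+1)%N -> dotv (row i U) (row i' U) = 0].
    exists U'; split => //.
    - apply: eqmx_trans UM; apply: (@replace_row_eqmx _ _ _ _ (Ordinal jn) c).
        by move=> i ij; rewrite rU' other// -val_eqE.
      rewrite rU' /= cE v2 -hU; congr (_ - _).
      rewrite (big_ord_widen_cond n xpredT (fun i => c i *: vec s2 (b + n * i))) ?(ltnW jn)//=.
      apply: eq_bigr => i ij; rewrite v2 -hU//.
    - move=> i i' ii; rewrite ltnS leq_eqVlt !rU' => /predU1P[ij|ij].
        have Hi : (i < j)%N by rewrite -ij.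
        by rewrite dotvC ij other ?ltn_eqF//; have := cO i Hi; rewrite v2 hU.
      by rewrite !other ?UO// ?ltn_eqF// (ltn_trans ii).
  isteps; split => /=.
  - split => /= [i /andP[ik]|i ik|]; last by rewrite ft3 t2.
      rewrite !inE !negb_or => /and4P[/negbTE n1 /negbTE n2 /negbTE n3 /negbTE n4].
      by rewrite n1 fi3 ?e2 ?fi ?inE ?ik ?n1 ?n2 ?n3 ?n4.
    by rewrite frr3// r2 frr.
  - by rewrite im3 im2.
  - exact: m3'.
  - exact: P3.
  - by rewrite fi3// e2// h21 fi3// e2// fi// h0 mulnS; clear; lia.
- split => //.
  + split => //= i /andP[ik]; rewrite !inE !negb_or => /and4P[/negbTE n1 /negbTE n2 /negbTE n3 /negbTE n4].
    by rewrite n1 n4.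
  + exists M; split => // j; rewrite -hM; exact: vec_eq.
  + by rewrite /= hb muln0.
move=> s' [fr im m [U [UM hU UO]] _]; split => //; exists U; split => // i j ij.
exact: UO.
Qed.

End Orthogonalize.

(** * Reading the input and setting up the constants *)

Lemma nth_allpairs_mul (S T U : Type) (f : S -> T -> U) x0 y0 u0 (s : seq S) (t : seq T) i j :
  (i < size s)%N -> (j < size t)%N ->
  nth u0 [seq f x y | x <- s, y <- t] (size t * i + j) = f (nth x0 s i) (nth y0 t j).
Proof.
elim: s i => //= x s IH [|i] /= il jl; rewrite nth_cat size_map.
  by rewrite muln0 add0n jl (nth_map y0).
by rewrite mulnS -addnA ltnNge leq_addr /= addKn IH.
Qed.

Section Entries.
Context {n : nat} (T : Type) (A : 'M[T]_n).

Lemma size_entries : size (entries A) = (n * n)%N.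
Proof. by rewrite size_allpairs size_enum_ord. Qed.

Lemma nth_entries x0 (i j : 'I_n) : nth x0 (entries A) (n * i + j) = A i j.
Proof.
have := @nth_allpairs_mul _ _ _ (fun i j => A i j) i j x0 (enum 'I_n) (enum 'I_n) i j.
rewrite size_enum_ord => /(_ (ltn_ord i) (ltn_ord j)) ->.
by rewrite !nth_ord_enum.
Qed.
End Entries.

(** Run on the cells of numerators and denominators, this computes [size_bound]. *)
Definition squares_product : cmd :=
  Seq (block [:: RSet 13 1; RSet 14 1; ISet 7 0])
  (While (ILt 7 5) (block [:: RLoad 15 7; RMul 15 15 15; RAdd 15 15 14; RMul 13 13 15; IAdd 7 7 4])).

(** Index registers can only be added and subtracted, so n^2 is obtained by n additions. *)
Definition layout : cmd :=
  Seq (block [:: ISet 3 0; ISet 4 1; ISet 5 0; ISet 7 0])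
  (Seq (While (ILt 7 0) (block [:: IAdd 5 5 0; IAdd 7 7 4]))
  (block [:: IAdd 1 0 0; IAdd 2 5 3; IAdd 5 2 2; IAdd 6 5 2])).

(** Writes the unit vector e_k followed by row k of B. Only the entry 1 of e_k is stored: the other
    cells still hold the initial 0. *)
Definition generator_row : cmd :=
  Seq (block [:: IAdd 11 7 9; RStore 11 14; IAdd 10 7 0; IAdd 12 10 0])
  (Seq (While (ILt 10 12) (block [:: RLoad 15 8; IAdd 11 8 2; RLoad 16 11; RDiv 15 15 16;
     RStore 10 15; IAdd 10 10 4; IAdd 8 8 4]))
  (block [:: IAdd 7 12 3; IAdd 9 9 4])).

Definition generators : cmd :=
  Seq (block [:: IAdd 7 6 3; ISet 8 0; ISet 9 0])
  (Seq (While (ILt 9 0) generator_row)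
  (block [:: IAdd 2 7 3])).

Section Setup.
Context {R : realType} {n : nat} (oracle : 'rV[R]_n -> R).
Implicit Types (s : state R).
Local Notation wp := (wp oracle).

Lemma wp_layout s : ireg s 0 = n ->
  wp layout s (n * 3 + 9) (fun s' =>
    [/\ [/\ ireg s' 0 = n, ireg s' 1 = (n + n)%N, ireg s' 2 = (n * n)%N & ireg s' 3 = 0%N],
      [/\ ireg s' 4 = 1%N, ireg s' 5 = (2 * (n * n))%N & ireg s' 6 = (3 * (n * n))%N],
      rreg s' = rreg s, rmem s' = rmem s & imem s' = imem s]).
Proof.
move=> h0.
apply: (@wp_le _ _ _ _ _ (4 + ((n * 3).+1 + 4))); last lia.
apply: wp_seq; isteps.
pose I k s' := [/\ [/\ ireg s' 0 = n, ireg s' 3 = 0%N, ireg s' 4 = 1%N, ireg s' 5 = (n * k)%N & ireg s' 7 = k],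
   rreg s' = rreg s, rmem s' = rmem s & imem s' = imem s].
apply: wp_seq; apply: (wp_while (m := n) (I := I)).
- by move=> k s' [[i0 _ _ _ i7] _ _ _] /=; rewrite i0 i7.
- move=> k s' kn [[i0 i3 i4 i5 i7] rr mm im]; isteps; split => //; split => //=.
    by rewrite i5 i0 mulnS addnC.
  by rewrite i7 i4 addn1.
- by split => //; split => //=; rewrite ?muln0.
move=> s' [[i0 i3 i4 i5 i7] rr mm im]; isteps; split => //; split => //=; rewrite ?i0 ?i3 ?i5 ?addn0//; lia.
Qed.

Lemma wp_squares_product s N : ireg s 4 = 1%N -> ireg s 5 = N ->
  wp squares_product s (N * 6 + 4) (fun s' => [/\ framex [::] 7 13 s s', rmem s' = rmem s, imem s' = imem s,
    rreg s' 14 = 1 & rreg s' 13 = \prod_(a < N) (1 + rmem s a ^+ 2)]).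
Proof.
move=> h4 h5.
apply: (@wp_le _ _ _ _ _ (3 + (N * 6).+1)); last lia.
apply: wp_seq; isteps.
pose I k s' := [/\ framex [::] 7 13 s s', rmem s' = rmem s, imem s' = imem s,
   rreg s' 14 = 1 /\ ireg s' 7 = k & rreg s' 13 = \prod_(a < k) (1 + rmem s a ^+ 2)].
apply: (wp_while (m := N) (I := I)).
- by move=> k s' [[fi _ _] _ _ [_ i7] _] /=; rewrite i7 fi// h5.
- move=> k s' kn [[fi fr ft] mm im [r14 i7] r13]; isteps; split => //=.
  + split => //= i H.
      by rewrite ifF ?fi//; apply/eqP => ii; move: H; rewrite ii.
    by rewrite !ifF ?fr//; apply/negbTE; move: H; clear; lia.
  + by rewrite i7 fi// h4 addn1.
  + by rewrite r13 big_ord_recr /= r14 mm i7 expr2 [_ + 1]addrC.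
- split => //=.
  + split => //= i H; last by rewrite !ifF//; apply/negbTE; move: H; clear; lia.
    by rewrite ifF//; apply/eqP => ii; move: H; rewrite ii.
  + by rewrite big_ord0.
- by move=> s' [fr mm im [r14 _] r13].
Qed.

Lemma wp_generator_row s k : (0 < n)%N -> ireg s 0 = n -> ireg s 2 = (n * n)%N -> ireg s 3 = 0%N ->
  ireg s 4 = 1%N -> ireg s 6 = (3 * (n * n))%N -> rreg s 14 = 1 ->
  ireg s 7 = (3 * (n * n) + (n + n) * k)%N -> ireg s 8 = (n * k)%N -> ireg s 9 = k -> (k < n)%N ->
  wp generator_row s (n * 8 + 8) (fun s' => [/\ framex [::] 7 15 s s', imem s' = imem s,
     [/\ ireg s' 7 = (3 * (n * n) + (n + n) * k.+1)%N, ireg s' 8 = (n * k.+1)%N & ireg s' 9 = k.+1],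
     forall a, (a < ireg s 7)%N || (ireg s 7 + (n + n) <= a)%N -> rmem s' a = rmem s a &
     (rmem s' (ireg s 7 + k)%N = 1 /\
      (forall i, (i < n)%N -> i != k -> rmem s' (ireg s 7 + i)%N = rmem s (ireg s 7 + i)%N)) /\
      forall i, (i < n)%N -> rmem s' (ireg s 7 + n + i)%N =
         rmem s (n * k + i)%N / rmem s (n * n + n * k + i)%N]).
Proof.
move=> n0 h0 h2 h3 h4 h6 r14 h7 h8 h9 kn.
have nk : (n * k.+1 <= n * n)%N by rewrite leq_mul2l kn orbT.
rewrite mulnS in nk.
apply: (@wp_le _ _ _ _ _ (4 + ((n * 8).+1 + 2))); last lia.
apply: wp_seq; isteps; set s1 := State _ _ _ _ _.
set g := ireg s 7 in h7 *.
have fr1 : framex [:: 10; 11; 12] 40 40 s s1.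
  by split => //= j; rewrite !inE => H; rewrite !ifF//; apply/negbTE; move: H; clear; lia.
have h10 : ireg s1 10 = (g + n)%N by rewrite /= h0.
have h12 : ireg s1 12 = (g + n + n)%N by rewrite /= h0.
have m1 : rmem s1 = fun x => if x == (g + k)%N then 1 else rmem s x by rewrite /= h9 r14.
have im1 : imem s1 = imem s by [].
clearbody s1; have [fi1 fr1' ft1] := fr1.
pose I i s' := [/\ framex [:: 10; 11; 8] 17 15 s1 s', imem s' = imem s,
   ireg s' 10 = (g + n + i)%N /\ ireg s' 8 = (n * k + i)%N,
   forall a, (a < g + n)%N || (g + n + n <= a)%N -> rmem s' a = rmem s1 a &
   forall j, (j < i)%N -> rmem s' (g + n + j)%N = rmem s (n * k + j)%N / rmem s (n * n + n * k + j)%N].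
apply: wp_seq; apply: (wp_while (m := n) (I := I)).
- by move=> i s' [[fi _ _] _ [h10' _] _ _] /=; rewrite h10' fi// h12 ltn_add2l.
- move=> i s' in_ [[fi fr ft] im [h10' h8'] m mm]; isteps.
  have H2 : ireg s' 2 = (n * n)%N by rewrite fi// fi1.
  have H4 : ireg s' 4 = 1%N by rewrite fi// fi1.
  have E1 : rmem s' (n * k + i)%N = rmem s (n * k + i)%N.
    by rewrite m ?m1 ?ifF//; [apply/negbTE|]; rewrite h7; slia.
  have E2 : rmem s' (n * k + i + n * n)%N = rmem s (n * n + n * k + i)%N.
    rewrite m ?m1 ?ifF//; [congr (rmem s _)|apply/negbTE|]; rewrite ?h7; slia.
  split => /=.
  + split => //= j H.
      rewrite !inE in H; rewrite !ifF ?fi ?inE//; try apply/negbTE; move: H; clear; lia.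
    by rewrite !ifF ?fr//; apply/negbTE; move: H; clear; lia.
  + by [].
  + by rewrite h10' h8' H4; split; lia.
  + move=> a ha; rewrite h10' ifF ?m//; apply/negbTE; move: ha in_; clear; lia.
  + move=> j; rewrite ltnS leq_eqVlt h10' h8' H2 => /predU1P[->|ji].
      by rewrite eqxx E1 E2.
    by rewrite ifF ?mm//; apply/negbTE; move: ji; clear; lia.
- split => //=; split; first by rewrite h10 addn0.
  by rewrite fi1// h8 addn0.
move=> s' [[fi fr ft] im [h10' h8'] m mm]; isteps.
have H12 : ireg s' 12 = (g + n + n)%N by rewrite fi.
have H3 : ireg s' 3 = 0%N by rewrite fi// fi1.
have H4 : ireg s' 4 = 1%N by rewrite fi// fi1.
have H9 : ireg s' 9 = k by rewrite fi// fi1.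
split => /=.
- split => //= [j H|j H|]; last by rewrite ft ft1.
    rewrite andbT in H; rewrite !ifF ?fi ?fi1 ?inE//; try apply/negbTE; move: H; clear; lia.
  by rewrite fr// fr1'// (leq_trans H).
- by [].
- by rewrite H12 H3 H9 H4 addn0 addn1 h8' h7 mulnS mulnS; split => //; lia.
- by move=> a ha; rewrite m ?m1 ?ifF//; [apply/negbTE|]; move: ha kn; clear; lia.
- split; first split.
  + by rewrite m ?m1 ?eqxx// ltn_add2l kn.
  + by move=> i in_ ik; rewrite m ?m1 ?ltn_add2l ?in_// ifF// eqn_add2l; apply/negbTE.
  + exact: mm.
Qed.

End Setup.

Definition setup_common : cmd := Seq layout (Seq squares_product (Seq orthogonalize generators)).

(** Real registers 1, 2, 3 and 6 receive vend, 4 U / vend, U and vend / 2, which steer the loops;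
    the heap starts right after the generators. *)
Definition derive_constants : seq instr :=
  [:: RDiv 3 13 0; RMul 15 13 13; RMul 15 1 15; RDiv 1 14 15; RSet 15 2; RDiv 6 1 15; RSet 15 4;
      RMul 15 15 3; RDiv 2 15 1; RSet 0 1; RAdd 7 3 16; ISet 20 0; IAdd 28 2 3; IStore 20 28].

Definition setup_approx : cmd := Seq setup_common
  (block ([:: RSet 16 0; RAdd 4 3 16; RSet 15 4; RDiv 15 4 15; RAdd 5 14 15] ++ derive_constants)).

Definition setup_exact : cmd := Seq setup_common
  (block ([:: RSet 16 0; RDiv 4 14 3; RSet 5 1] ++ derive_constants)).

Section Stat.
Context {R : realType} {n : nat} (B : 'M[rat]_n) (M : 'M[R]_n).
Variables (e fac U vend : R).
Implicit Types (s : state R).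
Local Notation Br := (map_mx ratr B : 'M[R]_n).
Local Notation L := (n + n)%N.
Local Notation nn := (n * n)%N.
Local Notation vec s a := (rvec (n := n) s a).

(** The data fixed once setup is over. M is represented by orthogonal rows spanning the same space,
    and [imem s 0] states that all of this lies below the heap. *)
Definition stat s :=
  [/\ [/\ ireg s 0 = n, ireg s 1 = L, ireg s 2 = (3 * nn + L * n)%N, ireg s 3 = 0%N & ireg s 4 = 1%N] /\
      (ireg s 5 = (2 * nn)%N /\ ireg s 6 = (3 * nn)%N),
    [/\ rreg s 0 = 1, rreg s 1 = vend, rreg s 2 = 4 * U / vend, rreg s 3 = U &
       [/\ rreg s 4 = e, rreg s 5 = fac & rreg s 6 = vend / 2]],
    forall k : 'I_n, stored Br (rmem s) (3 * nn + L * k) (delta_mx 0 k),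
    exists W : 'M[R]_n, [/\ (W :=: M)%MS, forall j : 'I_n, vec s (2 * nn + n * j) = row j W &
        forall i j : 'I_n, (i < j)%N -> dotv (row i W) (row j W) = 0] &
    imem s 0 = (3 * nn + L * n)%N].

Lemma stat_frame s s' : frame 7 7 s s' -> (forall a, (a < 3 * nn + L * n)%N -> rmem s' a = rmem s a) ->
  imem s' 0 = imem s 0 -> stat s -> stat s'.
Proof.
move=> [fi fr _] m im [[[i0 i1 i2 i3 i4] [i5 i6]] [r0 r1 r2 r3 [r4 r5 r6]] G [W [WM hW oW]] im0].
split; [by rewrite !fi|by rewrite !fr| | |by rewrite im].
- move=> k; apply: (@stored_below _ _ _ _ _ (3 * nn + L * n)%N) (G k) => //.
  rewrite -addnA leq_add2l -mulnSr leq_mul2l; apply/orP; right; exact: ltn_ord.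
- exists W; split => // j; rewrite -hW; apply: vec_eq => i il; apply: m.
  have : (n * j.+1 <= nn)%N by rewrite leq_mul2l ltn_ord orbT.
  rewrite mulnS; move: il; clear; lia.
Qed.

Lemma stat_genv s : stat s -> genv n fac (vend / 2) s.
Proof. by move=> [[[i0 i1 _ _ _] _] [_ _ _ _ [_ r5 r6]] _ _ _]; split. Qed.

End Stat.

Section SetupProof.
Context {R : realType} {n : nat} (oracle : 'rV[R]_n -> R) (B : 'M[rat]_n) (M : 'M[R]_n).
Implicit Types (s : state R).
Hypothesis n_gt0 : (0 < n)%N.
Local Notation wp := (wp oracle).
Local Notation Br := (map_mx ratr B : 'M[R]_n).
Local Notation L := (n + n)%N.
Local Notation nn := (n * n)%N.
Local Notation vec s a := (rvec (n := n) s a).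

Lemma wp_generators s : ireg s 0 = n -> ireg s 2 = nn -> ireg s 3 = 0%N ->
  ireg s 4 = 1%N -> ireg s 6 = (3 * nn)%N -> rreg s 14 = 1 ->
  (forall i j : 'I_n, rmem s (n * i + j)%N = (numq (B i j))%:~R) ->
  (forall i j : 'I_n, rmem s (nn + (n * i + j))%N = (denq (B i j))%:~R) ->
  (forall a, (3 * nn <= a)%N -> rmem s a = 0) ->
  wp generators s (n * (n * 8 + 9) + 5) (fun s' =>
    [/\ framex [:: 2] 7 15 s s', imem s' = imem s, ireg s' 2 = (3 * nn + L * n)%N,
      forall a, (a < 3 * nn)%N -> rmem s' a = rmem s a &
      forall k : 'I_n, stored Br (rmem s') (3 * nn + L * k) (delta_mx 0 k)]).
Proof.
move=> h0 h2 h3 h4 h6 r14 num den zero.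
apply: (@wp_le _ _ _ _ _ (3 + ((n * (n * 8 + 8).+1).+1 + 1))); last first.
  by rewrite -addnS; move: (n * _)%N => X; lia.
apply: wp_seq; isteps; set s1 := State _ _ _ _ _.
pose I k s' := [/\ framex [::] 7 15 s s', imem s' = imem s,
  [/\ ireg s' 7 = (3 * nn + L * k)%N, ireg s' 8 = (n * k)%N & ireg s' 9 = k],
  forall a, (a < 3 * nn)%N || (3 * nn + L * k <= a)%N -> rmem s' a = rmem s a &
  forall i : 'I_n, (i < k)%N -> stored Br (rmem s') (3 * nn + L * i) (delta_mx 0 i)].
apply: wp_seq; apply: (wp_while (m := n) (I := I)).
- by move=> k s' [[fi _ _] _ [_ _ h9] _ _] /=; rewrite h9 fi// h0.
- move=> k s' kn [[fi fr ft] im [h7 h8 h9] m st].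
  have e0 : ireg s' 0 = n by rewrite fi.
  have e2 : ireg s' 2 = nn by rewrite fi.
  have e3 : ireg s' 3 = 0%N by rewrite fi.
  have e4 : ireg s' 4 = 1%N by rewrite fi.
  have e6 : ireg s' 6 = (3 * nn)%N by rewrite fi.
  have e14 : rreg s' 14 = 1 by rewrite fr.
  apply: wp_weaken (wp_generator_row oracle n_gt0 e0 e2 e3 e4 e6 e14 h7 h8 h9 kn) (leqnn _) _.
  move=> s2 [[fi2 fr2 ft2] im2 h2' m2 [[g1 g2] g3]]; rewrite h7 in m2 g1 g2 g3.
  split => //.
  + split => [i ik|i ik|]; [by rewrite fi2// fi|by rewrite fr2// fr|by rewrite ft2].
  + by rewrite im2.
  + move=> a ha; rewrite m2 ?m//; move: ha; rewrite mulnS; clear; move: (L * k)%N => X; lia.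
  move=> i; rewrite ltnS leq_eqVlt => /predU1P[ik|ik]; last first.
    apply: stored_frame (st i ik) => l ll; apply: m2.
    have : (L * i.+1 <= L * k)%N by rewrite leq_mul2l ik orbT.
    rewrite mulnS; move: ll; clear; move: (L * i)%N (L * k)%N => X Y; lia.
  move=> l; rewrite ik.
  have [ln|nl] := ltnP l n.
    move=> _; have -> : enc Br (delta_mx 0 i) l = ((l == k)%N)%:R.
      rewrite (enc_coord Br (delta_mx 0 i) (Ordinal ln)) mxE /= -val_eqE /= ik.
      by rewrite eq_sym; case: (_ == _).
    have [->|lk] := eqVneq l k; first by rewrite g1.
    rewrite g2// m; last by rewrite -addnA leq_add2l leq_addr orbT.
    by apply: zero; rewrite -addnA leq_addr.
  move=> lL; have ln : (l - n < n)%N by move: lL nl; clear; lia.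
  have -> : l = (n + (l - n))%N by rewrite subnKC.
  rewrite (enc_pt Br (delta_mx 0 i) (Ordinal ln)) addnA g3//.
  have -> : latpt Br (delta_mx 0 i) = row i Br by rewrite /latpt map_delta_mx -rowE.
  have kn' : (n * k.+1 <= nn)%N by rewrite leq_mul2l kn orbT.
  rewrite mulnS in kn'.
  rewrite !mxE !m; last 2 first.
    by move: kn' ln; clear; move: (n * k)%N nn => X Y; lia.
    by move: kn' ln; clear; move: (n * k)%N nn => X Y; lia.
  have := num i (Ordinal ln); have := den i (Ordinal ln); rewrite /= ik -!addnA => -> ->.
  by rewrite /ratr.
- split => //=.
  + by split => //= i H; rewrite !ifF//; apply/negbTE; move: H; clear; lia.
  + by rewrite h6 h3 !muln0 !addn0.
move=> s' [[fi fr ft] im [h7 h8 h9] m st]; isteps; split => //=.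
- split => //= i H; rewrite ?inE in H; rewrite ifF ?fi ?inE//; try apply/negbTE; move: H; clear; lia.
- by rewrite h7 fi// h3 addn0.
- by move=> a ha; apply: m; rewrite ha.
- by move=> k; apply: st.
Qed.

Definition stat_time := (26 * (n * (n * n)) + 100 * (n * n) + 100 * n + 100)%N.



Lemma wp_setup_common (p : seq R) w :
  wp setup_common (input p B M w) stat_time (fun s' =>
    [/\ [/\ ireg s' 0 = n, ireg s' 1 = L, ireg s' 2 = (3 * nn + L * n)%N, ireg s' 3 = 0%N & ireg s' 4 = 1%N] /\
      (ireg s' 5 = (2 * nn)%N /\ ireg s' 6 = (3 * nn)%N),
      rreg s' 14 = 1 /\ rreg s' 13 = size_bound B,
      forall i, (i < 13)%N -> rreg s' i = nth 0 p i,
      forall k : 'I_n, stored Br (rmem s') (3 * nn + L * k) (delta_mx 0 k) &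
      exists W : 'M[R]_n, [/\ (W :=: M)%MS, forall j : 'I_n, vec s' (2 * nn + n * j) = row j W &
        forall i j : 'I_n, (i < j)%N -> dotv (row i W) (row j W) = 0]]).
Proof.
set s := input p B M w.
set nums := [seq (numq x)%:~R | x <- entries B] : seq R.
set dens := [seq (denq x)%:~R | x <- entries B] : seq R.
have sn : size nums = nn by rewrite size_map size_entries.
have sd : size dens = nn by rewrite size_map size_entries.
have ms a : rmem s a = nth 0 (nums ++ dens ++ entries M) a by [].
have ij (i j : 'I_n) : (n * i + j < nn)%N.
  have : (n * i.+1 <= nn)%N by rewrite leq_mul2l ltn_ord orbT.
  by rewrite mulnS; have := ltn_ord j; lia.
have num (i j : 'I_n) : rmem s (n * i + j)%N = (numq (B i j))%:~R.
  by rewrite ms nth_cat sn ij (nth_map 0) ?size_entries// nth_entries.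
have den (i j : 'I_n) : rmem s (nn + (n * i + j))%N = (denq (B i j))%:~R.
  rewrite ms nth_cat sn ltnNge leq_addr /= addKn nth_cat sd ij (nth_map 0) ?size_entries// nth_entries//.
have mat (i j : 'I_n) : rmem s (2 * nn + (n * i + j))%N = M i j.
  rewrite ms nth_cat sn ifF; last by apply/negbTE; lia.
  have -> : (2 * nn + (n * i + j) - nn = nn + (n * i + j))%N by lia.
  by rewrite nth_cat sd ltnNge leq_addr /= addKn nth_entries.
have zero a : (3 * nn <= a)%N -> rmem s a = 0.
  by move=> ha; rewrite ms nth_default// !size_cat sn sd size_entries; lia.
(* The first 2 n^2 cells are exactly the numerators and denominators of the entries, so the product
   over cells regroups into the product over entries. *)
have Q : \prod_(a < 2 * nn) (1 + rmem s a ^+ 2) = size_bound B.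
  have -> : \prod_(a < 2 * nn) (1 + rmem s a ^+ 2) = \prod_(x <- nums ++ dens) (1 + x ^+ 2).
    rewrite (big_nth 0) size_cat sn sd addnn -mul2n big_mkord; apply: eq_bigr => a _.
    by rewrite ms catA nth_cat size_cat sn sd addnn -mul2n ltn_ord.
  rewrite big_cat /= /nums /dens !big_map /entries !big_allpairs_dep -big_split /= /size_bound big_enum.
  by apply: eq_bigr => i _; rewrite -big_split /= big_enum.
apply: (@wp_le _ _ _ _ _ ((n * 3 + 9) + ((2 * nn * 6 + 4) + ((n * (n * (26 * n + 30) + 8) + 3) +
   (n * (n * 8 + 9) + 5))))); last first.
  by rewrite /stat_time; clear; lia.
apply: wp_seq; apply: wp_weaken (@wp_layout _ _ oracle s (erefl _)) (leqnn _) _.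
move=> s1 [[i0 i1 i2 i3] [i4 i5 i6] rr1 m1 im1].
apply: wp_seq; apply: wp_weaken (wp_squares_product oracle i4 i5) (leqnn _) _.
move=> s2 [[fi2 fr2 ft2] m2 im2 r14 r13]; rewrite m1 Q in r13.
apply: wp_seq; apply: wp_weaken (@wp_orthogonalize _ _ oracle s2 (2 * nn)%N M _ n_gt0 _ _ _) (leqnn _) _.
- by rewrite fi2.
- by rewrite fi2.
- by rewrite fi2// i6; lia.
- by move=> j; apply/rowP => i; rewrite !mxE m2 m1 -mat addnA.
move=> s3 [[fi3 fr3 ft3] im3 m3 ex3].
have k3 i : (i < 7)%N -> ireg s3 i = ireg s1 i.
  by move=> ik; rewrite fi3 ?fi2//; rewrite ?inE; move: ik; clear; lia.
have m3' a : (a < 2 * nn)%N || (2 * nn + nn <= a)%N -> rmem s3 a = rmem s a.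
  by move=> ha; rewrite m3// m2 m1.
apply: wp_weaken (@wp_generators s3 _ _ _ _ _ _ _ _ _) (leqnn _) _; rewrite ?k3//.
- by rewrite fr3.
- by move=> i j; rewrite m3' ?num//; have := ij i j; lia.
- by move=> i j; rewrite m3' ?den//; have := ij i j; lia.
- by move=> a ha; rewrite m3' ?zero//; lia.
move=> s4 [[fi4 fr4 ft4] im4 h2 m4 st4]; split => //.
- by rewrite h2 !fi4 ?k3.
- by rewrite !fr4 ?fr3.
- by move=> i i13; rewrite fr4 ?fr3 ?fr2 ?rr1// (leq_trans i13).
case: ex3 => W [WM hW oW]; exists W; split => // j; rewrite -hW; apply: vec_eq => i il; apply: m4.
have : (n * j.+1 <= nn)%N by rewrite leq_mul2l ltn_ord orbT.
by rewrite mulnS; lia.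
Qed.

(** Common to both setups, which differ only in the instructions [pre] that load the accuracy e and
    the gauge ratio fac. *)
Lemma wp_derive (r rho gamma x e fac : R) w setup pre :
  r != 0 -> setup = Seq setup_common (block (pre ++ derive_constants)) ->
  (forall s b Q, rreg s 14 = 1 -> rreg s 3 = x ->
     (forall s', ireg s' = ireg s -> imem s' = imem s -> rmem s' = rmem s ->
        (forall i, (i < 4)%N || (i == 13%N) || (i == 14%N) -> rreg s' i = rreg s i) ->
        rreg s' 16 = 0 -> rreg s' 4 = e -> rreg s' 5 = fac -> wp (block derive_constants) s' b Q) ->
     wp (block (pre ++ derive_constants)) s (5 + b) Q) ->
  wp setup (input [:: r; rho; gamma; x] B M w) (stat_time + 19) (fun s' =>
    [/\ stat B M e fac (size_bound B / r) (1 / (rho * (size_bound B * size_bound B))) s',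
        rreg s' 7 = size_bound B / r & heap Br [::] s']).
Proof.
move=> r0 -> Hpre.
apply: wp_seq; apply: wp_weaken (wp_setup_common [:: r; rho; gamma; x] w) (leqnn _) _.
move=> s1 [[[i0 i1 i2 i3 i4] [i5 i6]] [r14 r13] rr G W].
rewrite (_ : 19 = 5 + 14)%N//; apply: Hpre => //; first by rewrite rr.
move=> s2 ii im mm rr2 r16 r4 r5.
have r20 : rreg s2 0 = r by rewrite rr2// rr.
have r21 : rreg s2 1 = rho by rewrite rr2// rr.
have r213 : rreg s2 13 = size_bound B by rewrite rr2.
have r214 : rreg s2 14 = 1 by rewrite rr2.
isteps; split => /=.
- split => /=.
  + by rewrite !ii.
  + by rewrite r20 r21 r213 r214; split.
  + by rewrite mm.
  + case: W => W [WM hW oW]; exists W; split => // j; rewrite -hW; apply: vec_eq => i _ /=.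
    by rewrite mm.
  + by rewrite ii i2 i3 addn0.
- by rewrite r16 addr0 r213 r20.
- by split => //=.
Qed.

Lemma wp_setup_approx (r rho gamma x : R) w : r != 0 ->
  wp setup_approx (input [:: r; rho; gamma; x] B M w) (stat_time + 19) (fun s' =>
    [/\ stat B M x (1 + x / 4) (size_bound B / r) (1 / (rho * (size_bound B * size_bound B))) s',
        rreg s' 7 = size_bound B / r & heap Br [::] s']).
Proof.
move=> r0; apply: (@wp_derive r rho gamma x x (1 + x / 4) w setup_approx
  [:: RSet 16 0; RAdd 4 3 16; RSet 15 4; RDiv 15 4 15; RAdd 5 14 15] r0 erefl) => s b Q r14 r3 H.
do 5! (apply: wp_cons => //=); apply: H => //=.
- by move=> i; do ! (case: i => [|i] //=).
- by rewrite /upd /= r3 addr0.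
- by rewrite /upd /= r14 r3 addr0.
Qed.

Lemma wp_setup_exact (r rho gamma x : R) w : r != 0 ->
  wp setup_exact (input [:: r; rho; gamma; x] B M w) (stat_time + 19) (fun s' =>
    [/\ stat B M (1 / x) 1 (size_bound B / r) (1 / (rho * (size_bound B * size_bound B))) s',
        rreg s' 7 = size_bound B / r & heap Br [::] s']).
Proof.
move=> r0; apply: (@wp_derive r rho gamma x (1 / x) 1 w setup_exact
  [:: RSet 16 0; RDiv 4 14 3; RSet 5 1] r0 erefl) => s b Q r14 r3 H.
apply: (@wp_le _ _ _ _ _ (3 + b)); last by lia.
do 3! (apply: wp_cons => //=); apply: H => //=.
- by move=> i; do ! (case: i => [|i] //=).
- by rewrite /upd /= r14 r3.
Qed.

End SetupProof.

(** * Base lists for the sup norm *)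

Definition zero_vec : cmd :=
  Seq (block [:: IAdd 40 28 3; IAdd 41 28 3; IAdd 42 28 3; IAdd 43 1 3; RSet 40 0; RSub 40 40 0])
  (Seq axpy (block [:: IAdd 28 28 1])).

Definition close_list : cmd := block [:: IAdd 20 20 4; IStore 20 28].

(** Register 14 freezes the old end of the list, so only the original elements are shifted while
    copies are appended. *)
Definition expand_cmd : cmd :=
  Seq (block [:: IAdd 14 28 3; IAdd 15 13 3])
  (While (ILt 15 14)
    (Seq (block [:: IAdd 40 28 3; IAdd 41 15 3; IAdd 42 16 3; IAdd 43 1 3; RSet 40 0; RAdd 40 40 13])
    (Seq axpy (block [:: IAdd 28 28 1; IAdd 15 15 1])))).

Definition base_list_cmd : cmd :=
  Seq (block [:: IAdd 13 28 3]) (Seq zero_vec (Seq (block [:: IAdd 16 6 3])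
  (Seq (While (ILt 16 2)
     (Seq (block [:: RSet 13 0; RAdd 13 13 8]) (Seq expand_cmd
     (Seq (block [:: RSet 13 0; RSub 13 13 8]) (Seq expand_cmd (block [:: IAdd 16 16 1]))))))
  close_list))).

Definition base_phase : cmd :=
  Seq zero_vec (Seq close_list (Seq (block [:: RSet 8 1])
  (While (RLt 8 2) (Seq base_list_cmd (block [:: RAdd 8 8 8]))))).

Section Grow.
Context {R : realType} {n : nat} (Br : 'M[R]_n).
Implicit Types (s : state R) (ALL : seq (seq 'rV[int]_n)) (W : seq 'rV[int]_n).
Local Notation L := (n + n)%N.

(** The heap only grows: whatever was stored below its old end, and the old address table, stay
    valid. *)
Definition grow s s' := [/\ forall a, (a < ireg s 28)%N -> rmem s' a = rmem s a,
  (ireg s 28 <= ireg s' 28)%N, forall a, (a <= ireg s 20)%N -> imem s' a = imem s a &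
  (ireg s 20 <= ireg s' 20)%N].

Lemma grow_refl s : grow s s. Proof. by []. Qed.

Lemma grow_trans s1 s2 s3 : grow s1 s2 -> grow s2 s3 -> grow s1 s3.
Proof.
move=> [m1 h1 i1 t1] [m2 h2 i2 t2]; split.
- by move=> a ah; rewrite m2 ?m1// (leq_trans ah).
- exact: leq_trans h1 h2.
- by move=> a ah; rewrite i2 ?i1// (leq_trans ah).
- exact: leq_trans t1 t2.
Qed.

(** A heap whose last list W is still under construction and has not yet been closed by a table
    entry. *)
Definition heap_open ALL W s := [/\ ireg s 20 = size ALL,
  ireg s 28 = (imem s (size ALL) + L * size W)%N,
  forall e, (e < size ALL)%N -> imem s e.+1 = (imem s e + L * size (nth [::] ALL e))%N,
  forall e, (e < size ALL)%N -> vlist Br (rmem s) (imem s e) (nth [::] ALL e) &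
  vlist Br (rmem s) (imem s (size ALL)) W].

Lemma heap_openE ALL s : heap Br ALL s -> heap_open ALL [::] s.
Proof. by move=> [h1 h2 h3 h4]; split => //; rewrite muln0 addn0. Qed.

Lemma heap_open_mono ALL W s e : heap_open ALL W s -> (e <= size ALL)%N ->
  (imem s e <= imem s (size ALL))%N.
Proof.
move=> [_ _ hs _ _] el.
have H d : (e + d <= size ALL)%N -> (imem s e <= imem s (e + d))%N.
  elim: d => [|d IH] H; first by rewrite addn0.
  by rewrite addnS hs ?(leq_trans (IH _))// ?leq_addr//; slia.
by have := H (size ALL - e)%N; rewrite subnKC//; apply.
Qed.

Lemma heap_open_frame ALL W s s' : ireg s' 20 = ireg s 20 -> ireg s' 28 = ireg s 28 ->
  grow s s' -> heap_open ALL W s -> heap_open ALL W s'.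
Proof.
move=> e20 e28 [m h28 im h20] hp; have [h1 h2 h3 h4 h5] := hp.
have imE a : (a <= size ALL)%N -> imem s' a = imem s a by move=> H; rewrite im// h1.
have b e : (e < size ALL)%N -> (imem s e + L * size (nth [::] ALL e) <= ireg s 28)%N.
  move=> el; rewrite -h3// h2; apply: leq_trans (leq_addr _ _); exact: heap_open_mono hp _.
split.
- by rewrite e20.
- by rewrite e28 imE.
- by move=> e el; rewrite !imE ?h3// ltnW.
- move=> e el; rewrite imE ?(ltnW el)//; apply: (@vlist_below _ _ _ _ _ (ireg s 28)) (h4 e el) => //.
  exact: b.
- by rewrite imE//; apply: (@vlist_below _ _ _ _ _ (ireg s 28)) h5 => //; rewrite h2.
Qed.

Lemma heap_frame ALL s s' : ireg s' 20 = ireg s 20 -> ireg s' 28 = ireg s 28 ->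
  grow s s' -> heap Br ALL s -> heap Br ALL s'.
Proof.
move=> e20 e28 g /heap_openE /(heap_open_frame e20 e28 g) [h1 h2 h3 h4 _]; split => //.
by rewrite h2 muln0 addn0.
Qed.

Lemma heap_open_le ALL W s e : heap_open ALL W s -> (e <= size ALL)%N -> (imem s e <= ireg s 28)%N.
Proof.
move=> hp el; have := heap_open_mono hp el; case: hp => _ -> _ _ _ /leq_trans; apply.
exact: leq_addr.
Qed.

Lemma frame_unset20 ki kr s s' v : (ki <= 20)%N -> frame 40 kr s (set_ireg s' 20 v) -> frame ki kr s s'.
Proof.
move=> k20 [fi fr ft]; split => // i ik; rewrite -fi ?(leq_trans ik)//=; last slia.
by rewrite /upd ifF//; apply/negbTE; slia.
Qed.

Lemma frame_unset28 ki kr s s' v : (ki <= 28)%N -> frame 40 kr s (set_ireg s' 28 v) -> frame ki kr s s'.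
Proof.
move=> k20 [fi fr ft]; split => // i ik; rewrite -fi ?(leq_trans ik)//=; last slia.
by rewrite /upd ifF//; apply/negbTE; slia.
Qed.

End Grow.

Section BasePhase.
Context {R : realType} {n : nat} (oracle : 'rV[R]_n -> R) (B : 'M[rat]_n) (M : 'M[R]_n).
Variables (e fac U vend : R).
Implicit Types (s : state R) (ALL : seq (seq 'rV[int]_n)) (W : seq 'rV[int]_n).
Hypothesis n_gt0 : (0 < n)%N.
Local Notation wp := (wp oracle).
Local Notation Br := (map_mx ratr B : 'M[R]_n).
Local Notation L := (n + n)%N.
Local Notation nn := (n * n)%N.
Local Notation stat := (stat B M e fac U vend).
Local Notation heap_open := (heap_open Br).
Local Notation heap := (heap Br).

Lemma stat_grow ALL W s s' : heap_open ALL W s -> frame 7 7 s s' -> grow s s' -> stat s -> stat s'.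
Proof.
move=> hp fr [m _ im _] st; have [_ _ _ _ im0] := st.
apply: stat_frame fr _ _ st; last exact: im.
by move=> a ah; apply: m; apply: leq_trans ah _; rewrite -im0; exact: heap_open_le hp _.
Qed.

Lemma heap_open_push ALL W z s h s' : heap_open ALL W s -> ireg s' 20 = ireg s 20 ->
  ireg s 28 = h -> ireg s' 28 = (h + L)%N -> imem s' = imem s ->
  (forall a, (a < h)%N -> rmem s' a = rmem s a) -> stored Br (rmem s') h z ->
  heap_open ALL (rcons W z) s' /\ grow s s'.
Proof.
move=> hp e20 eh e28 im m sz.
pose s1 := State (ireg s) (imem s) (rreg s) (rmem s') (tape s).
have g1 : grow s s1 by split => // a; rewrite eh; exact: m.
have [h1 h2 h3 h4 h5] := heap_open_frame (erefl _ : ireg s1 20 = ireg s 20) (erefl _ : ireg s1 28 = ireg s 28) g1 hp.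
rewrite /= in h1 h2 h3 h4 h5; split; first split => //.
- by rewrite e20.
- by rewrite e28 -eh h2 im size_rcons mulnS; lia.
- by move=> a al; rewrite im h3.
- by move=> a al; rewrite im; exact: h4.
- by rewrite im; apply: vlist_rcons h5 _; rewrite -h2 eh.
split => //.
- by move=> a; rewrite eh; exact: m.
- by rewrite e28 eh leq_addr.
- by rewrite im.
- by rewrite e20.
Qed.

(** Free cells may contain leftovers of earlier scratch work, so the zero vector is produced as h +
    (-1) h. *)
Lemma wp_zero_vec s ALL : stat s -> heap_open ALL [::] s ->
  wp zero_vec s (10 * L + 10) (fun s' =>
    [/\ heap_open ALL [:: 0] s', grow s s' & frame 40 30 s (set_ireg s' 28 (ireg s 28))]).
Proof.
move=> [[[i0 i1 i2 i3 i4] _] [r0 _ _ _ _] _ _ _] hp.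
apply: (@wp_le _ _ _ _ _ (6 + (10 * L + 3 + 1))); last lia.
apply: wp_seq; isteps; set h := ireg s 28.
have ap : apart h L h by apply/orP; left.
apply: wp_seq; apply: wp_weaken (@wp_axpy _ _ oracle _ h h h L _ _ _ _ ap ap) (leqnn _) _;
  rewrite /= ?i3 ?addn0//.
move=> s2 [[/= fi fr ft] im m].
have e2 i : (i < 40)%N -> ireg s2 i = ireg s i.
  by move=> ik; rewrite fi ?(leq_trans ik)// !ifF//; apply/negbTE; slia.
isteps; set s3 := State _ _ _ _ _.
have := @heap_open_push ALL [::] 0 s h s3 hp.
rewrite /= !e2// i1 => H; have {H} := H erefl erefl erefl im.
case.
- by move=> a ah; rewrite m ifF//; apply/negbTE; slia.
- move=> i il /=; rewrite m leq_addr ltn_add2l il addKn r0 sub0r mulN1r subrr.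
  have := enc_lin Br 0 0 0 i; rewrite scale0r addr0 mul0r addr0 => _.
  have E := enc_lin Br 0 0 1 i; rewrite scale1r addr0 mul1r in E.
  by have := congr1 (fun x => x - enc Br 0 i) E; rewrite subrr addrK.
move=> hp3 g3; split => //; split => /= [i ik|i ik|]; last by rewrite ft.
  have [->|i28] := eqVneq i 28%N; first by [].
  by rewrite e2.
by rewrite fr ?(leq_trans ik)//= !ifF//; apply/negbTE; move: ik; clear; lia.
Qed.

Lemma wp_close_list s ALL W : ireg s 4 = 1%N -> heap_open ALL W s ->
  wp close_list s 2 (fun s' => [/\ heap (rcons ALL W) s', grow s s',
    frame 40 40 s (set_ireg s' 20 (ireg s 20)) & ireg s' 28 = ireg s 28]).
Proof.
move=> i4 hp; have [h1 h2 h3 h4 h5] := hp; isteps; split => //=.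
- split => /=; rewrite ?size_rcons h1 i4 addn1//.
  + by rewrite eqxx.
  + move=> a; rewrite ltnS nth_rcons; case: ltngtP => // [al|->] _.
      by rewrite !ltn_eqF ?h3// ltnS ltnW.
    by rewrite eqxx ltn_eqF.
  + move=> a; rewrite ltnS nth_rcons; case: ltngtP => // [al|->] _; rewrite ltn_eqF//.
      exact: h4.
    by rewrite ltnS ltnW.
- split => //=; last by rewrite leq_addr.
  by move=> a ah; rewrite ifF//; apply/negbTE; rewrite i4; slia.
- split => //= i ik; rewrite /upd /=; by case: eqVneq => [->|].
Qed.

Lemma wp_expand s ALL W g (c : int) : stat s -> heap_open ALL W s ->
  ireg s 13 = imem s (size ALL) -> stored Br (rmem s) (ireg s 16) g ->
  (ireg s 16 + L <= imem s (size ALL))%N -> rreg s 13 = c%:~R ->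
  wp expand_cmd s (size W * (10 * L + 12) + 3) (fun s' =>
    [/\ heap_open ALL (adjoin_shift (c *: g) W) s', grow s s' & framex [:: 14; 15; 28] 40 30 s s']).
Proof.
move=> st hp h13 sg gl rc; have [[[i0 i1 i2 i3 i4] _] _ _ _ _] := st.
have [h1 h2 h3 h4 h5] := hp; set b := imem s (size ALL) in h2 h5 h13 gl.
apply: (@wp_le _ _ _ _ _ (2 + (size W * (6 + (10 * L + 3 + 2)).+1).+1)); last first.
  have -> : ((6 + (10 * L + 3 + 2)).+1 = 10 * L + 12)%N by clear; lia.
  by clear; move: (size W * _)%N; lia.
have L0 : (0 < L)%N by lia.
apply: wp_seq; isteps.
pose I k s' := [/\ heap_open ALL (W ++ [seq w + c *: g | w <- take k W]) s', grow s s',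
   framex [:: 14; 15; 28] 40 30 s s', ireg s' 14 = ireg s 28 & ireg s' 15 = (b + L * k)%N].
apply: (wp_while (m := size W) (I := I)).
- by move=> k s' [_ _ _ h14 h15] /=; rewrite h14 h15 h2 ltn_add2l ltn_mul2l L0.
- move=> k s' kW [hp' g' [fi fr ft] h14 h15]; have [m' H28 im' H20] := g'.
  have kW' : (L * k.+1 <= L * size W)%N by rewrite leq_mul2l kW orbT.
  rewrite mulnS in kW'.
  set h := ireg s' 28.
  apply: wp_seq; isteps.
  apply: wp_seq; apply: wp_weaken (@wp_axpy _ _ oracle _ h (b + L * k)%N (ireg s 16) L _ _ _ _ _ _) (leqnn _) _;
    rewrite /= ?h15 ?(fi 3)// ?(fi 16)// ?(fi 1)// ?i3 ?i1 ?addn0// /apart.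
  + by apply/orP; right; apply/orP; left; slia.
  + by apply/orP; right; apply/orP; left; slia.
  move=> s2 [[/= fi2 fr2 ft2] im2 m2].
  have e2 i : (i < 40)%N -> ireg s2 i = ireg s' i.
    by move=> ik; rewrite fi2 ?(leq_trans ik)// !ifF//; apply/negbTE; slia.
  isteps; set s3 := State _ _ _ _ _.
  have e28 : ireg s3 28 = (h + L)%N by rewrite /= !e2// (fi 1)// i1.
  have := @heap_open_push ALL _ (nth 0 W k + c *: g) s' h s3 hp' _ (erefl _) e28 im2.
  case.
  + by rewrite /= e2.
  + by move=> a ah; rewrite /= m2 ifF//; apply/negbTE; slia.
  + move=> i il; rewrite /= m2 leq_addr ltn_add2l il addKn /= add0r (fr 13)// rc enc_lin.
    rewrite !m'; last 2 first.
      by slia.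
      by slia.
    by rewrite (h5 k kW)// sg.
  move=> hp3 g3; split.
  + by rewrite (take_nth 0)// map_rcons -cats1 catA cats1.
  + exact: grow_trans g' g3.
  + split => /= [i H|i ik|]; last by rewrite ft2 ft.
      rewrite !ifF ?e2 ?fi//; try apply/negbTE; move: H; rewrite !inE; clear; lia.
    by rewrite fr2 ?(leq_trans ik)//= !ifF ?fr//; apply/negbTE; move: ik; clear; lia.
  + by rewrite /= e2.
  + by rewrite /= !e2// h15 (fi 1)// i1 mulnS; lia.
- split => //=.
  + by rewrite take0 cats0.
  + by split => //= i H; rewrite !ifF//; apply/negbTE; move: H; rewrite !inE; clear; lia.
  + by rewrite i3 addn0.
  + by rewrite h13 i3 muln0.
by move=> s' [hp' g' fr' _ _]; rewrite take_size in hp'.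
Qed.

End BasePhase.

Section BaseLists.
Context {R : realType} {n : nat} (oracle : 'rV[R]_n -> R) (B : 'M[rat]_n) (M : 'M[R]_n).
Variables (e fac U vend : R).
Implicit Types (s : state R) (ALL : seq (seq 'rV[int]_n)) (W : seq 'rV[int]_n).
Hypothesis n_gt0 : (0 < n)%N.
Local Notation wp := (wp oracle).
Local Notation Br := (map_mx ratr B : 'M[R]_n).
Local Notation L := (n + n)%N.
Local Notation nn := (n * n)%N.
Local Notation stat := (stat B M e fac U vend).
Local Notation heap_open := (heap_open Br).
Local Notation heap := (heap Br).

Definition base_list_time := (n * (4 ^ n * (20 * L + 24) + 16) + 10 * L + 20)%N.

Lemma wp_base_list s ALL (c : int) : stat s -> heap ALL s -> rreg s 8 = c%:~R ->
  wp base_list_cmd s base_list_time (fun s' =>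
    [/\ heap (rcons ALL (base_list c (enum 'I_n))) s', grow s s' & frame 13 13 s s']).
Proof.
move=> st hp r8; have [[[i0 i1 i2 i3 i4] [i5 i6]] _ _ _ im0] := st.
have hpo := heap_openE hp; have [h20 h28 _ _] := hp.
apply: (@wp_le _ _ _ _ _ (1 + ((10 * L + 10) + (1 + ((n * (2 + ((4 ^ n * (10 * L + 12) + 3) +
   (2 + ((4 ^ n * (10 * L + 12) + 3) + 1)))).+1).+1 + 2))))); last first.
  rewrite /base_list_time; set X := (4 ^ n)%N.
  have -> : ((2 + ((X * (10 * L + 12) + 3) + (2 + ((X * (10 * L + 12) + 3) + 1)))).+1 =
    X * (20 * L + 24) + 12)%N by clear; nia.
  have : (n * (X * (20 * L + 24) + 12) <= n * (X * (20 * L + 24) + 16))%N by rewrite leq_mul2l leq_add2l orbT.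
  by clear; move: (n * (_ + 12))%N (n * (_ + 16))%N => x y; lia.
apply: wp_seq; isteps; set s1 := State _ _ _ _ _.
have g1 : grow s s1 by [].
have f1 : frame 13 40 s s1 by split => //=; iframe.
have st1 : stat s1 by apply: stat_grow hpo _ g1 st; exact: frame_le f1.
have hp1 : heap_open ALL [::] s1 by apply: heap_open_frame g1 hpo.
have h113 : ireg s1 13 = imem s (size ALL) by rewrite /= i3 addn0 h28.
have im1 : imem s1 = imem s by [].
clearbody s1.
apply: wp_seq; apply: wp_weaken (wp_zero_vec oracle n_gt0 st1 hp1) (leqnn _) _.
move=> s2 [hp2 g2 f2].
apply: wp_seq; isteps; set s3 := State _ _ _ _ _.
have e13 : ireg s2 13 = ireg s1 13 by case: f2 => fi _ _; rewrite -(fi 13%N).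
have f12 : frame 13 13 s1 s2 by apply: frame_unset28 (frame_le _ _ f2).
have e3 : ireg s2 3 = 0%N by case: f12 => fi _ _; rewrite fi//; case: st1 => -[[? ? ?]].
have e6 : ireg s2 6 = (3 * nn)%N by case: f12 => fi _ _; rewrite fi//; case: st1 => -[? [? ?]].
have f3 : frame 13 13 s s3.
  apply: frame_trans (frame_le _ _ f1) _ => //; apply: frame_trans f12 _.
  by split => //=; iframe.
have g3 : grow s s3 by apply: grow_trans g1 g2.
have hp3 : heap_open ALL [:: 0] s3 by apply: heap_open_frame hp2.
have h313 : ireg s3 13 = imem s (size ALL) by rewrite /= e13.
have h316 : ireg s3 16 = (3 * nn)%N by rewrite /= e6 e3 addn0.
clearbody s3.
pose I k s' := [/\ heap_open ALL (base_list c (take k (enum 'I_n))) s', grow s s',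
  frame 13 13 s s', ireg s' 13 = imem s (size ALL) & ireg s' 16 = (3 * nn + L * k)%N].
have L0 : (0 < L)%N by slia.
apply: wp_seq; apply: (wp_while (m := n) (I := I)).
- move=> k s' [_ _ [fi _ _] _ h16] /=.
  by rewrite h16 fi// i2 ltn_add2l ltn_mul2l L0.
- move=> k s' kn [hp' g' f' h13 h16]; have [fi fr ft] := f'.
  have st' : stat s' by apply: stat_grow hpo _ g' st; exact: frame_le f'.
  have tk : take k.+1 (enum 'I_n) = rcons (take k (enum 'I_n)) (Ordinal kn).
    by rewrite (take_nth (Ordinal kn)) ?size_enum_ord// -[k in nth _ _ k]/(val (Ordinal kn)) nth_ord_enum.
  have sz m : (m <= n)%N -> size (base_list c (take m (enum 'I_n))) = (4 ^ m)%N.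
    by move=> mn; rewrite size_base_list size_takel ?size_enum_ord.
  apply: wp_seq; isteps; set s4 := State _ _ _ _ _.
  have f4 : framex [::] 40 13 s' s4 by split => //=; iframe.
  have g4 : grow s' s4 by [].
  have hp4 : heap_open ALL (base_list c (take k (enum 'I_n))) s4 by apply: heap_open_frame hp'.
  have r413 : rreg s4 13 = c%:~R by rewrite /= add0r fr// r8.
  have im4 : imem s4 = imem s' by []. have m4 : rmem s4 = rmem s' by [].
  clearbody s4; have [fi4 fr4 ft4] := f4.
  have st4 : stat s4 by apply: stat_grow hp' _ g4 st'; split => // i ik; [rewrite fi4 ?(leq_trans ik) | rewrite fr4// (leq_trans ik)].
  have [g'm g'h g'i g't] := g'.
  have imA : imem s' (size ALL) = imem s (size ALL) by rewrite g'i// h20.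
  have b0 : (3 * nn + L * k + L <= imem s (size ALL))%N.
    have := heap_open_mono hpo (leq0n _); rewrite im0; apply: leq_trans.
    by rewrite -addnA leq_add2l -mulnSr leq_mul2l kn orbT.
  apply: wp_seq; apply: wp_weaken (@wp_expand _ _ oracle B M e fac U vend n_gt0 s4 ALL _ (delta_mx 0 (Ordinal kn)) c st4 hp4 _ _ _ r413) _ _.
  + by rewrite fi4// h13 im4 imA.
  + by rewrite fi4// h16 m4; case: st' => _ _ G _ _; exact: (G (Ordinal kn)).
  + by rewrite fi4// h16 im4 imA.
  + rewrite sz ?(ltnW kn)// leq_add2r leq_mul2r leq_pexp2l ?orbT// ltnW//.
  move=> s5 [hp5 g5 f5]; have [fi5 fr5 ft5] := f5.
  apply: wp_seq; isteps; set s6 := State _ _ _ _ _.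
  have f6 : framex [::] 40 13 s5 s6 by split => //=; iframe.
  have g6 : grow s5 s6 by [].
  have hp6 : heap_open ALL (adjoin_shift (axis c (Ordinal kn)) (base_list c (take k (enum 'I_n)))) s6 by apply: heap_open_frame hp5.
  have r613 : rreg s6 13 = (- c)%:~R by rewrite /= sub0r fr5// fr4// fr// r8 rmorphN.
  have im6 : imem s6 = imem s5 by []. have m6 : rmem s6 = rmem s5 by [].
  clearbody s6; have [fi6 fr6 ft6] := f6.
  have f46 : frame 13 13 s' s6.
    split => [i ik|i ik|]; last by rewrite ft6 ft5 ft4.
      by rewrite fi6 ?fi5 ?fi4 ?inE ?(leq_trans ik)//=; slia.
    by rewrite fr6 ?fr5 ?fr4 ?(leq_trans ik).
  have g46 : grow s' s6 := grow_trans (grow_trans g4 g5) g6.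
  have st6 : stat s6 by apply: stat_grow hp' _ g46 st'; exact: frame_le f46.
  have h166 : ireg s6 16 = (3 * nn + L * k)%N by rewrite fi6// fi5// fi4.
  have h136 : ireg s6 13 = imem s (size ALL) by rewrite fi6// fi5// fi4.
  have [g46m g46h g46i g46t] := g46.
  have imA6 : imem s6 (size ALL) = imem s (size ALL) by rewrite g46i//; case: hp' => ->.
  apply: wp_seq; apply: wp_weaken (@wp_expand _ _ oracle B M e fac U vend n_gt0 s6 ALL _ (delta_mx 0 (Ordinal kn)) (- c) st6 hp6 _ _ _ r613) _ _.
  + by rewrite h136 imA6.
  + by rewrite h166; case: st6 => _ _ G _ _; exact: (G (Ordinal kn)).
  + by rewrite h166 imA6.
  + rewrite leq_add2r leq_mul2r size_cat size_map sz ?(ltnW kn)//; apply/orP; right.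
    apply: (leq_trans (n := (4 ^ k.+1)%N)); first by rewrite expnS; move: (4 ^ k)%N => x; clear; lia.
    by rewrite leq_pexp2l.
  move=> s7 [hp7 g7 f7]; have [fi7 fr7 ft7] := f7.
  have g7' := grow_trans g46 g7.
  isteps; split => /=.
  + rewrite tk base_list_rcons; apply: heap_open_frame hp7 => //=.
  + exact: grow_trans g' g7'.
  + apply: frame_trans f' _; apply: frame_trans f46 _; split => //= i ik; last by rewrite fr7 ?(leq_trans ik).
    by rewrite !ifF ?fi7 ?inE ?(leq_trans ik)//=; try apply/negbTE; slia.
  + by rewrite fi7.
  + by rewrite fi7// h166 !fi7// (_ : ireg s6 1 = L) ?mulnS; [clear; lia|case: st6 => -[[? ->]]].
- by split => //; rewrite ?take0// h316 muln0 addn0.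
move=> s4 [hp4 g4 f4 h13 h16]; rewrite take_oversize ?size_enum_ord// in hp4.
have e4 : ireg s4 4 = 1%N by case: f4 => fi _ _; rewrite fi.
apply: wp_weaken (wp_close_list oracle n_gt0 e4 hp4) (leqnn _) _ => s5 [hp5 g5 f5 _]; split => //.
- exact: grow_trans g4 g5.
- by apply: frame_trans f4 _; apply: frame_unset20 (frame_le _ _ f5).
Qed.

(** Indexed by scale: position 0 is the trivial net and position l + 1 uses digits 0 and plus or
    minus 2^l, as [base_covers] requires. *)
Definition base_lists J : seq (seq 'rV[int]_n) :=
  [:: 0] :: [seq base_list (2 ^ l)%N%:Z (enum 'I_n) | l <- iota 0 J].

Lemma wp_base_phase s J : stat s -> heap [::] s -> (forall k, (2 ^+ k < 4 * U / vend) = (k < J)%N) ->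
  wp base_phase s (J * (base_list_time + 2) + 10 * L + 14) (fun s' =>
    [/\ heap (base_lists J) s', grow s s' & frame 8 8 s s']).
Proof.
move=> st hp HJ; have [[[i0 i1 i2 i3 i4] [i5 i6]] [r0 r1 r2 r3 _] _ _ im0] := st.
have hpo := heap_openE hp.
apply: (@wp_le _ _ _ _ _ ((10 * L + 10) + (2 + (1 + (J * (base_list_time + 1).+1).+1)))); last first.
  have -> : ((base_list_time + 1).+1 = base_list_time + 2)%N by clear; lia.
  by clear; move: (J * _)%N; lia.
apply: wp_seq; apply: wp_weaken (wp_zero_vec oracle n_gt0 st hpo) (leqnn _) _.
move=> s1 [hp1 g1 f1]; have {}f1 : frame 13 13 s s1 by apply: frame_unset28 (frame_le _ _ f1).
have e4 : ireg s1 4 = 1%N by case: f1 => fi _ _; rewrite fi.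
apply: wp_seq; apply: wp_weaken (wp_close_list oracle n_gt0 e4 hp1) (leqnn _) _ => s2 [hp2 g2 f2 _].
have {}f2 : frame 13 13 s s2 by apply: frame_trans f1 _; apply: frame_unset20 (frame_le _ _ f2).
have {}g2 := grow_trans g1 g2.
apply: wp_seq; isteps; set s3 := State _ _ _ _ _.
pose I k s' := [/\ heap (base_lists k) s', grow s s', frame 8 8 s s' & rreg s' 8 = 2 ^+ k].
apply: (wp_while (m := J) (I := I)).
- move=> k s' [_ _ [_ fr _] r8] /=; by rewrite r8 fr// r2 HJ.
- move=> k s' kJ [hp' g' f' r8].
  have st' : stat s' by apply: stat_grow hpo _ g' st; exact: frame_le f'.
  have := @wp_base_list s' _ (2 ^ k)%N%:Z st' hp'; rewrite r8 => H.
  apply: wp_seq; apply: wp_weaken (H _) (leqnn _) _; first by rewrite -natrX.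
  move=> s4 [hp4 g4 f4]; isteps; split => /=.
  + have -> : base_lists k.+1 = rcons (base_lists k) (base_list (2 ^ k)%N%:Z (enum 'I_n)).
      by rewrite /base_lists -cats1 -(addn1 k) iotaD add0n map_cat.
    by apply: heap_frame hp4.
  + exact: grow_trans g' g4.
  + apply: frame_trans f' _; case: f4 => fi fr ft; split => //= i ik; last first.
      by rewrite ifF ?fr ?(leq_trans ik)//; apply/negbTE; slia.
    by rewrite fi ?(leq_trans ik).
  + by case: f4 => _ fr _; rewrite fr// r8 exprS mulr2n mulrDl mul1r.
- split => //=.
  by apply: frame_trans (frame_le _ _ f2) _ => //; split => //=; iframe.
by move=> s4 [].
Qed.

End BaseLists.

(** * Lowering v from U to vend *)

Definition level_cmd (nu : cmd) : cmd :=
  Seq (block [:: RSet 16 3; RMul 7 7 16; RSet 16 4; RDiv 7 7 16; IAdd 9 20 3])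
  (Seq zero_vec (Seq close_list
  (Seq (block [:: RSet 16 3; RMul 9 7 16; RSet 16 2; RDiv 9 9 16; IAdd 8 7 3; IAdd 21 7 4])
  (Seq (While (ILt 21 9)
     (Seq (block [:: IAdd 22 8 3; RSet 16 3; RMul 20 16 9; RSet 16 9; RDiv 21 9 16])
     (Seq (prune_cmd nu) (block [:: RAdd 9 9 9; IAdd 8 8 4; IAdd 21 8 4]))))
  (block [:: IAdd 7 9 3]))))).

Definition levels_cmd (nu : cmd) : cmd :=
  Seq (block [:: ISet 7 0]) (While (RLt 1 7) (level_cmd nu)).

Section Levels.
Context {R : realType} {n : nat} (oracle : 'rV[R]_n -> R) (B : 'M[rat]_n) (M : 'M[R]_n).
Variables (e fac U vend : R).
Variables (q : 'rV[int]_n -> R) (zmax dl : R) (tn : nat) (nu : cmd) (J S1 : nat).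
Implicit Types (s : state R) (ALL : seq (seq 'rV[int]_n)) (W : seq 'rV[int]_n).
Local Notation wp := (wp oracle).
Local Notation Br := (map_mx ratr B : 'M[R]_n).
Local Notation L := (n + n)%N.
Local Notation stat := (stat B M e fac U vend).
Local Notation heap := (heap Br).
Local Notation Z := (3 * 2 ^+ J : R).
Hypothesis n_gt0 : (0 < n)%N.
Hypothesis q_ge0 : forall z, 0 <= q z.
Hypothesis qD : forall z w, q (z + w) <= q z + q w.
Hypothesis q_0 : q 0 = 0.
Hypothesis dl01 : 0 <= dl <= 1.
Hypothesis nu_spec : forall s z, genv n fac (vend / 2) s -> stored Br (rmem s) (ireg s 38) z ->
  mabs z <= zmax -> 0 <= rreg s 7 -> (ireg s 38 + (n + n) <= ireg s 39)%N ->
  wp nu s tn (fun s' => keeps s s' /\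
    nrm q (rreg s 7) z <= rreg s' 39 <= (1 + dl) * nrm q (rreg s 7) z).
Hypothesis Zz : 3 * Z <= zmax.
Hypothesis S1_big : (4 ^ n <= S1)%N.
Hypothesis S1_cap : forall v l D O, 0 < v -> pruned q v (3 * tau v l) (tau v l / 9) D O -> (size O <= S1)%N.

Definition prune_time (X Y S : nat) := (X * (Y * (S * (20 * L + 2 * tn + 31) + (10 * L + tn + 32)) + 5) + 15)%N.

Lemma prune_time_le X X' Y Y' S S' : (X <= X')%N -> (Y <= Y')%N -> (S <= S')%N ->
  (prune_time X Y S <= prune_time X' Y' S')%N.
Proof.
move=> XX YY SS; rewrite /prune_time leq_add2r leq_mul// leq_add2r leq_mul// leq_add2r leq_mul//.
Qed.

Lemma heap_grow ALL s s' W : heap ALL s -> heap (rcons ALL W) s' ->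
  (forall a, (a <= size ALL)%N -> imem s' a = imem s a) ->
  (forall a, (a < ireg s 28)%N -> rmem s' a = rmem s a) -> grow s s'.
Proof.
move=> [h1 h2 _ _] hp im m; have [h1' _ _ _] := hp; split => //.
- by rewrite -h2 -im//; apply: (heap_le hp); rewrite size_rcons.
- by move=> a; rewrite h1; exact: im.
- by rewrite h1 h1' size_rcons.
Qed.

Definition net v l W := [/\ covers q v (tau v l) (tau v l / 3) W, (size W <= S1)%N &
  forall x, x \in W -> mabs x <= Z].

Definition nets v ALL i0 := forall l, (l <= J)%N -> net v l (nth [::] ALL (i0 + l)).

(** Pruned lists have norm at most 3 tau, hence coordinates at most Z; this keeps all later
    evaluations within the range where the gauge program is specified. *)
Lemma tau_leZ v l : 0 < v -> (l <= J)%N -> 3 * tau v l <= v * Z.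
Proof.
move=> v0 lJ; have : 2 ^+ l <= 2 ^+ J :> R by rewrite ler_eXn2l// ltr1n.
have : 0 < (2 : R) ^+ l by rewrite exprn_gt0.
rewrite /tau; nra.
Qed.

Lemma net_zero v : 0 < v -> net v 0 [:: 0].
Proof.
move=> v0; split; first exact: covers_zero.
- by apply: leq_trans S1_big; rewrite expn_gt0.
- by move=> x; rewrite inE => /eqP->; rewrite mabs0 mulr_ge0// exprn_ge0.
Qed.

Definition level_time := (J * (prune_time S1 S1 S1 + 10) + 10 * L + 30)%N.

(** One descent of v by 3/4. A fresh block of J + 1 nets is appended: scale 0 is trivial, and scale
    l + 1 is the pruned sumset of the old nets at scales l + 1 and l. *)
Lemma wp_level s ALL i0 v : stat s -> heap ALL s -> ireg s 7 = i0 -> size ALL = (i0 + J.+1)%N ->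
  0 < v -> rreg s 7 = v -> nets v ALL i0 ->
  wp (level_cmd nu) s level_time (fun s' => exists ALL', [/\ heap ALL' s',
     ireg s' 7 = size ALL /\ size ALL' = (size ALL + J.+1)%N, nets (v * (3 / 4)) ALL' (size ALL),
     rreg s' 7 = v * (3 / 4) & grow s s' /\ frame 7 7 s s']).
Proof.
move=> st hp h7 szA v0 r7 netA; have [[[i0' i1 i2 i3 i4] _] _ _ _ _] := st.
set v' := v * (3 / 4); have v'0 : 0 < v' by rewrite mulr_gt0// divr_gt0.
have [h20 _ _ _] := hp.
apply: (@wp_le _ _ _ _ _ (5 + ((10 * L + 10) + (2 + (6 + ((J * (5 + (prune_time S1 S1 S1 + 3)).+1).+1 + 1)))))); last first.
  rewrite /level_time; set X := prune_time _ _ _.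
  have -> : ((5 + (X + 3)).+1 = X + 9)%N by clear; lia.
  have : (J * (X + 9) <= J * (X + 10))%N by rewrite leq_mul2l leq_add2l orbT.
  by clear; move: (J * (_ + 9))%N (J * (_ + 10))%N => x y; lia.
apply: wp_seq; isteps; set s1 := State _ _ _ _ _.
have f1 : frame 7 7 s s1 by split => //=; iframe.
have g1 : grow s s1 by [].
have hp1 : heap ALL s1 by apply: heap_frame hp.
have r17 : rreg s1 7 = v' by rewrite /= r7 /v'; field.
have i19 : ireg s1 9 = size ALL by rewrite /= h20 i3 addn0.
have i17 : ireg s1 7 = i0 by [].
clearbody s1.
have st1 : stat s1 by apply: stat_grow (heap_openE hp) f1 g1 st.
apply: wp_seq; apply: wp_weaken (wp_zero_vec oracle n_gt0 st1 (heap_openE hp1)) (leqnn _) _.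
move=> s2 [hp2 g2 f2]; have {}f2 : frame 20 16 s1 s2 by apply: frame_unset28 (frame_le _ _ f2).
have e4 : ireg s2 4 = 1%N by case: f2 => fi _ _; rewrite fi//; case: st1 => -[[_ _ _ _ ?] _].
apply: wp_seq; apply: wp_weaken (wp_close_list oracle n_gt0 e4 hp2) (leqnn _) _.
move=> s3 [hp3 g3 f3 _]; have {}f3 : frame 20 16 s2 s3 by apply: frame_unset20 (frame_le _ _ f3).
have f13 : frame 20 16 s1 s3 := frame_trans f2 f3.
have [fi13 fr13 ft13] := f13.
have f03 : frame 7 7 s s3 by apply: frame_trans f1 (frame_le _ _ f13).
have g03 : grow s s3 := grow_trans (grow_trans g1 g2) g3.
have st3 : stat s3 by apply: stat_grow (heap_openE hp) f03 g03 st.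
have [[[_ _ _ k3 k4] _] _ _ _ _] := st3.
apply: wp_seq; isteps; set s4 := State _ _ _ _ _.
have f4 : frame 7 7 s s4 by apply: frame_trans f03 _; split => //=; iframe.
have g4 : grow s s4 by apply: grow_trans g03 _.
have hp4 : heap (rcons ALL [:: 0]) s4 by apply: heap_frame hp3.
have r47 : rreg s4 7 = v' by rewrite /= fr13.
have i49 : ireg s4 9 = size ALL by rewrite /= fi13.
have i47 : ireg s4 7 = i0 by rewrite /= fi13.
have r49 : rreg s4 9 = tau v' 1 by rewrite /= fr13// r17 /tau expr1; field.
have i48 : ireg s4 8 = i0 by rewrite /= fi13// i17 k3 addn0.
have i421 : ireg s4 21 = i0.+1 by rewrite /= fi13// i17 k4 addn1.
clearbody s4.
(* Lists are only appended, so the old block remains readable at its indices while the new one is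
   being built. *)
pose I l s' := exists ALL', [/\ heap ALL' s',
  [/\ size ALL' = (size ALL + l.+1)%N, forall a, (a < size ALL)%N -> nth [::] ALL' a = nth [::] ALL a &
      forall k, (k <= l)%N -> net v' k (nth [::] ALL' (size ALL + k))],
  [/\ ireg s' 7 = i0, ireg s' 8 = (i0 + l)%N, ireg s' 9 = size ALL & ireg s' 21 = (i0 + l.+1)%N],
  rreg s' 7 = v' /\ rreg s' 9 = tau v' l.+1 & grow s s' /\ frame 7 7 s s'].
apply: wp_seq; apply: (wp_while (m := J) (I := I)).
- move=> l s' [ALL' [_ _ [_ _ h9 h21] _ _]] /=.
  by rewrite h9 h21 szA ltn_add2l ltnS.
- move=> l s' lJ [ALL' [hp' [szA' pre netA'] [h7' h8 h9 h21] [r7' r9] [g' f']]].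
  have st' : stat s' by apply: stat_grow (heap_openE hp) f' g' st.
  have [[[_ _ _ z3 z4] _] _ _ _ _] := st'.
  apply: wp_seq; isteps; set s5 := State _ _ _ _ _.
  have f5 : frame 20 16 s' s5 by split => //=; iframe.
  have g5 : grow s' s5 by [].
  have hp5 : heap ALL' s5 by apply: heap_frame hp'.
  have i521 : ireg s5 21 = (i0 + l.+1)%N by [].
  have i522 : ireg s5 22 = (i0 + l)%N by rewrite /= h8 z3 addn0.
  have r520 : rreg s5 20 = 3 * tau v' l.+1 by rewrite /= r9.
  have r521 : rreg s5 21 = tau v' l.+1 / 9 by rewrite /= r9.
  clearbody s5; have [fi5 fr5 ft5] := f5.
  have r57 : rreg s5 7 = v' by rewrite fr5.
  have st5 : stat s5 by apply: stat_grow (heap_openE hp') (frame_le _ _ f5) g5 st'.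
  have net1 := netA _ lJ; have net0 := netA _ (ltnW lJ).
  have E1 : nth [::] ALL' (i0 + l.+1) = nth [::] ALL (i0 + l.+1) by rewrite pre// szA ltn_add2l.
  have E0 : nth [::] ALL' (i0 + l) = nth [::] ALL (i0 + l) by rewrite pre// szA ltn_add2l ltnW.
  rewrite -E1 in net1; rewrite -E0 in net0.
  have [c1 sz1 Z1] := net1; have [c0 sz0 Z0] := net0.
  apply: wp_seq.
  have ge := stat_genv st5.
  have envE s0 : genv n fac (vend / 2) s0 -> ireg s0 0 = n /\ ireg s0 1 = L by case.
  have := @wp_prune _ _ oracle Br q zmax dl tn nu _ n_gt0 q_ge0 q_0 dl01 (@genv_frame _ n _ fac) envE nu_spec
    s5 ALL' _ _ Z S1 ge _ hp5 i521 i522; rewrite r57 r520 r521.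
  move=> H; apply: wp_weaken (H v'0 _ _ _ _ Zz Z1 Z0 _) _ _.
  + by rewrite szA' szA; move: lJ; clear; lia.
  + by rewrite szA' szA; move: lJ; clear; lia.
  + by rewrite divr_ge0// ltW// tau_gt0.
  + exact: tau_leZ.
  + by move=> D O; exact: S1_cap.
  + exact: prune_time_le.
  move=> s6 [ O [prO hp6 f6 im6 m6]].
  have g6 : grow s5 s6 by apply: heap_grow hp6 im6 m6.
  have [fi6 fr6 ft6] := f6.
  have covO := level_covers q_ge0 qD v0 c1 c0 prO.
  have netO : net v' l.+1 O.
    split => //; first exact: S1_cap prO.
    move=> x; case: prO => _ Ob _ /Ob; rewrite nrm_le => /andP[_ /le_trans/(_ (tau_leZ v'0 lJ))].
    by rewrite ler_pM2l.
  have [k63 k64] : ireg s6 3 = 0%N /\ ireg s6 4 = 1%N by rewrite !fi6// !fi5.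
  isteps; exists (rcons ALL' O); split => /=.
  + by apply: heap_frame hp6.
  + split.
    * by rewrite size_rcons szA' !addnS.
    * by move=> a al; rewrite nth_rcons szA' ifT ?pre//; slia.
    * move=> k; rewrite leq_eqVlt ltnS nth_rcons szA' => /predU1P[->|kl].
        by rewrite ltnn eqxx.
      by rewrite ltn_add2l ltnS kl; exact: netA'.
  + rewrite !fi6// !fi5// h8 z4; split => //; lia.
  + by rewrite !fr6// !fr5// r9; split => //; rewrite [RHS]tauS; ring.
  + split; first exact: grow_trans g' (grow_trans g5 g6).
    apply: frame_trans f' _; apply: frame_trans (frame_le _ _ f5) _ => //.
    apply: frame_trans (frame_le _ _ f6) _ => //; split => //=; iframe.
- exists (rcons ALL [:: 0]); split => //.
  + split.
    * by rewrite size_rcons addn1.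
    * by move=> a al; rewrite nth_rcons al.
    * by move=> k; rewrite leqn0 => /eqP->; rewrite addn0 nth_rcons ltnn eqxx; exact: net_zero.
  + by rewrite addn0 addn1.
move=> s5 [ALL' [hp' [szA' pre netA'] [h7' h8 h9 h21] [r7' r9] [g' f']]].
have [fi' _ _] := f'.
isteps; exists ALL'; split => //=.
- by rewrite h9 fi'// i3 addn0.
- by split => //; apply: frame_trans f' _; split => //=; iframe.
Qed.

Lemma wp_levels s m : stat s -> heap (base_lists J) s -> rreg s 7 = U -> 0 < U ->
  (forall z, q z <= U * mabs z) -> (forall k, (vend < U * (3 / 4) ^+ k) = (k < m)%N) ->
  wp (levels_cmd nu) s (m * level_time.+1 + 2) (fun s' => exists ALL i0,
    [/\ heap ALL s', ireg s' 7 = i0 /\ size ALL = (i0 + J.+1)%N, nets (U * (3 / 4) ^+ m) ALL i0,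
     rreg s' 7 = U * (3 / 4) ^+ m & grow s s' /\ frame 7 7 s s']).
Proof.
move=> st hp r7 U0 qU Hm.
apply: (@wp_le _ _ _ _ _ (1 + (m * level_time.+1).+1)); last by lia.
apply: wp_seq; isteps; set s1 := State _ _ _ _ _.
pose I k s' := exists ALL i0, [/\ heap ALL s', ireg s' 7 = i0 /\ size ALL = (i0 + J.+1)%N,
  nets (U * (3 / 4) ^+ k) ALL i0, rreg s' 7 = U * (3 / 4) ^+ k & grow s s' /\ frame 7 7 s s'].
apply: (wp_while (m := m) (I := I)).
- move=> k s' [ALL [i0 [_ _ _ r7' [_ [_ fr _]]]]] /=.
  by case: st => _ [_ r1 _ _ _] _ _ _; rewrite r7' fr// r1 Hm.
- move=> k s' km [ALL [i0 [hp' [h7 szA] nt r7' [g' f']]]].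
  have st' : stat s' by apply: stat_grow (heap_openE hp) f' g' st.
  have v0 : 0 < U * (3 / 4) ^+ k by rewrite mulr_gt0// exprn_gt0// divr_gt0.
  apply: wp_weaken (wp_level st' hp' h7 szA v0 r7' nt) (leqnn _) _.
  move=> s2 [ALL' [hp2 [h72 szA2] nt2 r72 [g2 f2]]]; exists ALL', (size ALL); split => //.
  + have -> : U * (3 / 4) ^+ k.+1 = U * (3 / 4) ^+ k * (3 / 4) by rewrite exprSr; ring.
    exact: nt2.
  + by rewrite r72 exprSr; ring.
  + by split; [exact: grow_trans g' g2 | exact: frame_trans f' f2].
- exists (base_lists J), 0%N; split => //=.
  + by rewrite size_map size_iota.
  (* At v = U no pruning has happened yet, and the nets are the base lists. *)
  + move=> [_|l lJ]; first by rewrite expr0 mulr1; exact: net_zero.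
    rewrite expr0 mulr1 /= (nth_map 0%N) ?size_iota// nth_iota//; split.
    * exact: base_covers.
    * by rewrite size_base_list size_enum_ord.
    * move=> x xb; apply: mabs_le => [|i]; first by rewrite mulr_ge0// exprn_ge0.
      have := @base_list_bound n _ (enum 'I_n) x i (enum_uniq _) xb; rewrite mem_enum => xl.
      rewrite -intr_norm; apply: (@le_trans _ _ ((2 ^ l)%N%:R)); first by rewrite -(ler_int R) in xl.
      have : 2 ^+ l <= 2 ^+ J :> R by rewrite ler_eXn2l ?ltr1n// ltnW.
      have : 0 < (2 : R) ^+ l by rewrite exprn_gt0.
      by rewrite natrX; lra.
  + by rewrite expr0 mulr1.
  + by split => //; split => //=; iframe.
by [].
Qed.

End Levels.

(** * Keeping the best vector outside M *)

Definition inspect_cmd (nu : cmd) : cmd :=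
  Seq (block [:: IAdd 38 13 3; IAdd 39 28 3])
  (Seq nu
  (Seq (block [:: RSet 12 0; RAdd 12 12 39; IAdd 40 28 3; IAdd 41 13 0; IAdd 42 13 0; IAdd 43 0 3; RSet 40 0])
  (Seq axpy
  (Seq (block [:: IAdd 21 28 3; IAdd 22 6 3])
  (Seq residual_cmd
  (Seq (block [:: IAdd 40 21 3; IAdd 41 21 3; IAdd 42 0 3; RSet 16 0])
  (Seq dot
  (Seq (If (RLt 16 40) (If (RLt 12 11) (block [:: RSet 11 0; RAdd 11 11 12; IAdd 12 13 3]) Skip) Skip)
  (block [:: IAdd 13 13 1]))))))))).

Definition scan_cmd (nu : cmd) : cmd :=
  Seq (block [:: ILoad 13 10; IAdd 14 10 4; ILoad 14 14]) (While (ILt 13 14) (inspect_cmd nu)).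

Section ScanList.
Context {R : realType} {n : nat} (oracle : 'rV[R]_n -> R) (B : 'M[rat]_n) (M : 'M[R]_n).
Variables (e fac U vend : R).
Variables (q : 'rV[int]_n -> R) (zmax dl : R) (tn : nat) (nu : cmd).
Implicit Types (s : state R) (ALL : seq (seq 'rV[int]_n)) (W X : seq 'rV[int]_n).
Local Notation wp := (wp oracle).
Local Notation Br := (map_mx ratr B : 'M[R]_n).
Local Notation L := (n + n)%N.
Local Notation nn := (n * n)%N.
Local Notation stat := (stat B M e fac U vend).
Local Notation heap := (heap Br).
Local Notation stored := (stored Br).
Local Notation vec s a := (rvec (n := n) s a).
Hypothesis n_gt0 : (0 < n)%N.
Hypothesis nu_spec : forall s z, genv n fac (vend / 2) s -> stored (rmem s) (ireg s 38) z ->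
  mabs z <= zmax -> 0 <= rreg s 7 -> (ireg s 38 + (n + n) <= ireg s 39)%N ->
  wp nu s tn (fun s' => keeps s s' /\
    nrm q (rreg s 7) z <= rreg s' 39 <= (1 + dl) * nrm q (rreg s 7) z).

(** Real register 11 is the best estimate so far. The starting value 4 U is a sentinel: it exceeds
    every bound derived later, so at the end the register must be witnessed by a stored vector. *)
Definition best_ok v X s :=
  (forall x, x \in X -> ~~ (latpt Br x <= M)%MS -> rreg s 11 <= (1 + dl) * nrm q v x) /\
  (rreg s 11 = 4 * U \/ exists x, [/\ ~~ (latpt Br x <= M)%MS, stored (rmem s) (ireg s 12) x,
     (ireg s 12 + L <= ireg s 28)%N & nrm q v x <= rreg s 11]).

Lemma best_ok_frame v X s s' : rreg s' 11 = rreg s 11 -> ireg s' 12 = ireg s 12 ->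
  (ireg s 28 <= ireg s' 28)%N -> (forall a, (a < ireg s 28)%N -> rmem s' a = rmem s a) ->
  best_ok v X s -> best_ok v X s'.
Proof.
move=> r11 i12 hh m [b1 b2]; split; first by move=> x xX xM; rewrite r11; exact: b1.
case: b2 => [b2|[x [xM sx xh xb]]]; [left | right; exists x]; first by rewrite r11.
rewrite r11 i12; split => //; last exact: leq_trans hh.
by apply: stored_below m _ sx.
Qed.

Definition inspect_time := (tn + 26 * (n * n) + 48 * n + 35)%N.

(** The point is copied to scratch and reduced against the orthogonal rows. By [residual_mem] the
    residual has positive squared length exactly when the point is outside M, and only then may it
    replace the best one. *)
Lemma wp_inspect s v x X : stat s -> (3 * nn + L * n <= ireg s 28)%N -> stored (rmem s) (ireg s 13) x ->
  (ireg s 13 + L <= ireg s 28)%N -> mabs x <= zmax -> rreg s 7 = v -> 0 <= v -> best_ok v X s ->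
  wp (inspect_cmd nu) s inspect_time (fun s' =>
    [/\ framex [:: 12; 13; 21; 22; 23] 29 11 s s', ireg s' 13 = (ireg s 13 + L)%N, imem s' = imem s,
      forall a, (a < ireg s 28)%N -> rmem s' a = rmem s a & best_ok v (rcons X x) s']).
Proof.
move=> st Hh sx ph xz r7 v0 bo; have [[[i0 i1 i2 i3 i4] [i5 i6]] _ _ [W [WM hW oW]] _] := st.
set p := ireg s 13 in sx ph *; set h := ireg s 28 in Hh ph *.
apply: (@wp_le _ _ _ _ _ (2 + (tn + (7 + (10 * n + 3 + (2 + (n * (26 * n + 30) + 3 + (4 +
  (8 * n + 4 + (5 + 1)))))))))); last first.
  by rewrite /inspect_time mulnDr !mulnA (mulnC n 26) (mulnC n 30); clear; lia.
apply: wp_seq; isteps; set s1 := State _ _ _ _ _.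
have f1 : frame 20 20 s s1 by split => //=; iframe.
have e1 i : (i < 38)%N -> ireg s1 i = ireg s i.
  by move=> ik; rewrite /= !ifF//; apply/negbTE; slia.
have r1 : rreg s1 = rreg s by [].
have h38 : ireg s1 38 = p by rewrite /= i3 addn0.
have h39 : ireg s1 39 = h by rewrite /= i3 addn0.
have m1 : rmem s1 = rmem s by []. have im1 : imem s1 = imem s by []. have t1 : tape s1 = tape s by [].
clearbody s1.
apply: wp_seq; apply: wp_weaken (@nu_spec s1 x _ _ xz _ _) (leqnn _) _.
- exact: genv_frame f1 (stat_genv st).
- by rewrite h38 m1.
- by rewrite r1 r7.
- by rewrite h38 h39.
move=> s2 [[[fi2 fr2 ft2] im2 m2] g2]; rewrite r1 r7 in g2.
rewrite h39 in m2.
have e2 i : (i < 38)%N -> ireg s2 i = ireg s i by move=> ik; rewrite fi2 ?e1// (leq_trans ik).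
have r2 i : (i < 39)%N -> rreg s2 i = rreg s i by move=> ik; rewrite fr2// r1.
apply: wp_seq; isteps; set s3 := State _ _ _ _ _.
have e3 i : (i < 38)%N -> ireg s3 i = ireg s i.
  by move=> ik; rewrite /= !ifF ?e2//; apply/negbTE; slia.
have r3 i : (i < 39)%N -> i != 12%N -> rreg s3 i = rreg s i.
  by move=> ik i12; rewrite /= !ifF ?r2//; apply/negbTE; slia.
have r312 : rreg s3 12 = rreg s2 39 by rewrite /= add0r.
have r340 : rreg s3 40 = 0 by [].
have h340 : ireg s3 40 = h by rewrite /= !e2// i3 addn0.
have h341 : ireg s3 41 = (p + n)%N by rewrite /= !e2// i0.
have h342 : ireg s3 42 = (p + n)%N by rewrite /= !e2// i0.
have h343 : ireg s3 43 = n by rewrite /= !e2// i0 i3 addn0.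
have m3 : rmem s3 = rmem s2 by []. have im3 : imem s3 = imem s by rewrite /= im2.
have t3 : tape s3 = tape s by rewrite /= ft2.
clearbody s3.
have ap : apart h n (p + n) by rewrite /apart; apply/orP; right; apply/orP; left; slia.
apply: wp_seq; apply: wp_weaken (@wp_axpy _ _ oracle s3 h (p + n)%N (p + n)%N n h340 h341 h342 h343 ap ap) (leqnn _) _.
move=> s4 [[fi4 fr4 ft4] im4 m4]; rewrite r340 m3 in m4.
have v4 : vec s4 h = latpt Br x.
  rewrite -(stored_rvec sx); apply/rowP => i; rewrite !mxE m4 leq_addr ltn_add2l ltn_ord addKn /= mul0r addr0.
  by rewrite m2 ?m1//; have := ltn_ord i; slia.
have m4l a : (a < h)%N -> rmem s4 a = rmem s a by move=> ah; rewrite m4 ifF ?m2 ?m1//; apply/negbTE; slia.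
apply: wp_seq; isteps; set s5 := State _ _ _ _ _.
have e5 i : (i < 38)%N -> i \notin [:: 21; 22]%N -> ireg s5 i = ireg s i.
  move=> ik; rewrite !inE negb_or /= => /andP[/negbTE -> /negbTE ->].
  by rewrite fi4 ?e3// (leq_trans ik).
have r5 i : (i < 39)%N -> i != 12%N -> rreg s5 i = rreg s i.
  by move=> ik i12; rewrite /= fr4 ?r3// (leq_trans ik).
have r512 : rreg s5 12 = rreg s2 39 by rewrite /= fr4.
have h521 : ireg s5 21 = h by rewrite /= !fi4// !e3// i3 addn0.
have h522 : ireg s5 22 = (2 * nn + n * n)%N by rewrite /= !fi4// !e3// i3 i6; clear; lia.
have m5 : rmem s5 = rmem s4 by []. have im5 : imem s5 = imem s by rewrite /= im4.
have t5 : tape s5 = tape s by rewrite /= ft4.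
clearbody s5.
have v5 : vec s5 h = latpt Br x by rewrite -v4; apply: vec_eq => i _; rewrite m5.
have w5 (j : 'I_n) : vec s5 (2 * nn + n * j) = row j W.
  rewrite -hW; apply: vec_eq => i il; rewrite m5 m4l//.
  have : (n * j.+1 <= nn)%N by rewrite leq_mul2l ltn_ord orbT.
  by rewrite mulnS; move: il Hh; clear; move: (n * j)%N (L * n)%N nn => X' Y V; lia.
apply: wp_seq; apply: wp_weaken (@wp_residual _ _ oracle s5 (2 * nn)%N h n _ n_gt0 _ h521 h522 _ _) (leqnn _) _.
- by rewrite e5.
- by rewrite e5.
- by apply/orP; right; move: Hh; clear; move: (L * n)%N => Y; lia.
- move=> i j ij jn; rewrite (w5 (Ordinal (ltn_trans ij jn))) (w5 (Ordinal jn)); exact: oW.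
move=> s6 [[fi6 fr6 ft6] im6 m6 [c cE cO]].
set y := vec s6 h in cE cO.
have yW j : dotv y (row j W) = 0 by rewrite -w5; exact: cO.
have xy : (latpt Br x - y <= W)%MS.
  rewrite cE v5 subKr summx_sub// => j _; rewrite scalemx_sub// w5 row_sub//.
have memM : (latpt Br x <= M)%MS = (dotv y y == 0) by rewrite -WM; exact: residual_mem.
have e6 i : (i < 38)%N -> i \notin [:: 21; 22; 23; 36]%N -> ireg s6 i = ireg s i.
  move=> ik H; rewrite fi6 ?e5//; move: H; rewrite !inE; move: ik; clear; lia.
have m6l a : (a < h)%N -> rmem s6 a = rmem s a by move=> ah; rewrite m6 ?ah// m5 m4l.
have h621 : ireg s6 21 = h by rewrite fi6.
apply: wp_seq; isteps; set s7 := State _ _ _ _ _.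
have e7 i : (i < 38)%N -> i \notin [:: 21; 22; 23; 36]%N -> ireg s7 i = ireg s i.
  by move=> ik H; rewrite /= !ifF ?e6//; apply/negbTE; slia.
have r7' i : (i < 38)%N -> i \notin [:: 12; 16]%N -> rreg s7 i = rreg s i.
  move=> ik; rewrite !inE negb_or => /andP[i12 /negbTE i16]; rewrite /= i16 fr6// r5// (leq_trans ik)//.
have r712 : rreg s7 12 = rreg s2 39 by rewrite /= fr6.
have r716 : rreg s7 16 = 0 by [].
have m7 : rmem s7 = rmem s6 by []. have im7 : imem s7 = imem s by rewrite /= im6.
have t7 : tape s7 = tape s by rewrite /= ft6.
have h740 : ireg s7 40 = h by rewrite /= h621 e6// i3 addn0.
have h741 : ireg s7 41 = h by rewrite /= h621 e6// i3 addn0.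
have h742 : ireg s7 42 = n by rewrite /= !e6// i0 i3 addn0.
clearbody s7.
apply: wp_seq; apply: wp_weaken (wp_dot oracle h740 h741 h742) (leqnn _) _.
move=> s8 [[fi8 fr8 ft8] im8 m8 r8]; rewrite dot_vec in r8.
have yE : vec s7 h = y by apply: vec_eq => i _; rewrite m7.
rewrite yE in r8.
have e8 i : (i < 38)%N -> i \notin [:: 21; 22; 23; 36]%N -> ireg s8 i = ireg s i.
  by move=> ik H; rewrite fi8 ?e7// (leq_trans ik).
have r8' i : (i < 38)%N -> i \notin [:: 12; 16]%N -> rreg s8 i = rreg s i.
  by move=> ik H; rewrite fr8 ?r7'// (leq_trans ik).
have r812 : rreg s8 12 = rreg s2 39 by rewrite fr8.
have m8l a : (a < h)%N -> rmem s8 a = rmem s a by move=> ah; rewrite m8 m7 m6l.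
have fr08 : framex [:: 12; 13; 21; 22; 23] 29 11 s s8.
  split; last by rewrite ft8 t7.
    move=> i /andP[ik]; rewrite !inE => H; apply: e8; first by rewrite (leq_trans ik).
    by rewrite !inE; move: ik H; clear; lia.
  by move=> i ik; apply: r8'; rewrite ?(leq_trans ik)// !inE; move: ik; clear; lia.
have {}im8 : imem s8 = imem s by rewrite im8.
have fin s9 : framex [:: 12; 13; 21; 22; 23] 29 11 s s9 -> ireg s9 13 = p -> imem s9 = imem s ->
    (forall a, (a < h)%N -> rmem s9 a = rmem s a) -> best_ok v (rcons X x) s9 ->
    wp (block [:: IAdd 13 13 1]) s9 1 (fun s' =>
    [/\ framex [:: 12; 13; 21; 22; 23] 29 11 s s', ireg s' 13 = (p + L)%N, imem s' = imem s,
      forall a, (a < h)%N -> rmem s' a = rmem s a & best_ok v (rcons X x) s']).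
  move=> [fi9 fr9 ft9] h9 im9 m9 b9; isteps; split => //=.
  - by split => //= i H; rewrite ifF ?fi9//; apply/negbTE; move: H; rewrite !inE; clear; lia.
  - by rewrite h9 fi9// i1.
have h813 : ireg s8 13 = p by rewrite e8.
have h828 : ireg s8 28 = h by rewrite e8.
have [bo1 bo2] := bo.
have bo8 : best_ok v X s8.
  by apply: best_ok_frame bo; rewrite ?r8' ?e8// h828.
apply: wp_seq; apply: wp_if => /=.
have r816 : rreg s8 16 = 0 by rewrite fr8.
rewrite r816 r8 lt_neqAle dotv_ge0 andbT eq_sym -memM.
case/boolP: (latpt Br x <= M)%MS => xM /=.
  apply: wp_skip; apply: fin => //; split; last by case: bo8.
  move=> x'; rewrite mem_rcons inE => /predU1P[->|]; first by rewrite xM.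
  by case: bo8 => H _; exact: H.
apply: wp_if => /=; rewrite r812 r8'//.
case/andP: g2 => g2 g2'.
have [lt|le] := ltP (rreg s2 39) (rreg s 11); last first.
  apply: wp_skip; apply: fin => //; split; last by case: bo8.
  move=> x'; rewrite mem_rcons inE => /predU1P[-> _|x'X]; first by rewrite r8'// (le_trans le).
  by case: bo8 => H _; exact: H.
isteps; set s9 := State _ _ _ _ _.
have r911 : rreg s9 11 = rreg s2 39 by rewrite /= add0r.
apply: fin => //.
- split => /=; last by rewrite ft8 t7.
    by case: fr08 => fi _ _ i H; rewrite ifF ?fi//; apply/negbTE; move: H; rewrite !inE; clear; lia.
  by case: fr08 => _ fr _ i H; rewrite !ifF ?fr//; apply/negbTE; move: H; clear; lia.
split.
  move=> x'; rewrite mem_rcons inE r911 => /predU1P[->//|x'X] x'M.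
  exact: le_trans (ltW lt) (bo1 _ x'X x'M).
right; exists x; rewrite r911 /= h813 e8// i3 addn0 h828; split => //.
exact: stored_below m8l ph sx.
Qed.

Lemma wp_scan s ALL ia X v : stat s -> heap ALL s -> ireg s 10 = ia -> (ia < size ALL)%N ->
  (forall x, x \in nth [::] ALL ia -> mabs x <= zmax) -> rreg s 7 = v -> 0 <= v -> best_ok v X s ->
  wp (scan_cmd nu) s (size (nth [::] ALL ia) * inspect_time.+1 + 4) (fun s' =>
    [/\ framex [:: 12; 13; 14; 21; 22; 23] 29 11 s s', imem s' = imem s,
      forall a, (a < ireg s 28)%N -> rmem s' a = rmem s a & best_ok v (X ++ nth [::] ALL ia) s']).
Proof.
move=> st hp h10 ial Wz r7 v0 bo; have [[[i0 i1 i2 i3 i4] [i5 i6]] _ _ _ im0] := st.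
set W := nth [::] ALL ia in Wz *; set h := ireg s 28.
have [h20 _ hstep hvl] := hp.
have sW := hvl _ ial; rewrite -/W in sW.
have bW : (imem s ia + L * size W <= h)%N := heap_list_le hp ial.
have nW : imem s ia.+1 = (imem s ia + L * size W)%N := hstep _ ial.
have L0 : (0 < L)%N by slia.
have Hh : (3 * nn + L * n <= h)%N by rewrite -im0; exact: heap_le hp _.
apply: (@wp_le _ _ _ _ _ (3 + (size W * inspect_time.+1).+1)); last by clear; move: (size W * _)%N; lia.
apply: wp_seq; isteps; set s1 := State _ _ _ _ _.
have f1 : framex [:: 12; 13; 14; 21; 22; 23] 29 11 s s1.
  by split => //= i H; rewrite !ifF//; apply/negbTE; move: H; rewrite !inE; clear; lia.
have h13 : ireg s1 13 = imem s ia by rewrite /= h10.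
have h14 : ireg s1 14 = (imem s ia + L * size W)%N by rewrite /= h10 i4 addn1.
have bo1 : best_ok v X s1 by [].
have m1 : rmem s1 = rmem s by []. have im1 : imem s1 = imem s by [].
clearbody s1.
pose I k s' := [/\ framex [:: 12; 13; 14; 21; 22; 23] 29 11 s s', imem s' = imem s,
  forall a, (a < h)%N -> rmem s' a = rmem s a, best_ok v (X ++ take k W) s' &
  ireg s' 13 = (imem s ia + L * k)%N /\ ireg s' 14 = (imem s ia + L * size W)%N].
apply: (wp_while (m := size W) (I := I)).
- by move=> k s' [_ _ _ _ [+ +]] /= => -> ->; rewrite ltn_add2l ltn_mul2l L0.
- move=> k s' kW [[fi fr ft] im m b [h13' h14']].
  have kW' : (L * k.+1 <= L * size W)%N by rewrite leq_mul2l kW orbT.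
  rewrite mulnS in kW'.
  have f' : frame 7 7 s s'.
    by split => // i ik; [apply: fi; rewrite !inE; move: ik; clear; lia | apply: fr; rewrite (leq_trans ik)].
  have h28' : ireg s' 28 = h by rewrite fi.
  have st' : stat s'.
    apply: stat_frame f' _ _ st; last by rewrite im.
    by move=> a ah; apply: m; exact: leq_trans Hh.
  apply: wp_weaken (@wp_inspect s' v (nth 0 W k) (X ++ take k W) st' _ _ _ _ _ v0 b) (leqnn _) _.
  + by rewrite h28'.
  + by rewrite h13'; apply: (stored_below m) (sW k kW); slia.
  + by rewrite h13' h28'; slia.
  + by apply: Wz; exact: mem_nth.
  + by rewrite fr.
  move=> s2 [[fi2 fr2 ft2] h213 im2 m2 b2]; rewrite h28' in m2; split.
  + split; last by rewrite ft2.
      by move=> i H; rewrite fi2 ?fi//; move: H; rewrite !inE; clear; lia.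
    by move=> i H; rewrite fr2 ?fr.
  + by rewrite im2.
  + by move=> a ah; rewrite m2// m.
  + by rewrite (take_nth 0)// -rcons_cat.
  + by rewrite h213 h13' fi2// h14' mulnS; split => //; clear; lia.
- by split => //; rewrite ?take0 ?cats0 ?muln0 ?addn0// => a _; rewrite m1.
by move=> s' [fr im m b _]; rewrite take_size in b.
Qed.

End ScanList.

(** * Refining the final nets and selecting the output *)

Definition refine_cmd (nu : cmd) : cmd :=
  Seq (block [:: IAdd 21 10 3; IAdd 22 11 3; RSet 16 3; RMul 20 16 9; RSet 16 6; RMul 21 10 9;
         RDiv 21 21 16; IAdd 10 20 3])
  (Seq (prune_cmd nu) (block [:: RSet 16 2; RDiv 10 10 16])).

(** Each pass halves the relative error f of the list for scale l, using as partner the net one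
    scale lower than in the pass before. It stops refining once 4 f <= e; otherwise it runs until
    the scales are exhausted. *)
Definition refine_loop (nu : cmd) : cmd :=
  While (ILt 7 11) (Seq (block [:: ISub 11 11 4; RSet 16 4; RMul 16 16 10])
    (If (RLt 4 16) (refine_cmd nu) Skip)).

Definition select_cmd (nu : cmd) : cmd :=
  Seq (block [:: RSet 11 4; RMul 11 11 3; ISet 12 0; IAdd 8 7 3; IAdd 9 20 3; RSet 16 3;
         RMul 9 7 16; RSet 16 4; RDiv 9 9 16])
  (While (ILt 8 9)
    (Seq (block [:: IAdd 10 8 3; IAdd 11 8 3; RSet 10 1; RSet 16 2; RDiv 10 10 16])
    (Seq (refine_loop nu) (Seq (scan_cmd nu) (block [:: RAdd 9 9 9; IAdd 8 8 4]))))).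

Definition output_cmd : cmd :=
  Seq (block [:: ISet 40 0; IAdd 41 12 0; IAdd 42 12 0; IAdd 43 0 3; RSet 40 0]) axpy.

Section Select.
Context {R : realType} {n : nat} (oracle : 'rV[R]_n -> R) (B : 'M[rat]_n) (M : 'M[R]_n).
Variables (e fac U vend : R).
Variables (q : 'rV[int]_n -> R) (zmax dl : R) (tn : nat) (nu : cmd) (J S1 S2 : nat) (v : R).
Implicit Types (s : state R) (ALL : seq (seq 'rV[int]_n)) (W X : seq 'rV[int]_n).
Local Notation wp := (wp oracle).
Local Notation Br := (map_mx ratr B : 'M[R]_n).
Local Notation L := (n + n)%N.
Local Notation stat := (stat B M e fac U vend).
Local Notation heap := (heap Br).
Local Notation Z := (3 * 2 ^+ J : R).
Local Notation nets := (nets q J S1 v).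
Local Notation best_ok := (best_ok B M U q dl v).
Hypothesis n_gt0 : (0 < n)%N.
Hypothesis q_ge0 : forall z, 0 <= q z.
Hypothesis qD : forall z w, q (z + w) <= q z + q w.
Hypothesis q_0 : q 0 = 0.
Hypothesis dl01 : 0 <= dl <= 1.
Hypothesis nu_spec : forall s z, genv n fac (vend / 2) s -> stored Br (rmem s) (ireg s 38) z ->
  mabs z <= zmax -> 0 <= rreg s 7 -> (ireg s 38 + (n + n) <= ireg s 39)%N ->
  wp nu s tn (fun s' => keeps s s' /\
    nrm q (rreg s 7) z <= rreg s' 39 <= (1 + dl) * nrm q (rreg s 7) z).
Hypothesis Zz : 3 * Z <= zmax.
Hypothesis v0 : 0 < v.
Hypothesis S12 : (S1 <= S2)%N.
Hypothesis S2_cap : forall l f D O, e < 4 * f -> pruned q v (3 * tau v l) (f * tau v l / 6) D O ->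
  (size O <= S2)%N.

Definition fine l (f : R) W := [/\ covers q v (tau v l) (f * tau v l) W, (size W <= S2)%N &
  forall x, x \in W -> mabs x <= Z].

(** After k passes, j of them effective: either all were, or the accuracy was already reached after
    j and the remaining passes did nothing. *)
Definition refined ALL l k s := exists j, [/\ rreg s 10 = 2 ^- j.+1, (j <= k)%N,
  (j == k) || (4 * 2 ^- j.+1 <= e), (ireg s 10 < size ALL)%N &
  fine l (2 ^- j.+1) (nth [::] ALL (ireg s 10))].

Definition refine_time := (J * (@prune_time n tn S2 S1 S2 + 20) + 1)%N.

Lemma wp_refine s ALL i0 l : stat s -> heap ALL s -> (i0 + J < size ALL)%N -> nets ALL i0 -> (l <= J)%N ->
  ireg s 7 = i0 -> ireg s 10 = (i0 + l)%N -> ireg s 11 = (i0 + l)%N ->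
  rreg s 7 = v -> rreg s 9 = tau v l -> rreg s 10 = 1 / 2 ->
  wp (refine_loop nu) s refine_time (fun s' => exists ALL', [/\ heap ALL' s',
     (size ALL <= size ALL')%N /\ (forall a, (a < size ALL)%N -> nth [::] ALL' a = nth [::] ALL a),
     refined ALL' l l s', grow s s' &
     framex [:: 10; 11] 13 10 s s' /\ rreg s' 11 = rreg s 11]).
Proof.
move=> st hp szA nt lJ h7 h10 h11 r7 r9 r10; have [[[i0' i1 i2 i3 i4] _] _ _ _ _] := st.
pose I k s' := exists ALL', [/\ heap ALL' s',
     (size ALL <= size ALL')%N /\ (forall a, (a < size ALL)%N -> nth [::] ALL' a = nth [::] ALL a),
     refined ALL' l k s' /\ ireg s' 11 = (i0 + l - k)%N, grow s s' &
     framex [:: 10; 11] 13 10 s s' /\ rreg s' 11 = rreg s 11].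
apply: (@wp_le _ _ _ _ _ (l * (3 + (8 + (@prune_time n tn S2 S1 S2 + 2)).+1).+1).+1); last first.
  rewrite /refine_time; set P := prune_time _ _ _ _; rewrite addn1 ltnS.
  by apply: leq_mul => //; clear; lia.
apply: (wp_while (m := l) (I := I)); last 2 first.
- exists ALL; split => //; split; last by rewrite h11 subn0.
  exists 0%N; rewrite expr1 r10 div1r h10; split => //.
    by apply: leq_ltn_trans szA; rewrite leq_add2l.
  have [c sz Wz] := nt _ lJ; split => //; last exact: leq_trans S12.
  apply: covers_mono c => //; have := tau_gt0 l v0; lra.
- by move=> s' [ALL' [hp' sA [rf _] g f]]; exists ALL'.
- move=> k s' [ALL' [_ _ [_ h11'] _ [[fi _ _] _]]] /=.
  rewrite h11' fi// h7; clear; lia.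
move=> k s' kl [ALL' [hp' [szA' pre] [[j [r10' jk jd h10' [cW sW WZ]]] h11'] g' [f' r11']]].
have [fi' fr' ft'] := f'.
have fr7' : frame 7 7 s s'.
  by split => // i ik; [apply: fi'; rewrite !inE; move: ik; clear; lia | apply: fr'; rewrite (leq_trans ik)].
have st' : stat s' by apply: stat_grow (heap_openE hp) fr7' g' st.
have [[[_ _ _ k3 k4] _] [_ _ _ _ [r4 _ _]] _ _ _] := st'.
apply: wp_seq; isteps; set s1 := State _ _ _ _ _.
have h111 : ireg s1 11 = (i0 + l - k.+1)%N by rewrite /= h11' k4; clear; lia.
have f1 : framex [:: 10; 11] 16 16 s' s1.
  by split => //= i H; rewrite !ifF//; apply/negbTE; move: H; rewrite ?inE; clear; lia.
have g1 : grow s' s1 by [].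
have hp1 : heap ALL' s1 by apply: heap_frame hp'.
have h110 : ireg s1 10 = ireg s' 10 by [].
have r110 : rreg s1 10 = 2 ^- j.+1 by [].
have r116 : rreg s1 16 = 4 * 2 ^- j.+1 by rewrite /= r10'.
have r111 : rreg s1 11 = rreg s 11 by [].
have h120 : ireg s1 20 = ireg s' 20 by [].
clearbody s1; have [fi1 fr1 ft1] := f1.
have f01 : framex [:: 10; 11] 13 10 s s1.
  split; last by rewrite ft1.
    by move=> i H; rewrite fi1 ?fi'//; move: H; rewrite ?inE; clear; lia.
  by move=> i H; rewrite fr1 ?fr'// (leq_trans H).
have g01 := grow_trans g' g1.
apply: wp_if => /=; rewrite r116 fr1// r4.
have [lt|le] := ltP e (4 * 2 ^- j.+1); last first.
  apply: wp_skip; exists ALL'; split => //; split => //; exists j; split => //.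
  - exact: leq_trans jk _.
  - by rewrite le orbT.
  - by rewrite h110.
  - by rewrite h110; split.
have {jd} jk' : j = k by move: jd; rewrite leNgt lt orbF => /eqP.
subst j.
have lk : (l - k.+1 <= J)%N by move: lJ; clear; lia.
set W := nth [::] ALL' (ireg s' 10) in cW sW WZ.
have V1 : nth [::] ALL' (i0 + l - k.+1) = nth [::] ALL (i0 + (l - k.+1)).
  rewrite -addnBA// pre//; move: szA lJ; clear; lia.
have [cV sV VZ] := nt _ lk; rewrite -V1 in cV sV VZ.
have ll : (i0 + l - k.+1 < size ALL')%N by move: szA szA' lJ kl; clear; lia.
have T0 := tau_gt0 l v0.
(* The current error is exactly the range of the partner net, as [refine_covers] demands. *)
have fT : 2 ^- k.+1 * tau v l = tau v (l - k.+1).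
  rewrite /tau -[in 2 ^+ l](subnK kl) exprD; field; by rewrite expf_neq0.
have f0 : 0 < 2 ^- k.+1 :> R by rewrite invr_gt0 exprn_gt0.
have [h20' _ _ _] := hp'.
apply: wp_seq; isteps; set s2 := State _ _ _ _ _.
have K3 : ireg s1 3 = 0%N by rewrite fi1.
have f2 : framex [:: 10] 16 16 s1 s2.
  by split => //= i H; rewrite !ifF//; apply/negbTE; move: H; rewrite ?inE; clear; lia.
have g2 : grow s1 s2 by [].
have hp2 : heap ALL' s2 by apply: heap_frame hp1.
have h221 : ireg s2 21 = ireg s' 10 by rewrite /= K3 addn0.
have h222 : ireg s2 22 = (i0 + l - k.+1)%N by rewrite /= K3 addn0.
have h210 : ireg s2 10 = size ALL' by rewrite /= K3 addn0 h120.
have r220 : rreg s2 20 = 3 * tau v l by rewrite /= fr1// fr'// r9.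
have r221 : rreg s2 21 = 2 ^- k.+1 * tau v l / 6 by rewrite /= r110 fr1// fr'// r9.
have r27 : rreg s2 7 = v by rewrite /= fr1// fr'// r7.
have r210 : rreg s2 10 = 2 ^- k.+1 by [].
have r211 : rreg s2 11 = rreg s 11 by [].
have h211 : ireg s2 11 = ireg s1 11 by [].
clearbody s2; have [fi2 fr2 ft2] := f2.
have fr72 : frame 7 7 s s2.
  split; last by rewrite ft2 ft1.
    by move=> i H; rewrite fi2 ?fi1 ?fi'//; move: H; rewrite ?inE; clear; lia.
  by move=> i H; rewrite fr2 ?fr1 ?fr'// (leq_trans H).
have g02 := grow_trans g01 g2.
have st2 : stat s2 by apply: stat_grow (heap_openE hp) fr72 g02 st.
have envE s0 : genv n fac (vend / 2) s0 -> ireg s0 0 = n /\ ireg s0 1 = L by case.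
have ge := stat_genv st2.
apply: wp_seq.
have := @wp_prune _ _ oracle Br q zmax dl tn nu _ n_gt0 q_ge0 q_0 dl01 (@genv_frame _ n _ fac) envE nu_spec
    s2 ALL' (ireg s' 10) (i0 + l - k.+1)%N Z S2 ge; rewrite r27 r220 r221 -/W.
move=> H; apply: wp_weaken (H v0 hp2 h221 h222 h10' ll _ _ Zz WZ VZ _) _ _.
- by rewrite divr_ge0// mulr_ge0// ltW.
- exact: tau_leZ.
- by move=> D O; exact: S2_cap.
- exact: prune_time_le.
move=> s3 [ O [prO hp3 [fi3 fr3 ft3] im3 m3]].
have g3 : grow s2 s3 by apply: heap_grow hp3 im3 m3.
isteps; exists (rcons ALL' O); split.
- by apply: heap_frame hp3.
- split; first by rewrite size_rcons leqW.
  by move=> a al; rewrite nth_rcons (leq_trans al)// pre.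
- split; last by rewrite /= fi3// h211 h111.
  exists k.+1; rewrite /= !fi3// h210 size_rcons nth_rcons ltnn !eqxx; split => //.
  + by rewrite fr3// r210 [in RHS]exprSr invfM.
  split.
  + have -> : 2 ^- k.+2 * tau v l = (2 ^- k.+1 * tau v l) / 2 by rewrite [in LHS]exprSr invfM; ring.
    have half : 2 * (2 ^- k.+1 * tau v l) <= tau v l.
      have : 2 * 2 ^- k.+1 <= 1 :> R.
        by rewrite ler_pdivrMr ?exprn_gt0// mul1r exprS ler_peMr// exprn_ege1// ler1n.
      by move=> H2; rewrite mulrA -[leRHS]mul1r ler_pM2r.
    rewrite -fT in cV.
    exact: (refine_covers qD v0 (mulr_gt0 f0 T0) half cW cV prO).
  + exact: S2_cap lt prO.
  + move=> x; case: prO => _ Ob _ /Ob; rewrite nrm_le => /andP[_ /le_trans/(_ (tau_leZ v0 lJ))].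
    by rewrite ler_pM2l.
- exact: grow_trans g02 g3.
- split.
    split => /=; last by rewrite ft3 ft2 ft1.
      by move=> i H'; rewrite fi3 ?fi2 ?fi1 ?fi'//; move: H'; rewrite ?inE; clear; lia.
    by move=> i H'; rewrite !ifF ?fr3 ?fr2 ?fr1 ?fr'//; try apply/negbTE; move: H'; rewrite ?inE; clear; lia.
  by rewrite /= fr3.
Qed.

(** If the scales run out before 4 f <= e, then f = 2^-(l+1) and the error is (3/8) v, too small for
    a nonzero integer vector: the list is then complete at that scale. *)
Definition examined X l := exists W f, [/\ {subset W <= X}, covers q v (tau v l) (f * tau v l) W &
  4 * f <= e \/ f = 2 ^- l.+1].

Definition select_time := (J.+1 * (refine_time + (S2 * (@inspect_time n tn).+1 + 20)) + 12)%N.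

Lemma wp_select s ALL i0 : stat s -> heap ALL s -> size ALL = (i0 + J.+1)%N -> nets ALL i0 ->
  ireg s 7 = i0 -> rreg s 7 = v ->
  wp (select_cmd nu) s select_time (fun s' => exists X, [/\ best_ok X s',
     forall l, (l <= J)%N -> examined X l & stat s']).
Proof.
move=> st hp szA nt h7 r7; have [[[i0' i1 i2 i3 i4] _] [_ _ _ r3 _] _ _ _] := st.
have [h20 _ _ _] := hp.
apply: (@wp_le _ _ _ _ _ (9 + (J.+1 * (5 + (refine_time + (S2 * (@inspect_time n tn).+1 + 4 + 2))).+1).+1)); last first.
  rewrite /select_time; move: refine_time (S2 * _)%N => X Y.
  have : (J.+1 * (5 + (X + (Y + 4 + 2))).+1 <= J.+1 * (X + (Y + 20)))%N by rewrite leq_mul2l /=; clear; lia.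
  by clear; move: (_ * _)%N (_ * (X + _))%N => x y; lia.
apply: wp_seq; isteps; set s1 := State _ _ _ _ _.
pose I l s' := exists ALL' X, [/\ heap ALL' s',
     (size ALL <= size ALL')%N /\ (forall a, (a < size ALL)%N -> nth [::] ALL' a = nth [::] ALL a),
     [/\ ireg s' 7 = i0, ireg s' 8 = (i0 + l)%N, ireg s' 9 = (i0 + J.+1)%N, rreg s' 7 = v & rreg s' 9 = tau v l],
     best_ok X s' /\ forall k, (k < l)%N -> examined X k & grow s s' /\ frame 7 7 s s'].
apply: (wp_while (m := J.+1) (I := I)).
- by move=> l s' [ALL' [X [_ _ [_ h8 h9 _ _] _ _]]] /=; rewrite h8 h9 ltn_add2l.
- move=> l s' lJ [ALL' [X [hp' [szA' pre] [h7' h8 h9 r7' r9] [bo ex] [g' f']]]].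
  have st' : stat s' by apply: stat_grow (heap_openE hp) f' g' st.
  have [[[_ _ _ k3 k4] _] _ _ _ _] := st'.
  apply: wp_seq; isteps; set s2 := State _ _ _ _ _.
  have f2 : framex [:: 10; 11] 16 10 s' s2.
    by split => //= i H; rewrite !ifF//; apply/negbTE; move: H; rewrite ?inE; clear; lia.
  have g2 : grow s' s2 by [].
  have hp2 : heap ALL' s2 by apply: heap_frame hp'.
  have h210 : ireg s2 10 = (i0 + l)%N by rewrite /= h8 k3 addn0.
  have h211 : ireg s2 11 = (i0 + l)%N by rewrite /= h8 k3 addn0.
  have r210 : rreg s2 10 = 1 / 2 by [].
  have bo2 : best_ok X s2 by apply: best_ok_frame bo.
  clearbody s2; have [fi2 fr2 ft2] := f2.
  have f02 : frame 7 7 s' s2.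
    split => // i H; [apply: fi2 | apply: fr2]; move: H; rewrite ?inE; clear; lia.
  have st2 : stat s2 by apply: stat_grow (heap_openE hp') f02 g2 st'.
  have nt' : nets ALL' i0.
    by move=> k kJ; rewrite pre; [exact: nt | rewrite szA ltn_add2l].
  have szJ : (i0 + J < size ALL')%N by rewrite (leq_trans _ szA')// szA ltn_add2l.
  apply: wp_seq; apply: wp_weaken (@wp_refine s2 ALL' i0 l st2 hp2 szJ nt' lJ _ h210 h211 _ _ r210) (leqnn _) _.
  + by rewrite fi2.
  + by rewrite fr2.
  + by rewrite fr2.
  move=> s3 [AL3 [hp3 [szA3 pre3] [j [r103 jl jd h103 [cW sW WZ]]] g3 [[fi3 fr3 ft3] r113]]].
  have f03 : frame 7 7 s s3.
    apply: frame_trans f' _; apply: frame_trans f02 _.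
    by split => // i H; [apply: fi3 | apply: fr3]; move: H; rewrite ?inE; clear; lia.
  have g03 : grow s s3 := grow_trans (grow_trans g' g2) g3.
  have st3 : stat s3 by apply: stat_grow (heap_openE hp) f03 g03 st.
  have [m3 l3 _ _] := g3.
  have bo3 : best_ok X s3 by apply: best_ok_frame bo2 => //; rewrite fi3.
  have r73 : rreg s3 7 = v by rewrite fr3// fr2.
  have Wz x : x \in nth [::] AL3 (ireg s3 10) -> mabs x <= zmax.
    by move=> /WZ /le_trans; apply; apply: le_trans Zz; rewrite ler_peMl ?mulr_ge0 ?exprn_ge0// ler1n.
  apply: wp_seq; apply: wp_weaken (@wp_scan _ _ oracle B M e fac U vend q zmax dl tn nu n_gt0 nu_spec
    s3 AL3 _ X v st3 hp3 erefl h103 Wz r73 (ltW v0) bo3) _ _.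
    by rewrite leq_add2r leq_mul2r sW orbT.
  move=> s4 [[fi4 fr4 ft4] im4 m4 bo4].
  have g4 : grow s3 s4 by split => //; rewrite ?im4 ?fi4.
  have hp4 : heap AL3 s4 by apply: heap_frame g4 hp3; rewrite fi4.
  have e34 i : (i < 10)%N -> ireg s4 i = ireg s' i.
    move=> ik; rewrite fi4 ?fi3 ?fi2//; move: ik; rewrite ?inE; clear; lia.
  have q34 i : (i < 10)%N -> rreg s4 i = rreg s' i.
    move=> ik; rewrite fr4 ?fr3 ?fr2//; move: ik; rewrite ?inE; clear; lia.
  isteps; exists AL3, (X ++ nth [::] AL3 (ireg s3 10)); split.
  + by apply: heap_frame hp4.
  + split; first exact: leq_trans szA' szA3.
    by move=> a al; rewrite pre3 ?pre// (leq_trans al).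
  + split => /=; rewrite ?e34 ?q34//; first by rewrite h8 k4; clear; lia.
    by rewrite r9 tauS; ring.
  + split; first by apply: best_ok_frame bo4.
    move=> k; rewrite ltnS leq_eqVlt => /predU1P[->|/ex[W [f [WX c fe]]]].
      exists (nth [::] AL3 (ireg s3 10)), (2 ^- j.+1); split => //.
        by move=> x xW; rewrite mem_cat xW orbT.
      by case/orP: jd => [/eqP->|]; [right | left].
    by exists W, f; split => // x /WX xX; rewrite mem_cat xX.
  + split; first by apply: grow_trans g03 _; apply: grow_trans g4 _.
    apply: frame_trans f' _; split => //=; last by rewrite ft4 ft3 ft2.
      by move=> i ik; rewrite ifF ?e34//; try apply/negbTE; move: ik; clear; lia.
    by move=> i ik; rewrite ifF ?q34//; try apply/negbTE; move: ik; clear; lia.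
- exists ALL, [::]; split => //.
  + split => //=; rewrite ?h7 ?i3 ?h20 ?addn0//.
    by rewrite r7 /tau expr0 mulr1 mulrA.
  + split => //; split => //=; left; rewrite r3//.
  + by split => //; split => //=; iframe.
move=> s' [ALL' [X [hp' _ _ [bo ex] [g' f']]]]; exists X; split => //.
by apply: stat_grow (heap_openE hp) f' g' st.
Qed.

Lemma wp_output s x : stat s -> stored Br (rmem s) (ireg s 12) x ->
  wp output_cmd s (10 * n + 8) (fun s' => rvec s' 0 = latpt Br x).
Proof.
move=> [[[i0 i1 i2 i3 i4] _] _ _ _ _] sx.
apply: (@wp_le _ _ _ _ _ (5 + (10 * n + 3))); last by clear; lia.
apply: wp_seq; isteps.
have ap : apart 0 n (ireg s 12 + n) by rewrite /apart; apply/orP; right; apply/orP; right; clear; lia.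
apply: wp_weaken (@wp_axpy _ _ oracle _ 0 (ireg s 12 + n)%N (ireg s 12 + n)%N n _ _ _ _ ap ap) (leqnn _) _;
  rewrite /= ?i0 ?i3 ?addn0//.
move=> s' [_ _ m]; rewrite -(stored_rvec sx); apply/rowP => i.
by rewrite !mxE m !add0n subn0 ltn_ord /= mul0r addr0.
Qed.

End Select.

(** * Why the examined vectors contain an answer *)

Section LatticeSearch.
Context {R : realType} {n : nat} (C : set 'rV[R]_n) (r rho : R) (B : 'M[rat]_n) (M : 'M[R]_n).
Hypothesis n_gt0 : (0 < n)%N.
Hypothesis Cconv : convex_set (C : set (convex_lmodType 'rV[R]_n)).
Hypothesis Ccent : centered r rho C.
Hypothesis uB : B \in unitmx.
Hypothesis rkM : (\rank M < n)%N.
Implicit Types (z x : 'rV[int]_n) (s : state R) (X : seq 'rV[int]_n).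
Local Notation Br := (map_mx ratr B : 'M[R]_n).
Local Notation q := (fun z => gauge C (latpt Br z)).
Local Notation Q := (size_bound B : R).
Local Notation U := (Q / r).
Local Notation vend := (1 / (rho * (Q * Q))).
Local Notation Lat := (lattice Br).
Local Notation lam := (lambda C Lat (rowspace M)).
Local Notation inM z := (latpt Br z <= M)%MS.

Lemma latt_q_ge0 z : 0 <= q z. Proof. exact: gauge_ge0 Ccent _. Qed.

Lemma latt_qD z x : q (z + x) <= q z + q x.
Proof. by rewrite /= latptD; exact: (gaugeD Cconv Ccent). Qed.

Lemma latt_q0 : q 0 = 0.
Proof. by rewrite /= /latpt map_mx0 mul0mx (gauge0 Ccent). Qed.

Lemma inner_radius_gt0 : 0 < r. Proof. by case: Ccent. Qed.

Lemma outer_radius_gt0 : 0 < rho.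
Proof. exact: lt_le_trans inner_radius_gt0 (radii_le Ccent n_gt0). Qed.

Lemma size_bound_gt0 : 0 < Q.
Proof. exact: lt_le_trans ltr01 (size_bound_ge1 _). Qed.

Lemma upper_gt0 : 0 < U.
Proof. by rewrite divr_gt0 ?size_bound_gt0 ?inner_radius_gt0. Qed.

Lemma lower_gt0 : 0 < vend.
Proof. by rewrite divr_gt0// mulr_gt0 ?outer_radius_gt0// mulr_gt0 ?size_bound_gt0. Qed.

Lemma lower_le_upper : vend <= U.
Proof.
have r0 := inner_radius_gt0; have rr := radii_le Ccent n_gt0.
have rho0 := outer_radius_gt0; have Q1 := @size_bound_ge1 R n B; have Q0 := size_bound_gt0.
rewrite ler_pdivrMr ?mulr_gt0// mulrAC ler_pdivlMr// mul1r.
apply: le_trans rr _; rewrite mulrCA ler_peMr ?(ltW rho0)//.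
by rewrite mulrA !mulr_ege1.
Qed.

(** The outer radius bounds the entries of the point by the gauge, and [coord_basis_le] bounds the
    coordinates by those entries. *)
Lemma lattice_lower z : vend * mabs z <= q z.
Proof.
rewrite mulrC -ler_pdivlMr ?lower_gt0// div1r invrK.
have rho0 := outer_radius_gt0; have Q0 := size_bound_gt0.
apply: mabs_le => [|k].
  by rewrite mulr_ge0 ?latt_q_ge0// mulr_ge0 ?(ltW rho0)// mulr_ge0 ?(ltW Q0).
have := @coord_basis_le R n B (map_mx intr z) (latpt Br z) k uB erefl; rewrite mxE => /le_trans; apply.
have -> : q z * (rho * (Q * Q)) = Q * (Q * (rho * q z)) by ring.
rewrite ler_pM2l//; apply: (@le_trans _ _ (n%:R * (rho * q z))).
  have -> : n%:R * (rho * q z) = \sum_(j < n) rho * q z by rewrite sumr_const card_ord mulr_natl.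
  by apply: ler_sum => j _; exact: (coord_le_gauge Cconv Ccent).
rewrite ler_wpM2r ?dim_le_size_bound//.
by rewrite mulr_ge0 ?latt_q_ge0 ?ltW.
Qed.

Lemma lattice_upper z : q z <= U * mabs z.
Proof.
have r0 := inner_radius_gt0; apply: le_trans (gauge_le_l1 Ccent _) _.
rewrite mulrAC ler_pM2r ?invr_gt0//.
apply: (@le_trans _ _ (\sum_j \sum_k `|(z 0 k)%:~R| * `|Br k j|)).
  apply: ler_sum => j _; rewrite mxE; apply: le_trans (ler_norm_sum _ _ _) _.
  by apply: ler_sum => k _; rewrite normrM mxE.
rewrite exchange_big /=; apply: (@le_trans _ _ (\sum_k mabs z * (\sum_j `|Br k j|))).
  apply: ler_sum => k _; rewrite mulr_sumr; apply: ler_sum => j _.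
  by rewrite ler_wpM2r// mabs_ge.
by rewrite -mulr_sumr mulrC ler_wpM2r ?mabs_ge0 ?entry_sum_le.
Qed.

Lemma lattice_small z v : 0 < v -> v <= vend -> v * mabs z <= q z.
Proof.
move=> v0 vv; apply: le_trans (lattice_lower z).
by rewrite ler_wpM2r// mabs_ge0.
Qed.

(** Some basis vector lies outside M, since otherwise M would have rank n. *)
Lemma latt_outside_has_inf : has_inf (gauge C @` (Lat `\` rowspace M)).
Proof.
split; last by exists 0 => _ [y _ <-]; exact: gauge_ge0 Ccent _.
have [/forallP H|/forallPn[i iM]] := boolP [forall i, (row i Br <= M)%MS].
  have /mxrankS : (Br <= M)%MS by apply/row_subP.
  by rewrite (@mxrank_unit _ _ Br) ?map_unitmx// leqNgt rkM.
exists (gauge C (row i Br)), (row i Br) => //; split; last by apply/negP.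
by exists (delta_mx 0 i) => //; rewrite map_delta_mx -rowE.
Qed.

Lemma latt_lam_le z : ~~ inM z -> lam <= q z.
Proof.
move=> zM; apply: ge_inf; first by case: latt_outside_has_inf.
by exists (latpt Br z) => //; split; [exists z | apply/negP].
Qed.

Lemma latt_lam_approx d : 0 < d -> exists2 z, ~~ inM z & q z < lam + d.
Proof.
move=> d0; have [_ [_ [[z _ <-] zM] <-] zd] := inf_adherent d0 latt_outside_has_inf.
by exists z => //; apply/negP.
Qed.

Lemma outside_neq0 z : ~~ inM z -> 1 <= mabs z :> R.
Proof.
apply: contraNT; rewrite -ltNge => /mabs_lt1 ->.
by rewrite /latpt map_mx0 mul0mx sub0mx.
Qed.

Lemma lam_gt0 : 0 < lam.
Proof.
apply: lt_le_trans lower_gt0 _; apply: lb_le_inf; first by case: latt_outside_has_inf.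
move=> _ [_ [[z _ <-] /negP zM] <-]; apply: le_trans (lattice_lower z).
by rewrite ler_peMr ?(ltW lower_gt0)// outside_neq0.
Qed.

Lemma lam_le_upper : lam <= U.
Proof.
have [/forallP H|/forallPn[i iM]] := boolP [forall i, (row i Br <= M)%MS].
  have /mxrankS : (Br <= M)%MS by apply/row_subP.
  by rewrite (@mxrank_unit _ _ Br) ?map_unitmx// leqNgt rkM.
have E : latpt Br (delta_mx 0 i) = row i Br by rewrite /latpt map_delta_mx -rowE.
apply: (@le_trans _ _ (q (delta_mx 0 i))); first by apply: latt_lam_le; rewrite E.
apply: le_trans (lattice_upper _) _; rewrite ler_piMr ?(ltW upper_gt0)//.
apply: mabs_le => // j; rewrite mxE; case: (_ && _); rewrite ?normr1 ?normr0//.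
Qed.

Section Examined.
Variables (e v : R) (J : nat) (X : seq 'rV[int]_n).
Hypotheses (e0 : 0 < e) (v0 : 0 < v) (v_le : v <= vend) (v_ge : 3 / 4 * vend <= v).
Hypothesis J_big : 4 * U / vend <= 2 ^+ J.
Hypothesis ex : forall l, (l <= J)%N -> examined e q v X l.

(** Take the least scale l with q z <= tau v l. The previous scale is below q z, so an error f tau v
    l is at most 2 f q z, hence at most (e/2) q z. *)
Lemma examined_close z : ~~ inM z -> q z < 2 * lam ->
  exists2 x, x \in X & q (z - x) <= e / 2 * q z /\ q (x - z) <= e / 2 * q z.
Proof.
move=> zM zl.
have qz0 : 0 < q z := lt_le_trans lam_gt0 (latt_lam_le zM).
(* The top scale suffices: tau v J >= (9/16) 2^J vend >= (9/4) U, while q z < 2 lambda <= 2 U. *)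
have qJ : q z <= tau v J.
  apply: ltW; apply: lt_le_trans zl _.
  apply: (@le_trans _ _ (2 * U)); first by rewrite ler_pM2l// lam_le_upper.
  have U0 := upper_gt0; have := J_big; rewrite ler_pdivrMr ?lower_gt0// => H1.
  have H2 : 3 / 4 * (2 ^+ J * vend) <= 2 ^+ J * v by rewrite mulrCA ler_pM2l ?exprn_gt0.
  have -> : tau v J = 3 / 4 * (2 ^+ J * v) by rewrite /tau; ring.
  set y := 2 ^+ J * v in H2 *; set w := 2 ^+ J * vend in H1 H2; set u := U in H1 U0 *.
  move: y w u H1 H2 U0 => y w u H1 H2 U0; lra.
have exl : exists l, q z <= tau v l by exists J.
have [l zt mn] := ex_minnP exl.
have lJ : (l <= J)%N := mn _ qJ.
have nz : nrm q v z <= tau v l by rewrite nrm_le zt (le_trans (lattice_small z v0 v_le)).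
have [W [f [WX c fe]]] := ex lJ.
have [x xW] := c z nz; rewrite snrm_le opprB => /and3P[h1 h2 h3].
exists x; first exact: WX.
case: fe => [fe|fe].
  (* Scale 0 cannot occur, because z is nonzero and so has a coordinate of size at least 1 > 3/4. *)
  case: l {nz c lJ} zt mn h1 h2 h3 => [|l] zt mn h1 h2 h3.
    have := le_trans (lattice_small z v0 v_le) zt; rewrite /tau expr0 mulr1 ler_pM2l//.
    by move=> H; have := le_trans (outside_neq0 zM) H; lra.
  have tl : tau v l < q z by rewrite ltNge; apply/negP => /mn; rewrite ltnn.
  have T0 := tau_gt0 l v0; rewrite tauS in h1 h2.
  have H : f * (2 * tau v l) <= e / 2 * q z by move: fe e0 tl T0 qz0; nra.
  by split; [exact: le_trans h1 H | exact: le_trans h2 H].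
(* The list is complete at this scale: an error of (3/8) v leaves no room for a nonzero
   difference. *)
have E : z - x = 0.
  apply: (@mabs_lt1 R); move: h3; rewrite fe.
  have -> : 2 ^- l.+1 * tau v l = v * (3 / 8).
    by rewrite /tau exprS; field; rewrite expf_neq0.
  by rewrite ler_pM2l// => h3; apply: le_lt_trans h3 _; lra.
have E' : x - z = 0 by rewrite -opprB E oppr0.
by rewrite E E' latt_q0; split; rewrite mulr_ge0// ?latt_q_ge0// divr_ge0// ltW.
Qed.

(** The infimum lambda is approached by lattice vectors z outside M with q z < 2 lambda. Each bounds
    the best estimate by (1 + dl) c q z, and the excess over lambda is let go to 0. *)
Lemma best_le s (U' dl c : R) : 0 <= dl -> 0 < c -> best_ok B M U' q dl v X s ->
  (forall z, ~~ inM z -> q z < 2 * lam -> exists x, [/\ x \in X, ~~ inM x & q x <= c * q z]) ->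
  rreg s 11 <= (1 + dl) * c * lam.
Proof.
move=> dl0 c0 [b1 _] H; have dc0 : 0 < (1 + dl) * c by rewrite mulr_gt0//; lra.
have near z : ~~ inM z -> q z < 2 * lam -> rreg s 11 <= (1 + dl) * c * q z.
  move=> zM /(H _ zM)[x [xX xM xz]]; apply: le_trans (b1 _ xX xM) _.
  rewrite -mulrA ler_pM2l; last by lra.
  by rewrite nrm_le xz (le_trans (lattice_small x v0 v_le)).
apply/ler_addgt0Pr => d d0.
pose d' := Num.min lam (d / ((1 + dl) * c)).
have d'0 : 0 < d' by rewrite lt_min lam_gt0 divr_gt0.
have [z zM zd] := latt_lam_approx d'0.
apply: (@le_trans _ _ ((1 + dl) * c * (lam + d'))).
  apply: le_trans (near z zM _) _; last by rewrite ler_pM2l// ltW.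
  apply: lt_le_trans zd _; rewrite mulr_natl mulr2n lerD2l ge_min lexx//.
rewrite mulrDr lerD2l mulrC -ler_pdivlMr// ge_min lexx orbT//.
Qed.

Lemma search_approx s : e <= 1 / 2 -> best_ok B M U q (e / 4) v X s ->
  exists x, [/\ ~~ inM x, stored Br (rmem s) (ireg s 12) x & q x <= (1 + e) * lam].
Proof.
move=> e2 bo; have l0 := lam_gt0; have lU := lam_le_upper.
have H : rreg s 11 <= (1 + e / 4) * (1 + e / 2) * lam.
  apply: best_le bo _ => [| |z zM zl]; rewrite ?divr_ge0 ?addr_gt0 ?divr_gt0 ?ltW//.
  have [x xX [h1 h2]] := examined_close zM zl; exists x; split => //.
    apply/negP => xM.
    (* If x were in M, then z - x would be outside M with gauge at most (e/2) q z < lambda, a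
       contradiction. *)
    have : ~~ inM (z - x).
      apply: contra zM => dM; have -> : z = (z - x) + x by rewrite subrK.
      by rewrite latptD addmx_sub.
    move=> /latt_lam_le /le_trans/(_ h1); apply/negP; rewrite -ltNge.
    apply: (@lt_trans _ _ (e / 2 * (2 * lam))); first by rewrite ltr_pM2l// divr_gt0.
    by rewrite mulrA gtr_pMl//; lra.
  have := latt_qD (x - z) z; rewrite subrK => /le_trans; apply.
  by rewrite mulrDl mul1r addrC lerD2l.
have {}H : rreg s 11 <= (1 + e) * lam.
  apply: le_trans H _; rewrite ler_pM2r//.
  have : 0 <= e * (1 / 2 - e) by rewrite mulr_ge0 ?subr_ge0 ?(ltW e0).
  by move: e0; lra.
case: bo => _ [b|[x [xM sx _ xb]]].
  by have : (1 + e) * lam <= 3 / 2 * U; [nra | move: H; rewrite b; have := upper_gt0; lra].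
exists x; split => //; apply: le_trans H; apply: le_trans xb.
by rewrite le_max lexx.
Qed.

(** With e = 1 / t the difference z - x has gauge below lambda / t <= lambda_1, so it vanishes and z
    itself was listed. The best exact value is then at most lambda, so it is attained. *)
Lemma search_exact s t : e = 1 / t -> 0 < t -> lam <= t * lambda1 C Lat ->
  best_ok B M U q 0 v X s ->
  exists x, [/\ ~~ inM x, stored Br (rmem s) (ireg s 12) x & q x = lam].
Proof.
move=> et t0 lt bo; have l0 := lam_gt0; have lU := lam_le_upper.
have et1 : e * t = 1 by rewrite et div1r mulVf// gt_eqF.
have H : rreg s 11 <= (1 + 0) * 1 * lam.
  apply: best_le bo _ => // z zM zl.
  have [x xX [h1 h2]] := examined_close zM zl; exists z.
  suff E : z = x by rewrite mul1r {1}E; split.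
  apply/eqP; rewrite -subr_eq0; apply/negPn/negP => d0.
  have : lambda1 C Lat <= q (z - x).
    apply: ge_inf; first by exists 0 => _ [y _ <-]; exact: gauge_ge0 Ccent _.
    exists (latpt Br (z - x)) => //; split; first by exists (z - x).
    move=> /= E; have := lattice_lower (z - x); rewrite E (gauge0 Ccent).
    rewrite pmulr_rle0 ?lower_gt0// => m0; move/eqP: d0; apply; apply: (@mabs_lt1 R).
    exact: le_lt_trans m0 ltr01.
  have h3 : e * lam <= lambda1 C Lat by rewrite -[leRHS]mul1r -et1 -mulrA ler_pM2l.
  have h4 : e / 2 * q z < e * lam.
    have -> : e * lam = e / 2 * (2 * lam) by field.
    by rewrite ltr_pM2l// divr_gt0.
  by move=> h5; have := le_lt_trans (le_trans h5 h1) (lt_le_trans h4 h3); rewrite ltxx.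
rewrite addr0 !mul1r in H.
case: bo => _ [b|[x [xM sx _ xb]]].
  by move: H; rewrite b; have := upper_gt0; lra.
exists x; split => //; apply/eqP; rewrite eq_le latt_lam_le// andbT.
by apply: le_trans H; apply: le_trans xb; rewrite le_max lexx.
Qed.

End Examined.
End LatticeSearch.

(** * List size caps and the complete search *)

Definition search_cmd (nu : cmd) : cmd :=
  Seq base_phase (Seq (levels_cmd nu) (Seq (select_cmd nu) output_cmd)).

(** 872 is the packing constant and 109 the number of cells per coordinate for the coarse nets; see
    [level_capP]. *)
Definition level_ratio {R : realType} : R := 872 * 109.

Lemma level_ratio_ge {R : realType} : 1152 <= level_ratio :> R.
Proof. by rewrite /level_ratio; lra. Qed.

Lemma level_ratio_ge0 {R : realType} : 0 <= level_ratio :> R.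
Proof. exact: le_trans (ler0n _ _) level_ratio_ge. Qed.

Section SearchCmd.
Context {R : realType} {n : nat} (oracle : 'rV[R]_n -> R) (C : set 'rV[R]_n) (r rho gamma : R).
Context (B : 'M[rat]_n) (M : 'M[R]_n).
Hypothesis n_gt0 : (0 < n)%N.
Hypothesis Cconv : convex_set (C : set (convex_lmodType 'rV[R]_n)).
Hypothesis Ccent : centered r rho C.
Hypothesis Ccpt : compact C.
Hypothesis Csym : gamma_symmetric gamma C.
Hypothesis uB : B \in unitmx.
Hypothesis rkM : (\rank M < n)%N.
Implicit Types (z x : 'rV[int]_n) (s : state R) (X : seq 'rV[int]_n).
Local Notation wp := (wp oracle).
Local Notation Br := (map_mx ratr B : 'M[R]_n).
Local Notation q := (fun z => gauge C (latpt Br z)).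
Local Notation Q := (size_bound B : R).
Local Notation U := (Q / r).
Local Notation vend := (1 / (rho * (Q * Q))).
Local Notation L := (n + n)%N.

Lemma lattice_packing (W : seq 'rV[int]_n) (b s : R) (m : nat) : uniq W -> 0 <= b -> 0 < s -> (0 < m)%N ->
  8 * (b + s) <= m%:R * s -> (forall w, w \in W -> q w <= b) ->
  {in W &, forall w w', w != w' -> s < Num.max (q (w - w')) (q (w' - w))} ->
  (size W)%:R <= 3 * (m%:R / gamma) ^+ n.
Proof.
move=> uW b0 s0 m0 mb Wb Ws.
have inj : injective (latpt Br).
  move=> z x E; apply/eqP; rewrite -subr_eq0; apply/eqP; apply: (@mabs_lt1 R).
  have := lattice_lower n_gt0 Cconv Ccent uB (z - x).
  rewrite latptD latptN E subrr (gauge0 Ccent) pmulr_rle0 ?(lower_gt0 B n_gt0 Ccent)// => H.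
  exact: le_lt_trans H ltr01.
rewrite -(size_map (latpt Br)).
apply: (packing n_gt0 Cconv Ccent Ccpt Csym _ b0 s0 m0 mb).
- by rewrite map_inj_uniq.
- by move=> _ /mapP[w wW ->]; exact: Wb.
- move=> _ _ /mapP[w wW ->] /mapP[w' wW' ->] ww.
  by rewrite -!latptN -!latptD; apply: Ws => //; apply: contra ww => /eqP->.
Qed.

Lemma gamma_gt0 : 0 < gamma. Proof. by case: Csym => /andP[]. Qed.
Lemma gamma_le1 : gamma <= 1. Proof. by case: Csym => /andP[]. Qed.

Definition level_cap := Num.truncn (3 * (level_ratio / gamma) ^+ n).
(** The 9 is the additive 8 required by the packing bound plus 1 for truncation. *)
Definition refine_factor (e : R) := (Num.truncn (level_ratio / e) + 9)%N.
Definition refine_cap (e : R) := Num.truncn (3 * ((refine_factor e)%:R / gamma) ^+ n).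

Lemma cap_ge0 (a : R) : 0 <= a -> 0 <= 3 * (a / gamma) ^+ n.
Proof. by move=> a0; rewrite mulr_ge0// exprn_ge0// divr_ge0// ltW// gamma_gt0. Qed.

Lemma cap_mono (a b : R) : 0 <= a -> a <= b -> 3 * (a / gamma) ^+ n <= 3 * (b / gamma) ^+ n.
Proof.
move=> a0 ab; have g0 := gamma_gt0; have b0 := le_trans a0 ab.
rewrite ler_pM2l//; apply: lerXn2r; rewrite ?nnegrE ?divr_ge0 ?(ltW g0)//.
by rewrite ler_pM2r ?invr_gt0.
Qed.

Lemma level_cap_le : level_cap%:R <= 3 * (level_ratio / gamma) ^+ n.
Proof. by rewrite truncn_le// cap_ge0 ?level_ratio_ge0. Qed.

Lemma ratio_div_ge0 (e : R) : 0 < e -> 0 <= level_ratio / e.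
Proof. by move=> e0; rewrite divr_ge0 ?level_ratio_ge0 ?ltW. Qed.

Lemma refine_factor_ge (e : R) : 0 < e -> level_ratio / e + 8 <= (refine_factor e)%:R.
Proof.
move=> e0; have := truncnS_gt (level_ratio / e); rewrite /refine_factor natrD -addn1 natrD.
by move: (level_ratio / e) ((Num.truncn _)%:R) => x y; lra.
Qed.

Lemma refine_cap_le (e : R) : 0 < e <= 1 -> (refine_cap e)%:R <= 3 * ((level_ratio + 9) / e / gamma) ^+ n.
Proof.
move=> /andP[e0 e1].
apply: (@le_trans _ _ (3 * ((refine_factor e)%:R / gamma) ^+ n)); first by rewrite truncn_le ?cap_ge0.
apply: cap_mono => //; rewrite /refine_factor natrD mulrDl lerD ?truncn_le ?ratio_div_ge0//.
by rewrite ler_pdivlMr// ler_piMr.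
Qed.

Lemma pow4_le_level_cap : (4 ^ n <= level_cap)%N.
Proof.
have g0 := gamma_gt0; have g1 := gamma_le1.
rewrite truncn_ge_nat ?cap_ge0 ?level_ratio_ge0//.
rewrite natrX; apply: (@le_trans _ _ ((level_ratio / gamma) ^+ n)).
  apply: lerXn2r; rewrite ?nnegrE ?divr_ge0 ?level_ratio_ge0 ?(ltW g0)// ler_pdivlMr//.
  by apply: le_trans (@level_ratio_ge R); move: gamma g0 g1 => g; lra.
by rewrite ler_peMl ?ler1n// exprn_ge0// divr_ge0 ?level_ratio_ge0// ltW.
Qed.

Lemma level_le_refine_cap (e : R) : 0 < e <= 1 -> (level_cap <= refine_cap e)%N.
Proof.
move=> /andP[e0 e1].
rewrite truncn_ge_nat ?cap_ge0//; apply: le_trans level_cap_le _.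
apply: cap_mono; rewrite ?level_ratio_ge0//; apply: le_trans (refine_factor_ge e0).
have : level_ratio <= (level_ratio / e : R) by rewrite ler_pdivlMr// ler_piMr// level_ratio_ge0.
by move: (level_ratio / e) (level_ratio) => x y; lra.
Qed.

(** With b = 3 tau and sg = tau / 9, the packing constant is 8 (3 + 1/36) 36 = 872, and 2 b / sg =
    54 gives 2 * 54 + 1 = 109 cells. *)
Lemma level_capP v l D O : 0 < v -> pruned q v (3 * tau v l) (tau v l / 9) D O -> (size O <= level_cap)%N.
Proof.
move=> v0 prO; have T0 := tau_gt0 l v0; have g0 := gamma_gt0.
rewrite truncn_ge_nat ?cap_ge0 ?level_ratio_ge0//.
have b0 : 0 <= 3 * tau v l by rewrite mulr_ge0// ltW.
have s0 : 0 < tau v l / 9 by rewrite divr_gt0.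
have m1 : 8 * (3 * tau v l + tau v l / 9 / 4) <= 872%:R * (tau v l / 9 / 4) by move: (tau v l) => x; lra.
have m2 : 2 * (3 * tau v l) <= 54%:R * (tau v l / 9) by move: (tau v l) => x; lra.
have := @pruned_size R n q gamma (latt_qD B Cconv Ccent) (latt_q0 B Ccent) lattice_packing
  v (3 * tau v l) (tau v l / 9) D O 872 54 v0 b0 s0 isT m1 m2 prO.
rewrite -mulrA -exprMn mulrAC => /le_trans; apply.
by rewrite le_eqVlt /level_ratio (_ : (54 + 54).+1%:R = 109) ?eqxx.
Qed.

(** With b = 3 tau and sg = f tau / 6, the packing constant is 288 / f + 8, and e < 4 f makes this
    at most 1152 / e + 8. Since v <= vend the norm is q, so no cells enter. *)
Lemma refine_capP e v l f D O : 0 < e -> 0 < v -> v <= vend -> e < 4 * f ->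
  pruned q v (3 * tau v l) (f * tau v l / 6) D O -> (size O <= refine_cap e)%N.
Proof.
move=> e0 v0 vv ef prO; have T0 := tau_gt0 l v0.
have f0 : 0 < f by move: ef e0; lra.
rewrite truncn_ge_nat ?cap_ge0//.
have b0 : 0 <= 3 * tau v l by rewrite mulr_ge0// ltW.
have s0 : 0 < f * tau v l / 6 by rewrite divr_gt0// mulr_gt0.
have m0 : (0 < refine_factor e)%N by rewrite /refine_factor addn_gt0 orbT.
have m1 : 8 * (3 * tau v l + f * tau v l / 6 / 2) <= (refine_factor e)%:R * (f * tau v l / 6 / 2).
  have H : 288 / f + 8 <= (refine_factor e)%:R.
    apply: le_trans (refine_factor_ge e0); rewrite lerD2r.
    apply: (@le_trans _ _ (1152 / e)); last by rewrite ler_pM2r ?invr_gt0// level_ratio_ge.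
    rewrite ler_pdivrMr// mulrAC ler_pdivlMr//.
    by move: ef e0 f0; lra.
  apply: (@le_trans _ _ ((288 / f + 8) * (f * tau v l / 6 / 2))).
    by rewrite le_eqVlt; apply/orP; left; apply/eqP; field; rewrite gt_eqF.
  by rewrite ler_wpM2r// !divr_ge0// mulr_ge0// ltW.
have vq z : v * mabs z <= q z := lattice_small n_gt0 Cconv Ccent uB z v0 vv.
exact: (pruned_size_core (latt_q0 B Ccent) lattice_packing (ltW v0) b0 s0 m0 m1 vq prO).
Qed.

Variables (e fac dl : R) (tn : nat) (nu : cmd) (J m : nat).
Hypothesis e01 : 0 < e <= 1.
Hypothesis dl01 : 0 <= dl <= 1.
Hypothesis HJ : forall k, (2 ^+ k < 4 * U / vend) = (k < J)%N.
Hypothesis Hm : forall k, (vend < U * (3 / 4) ^+ k) = (k < m)%N.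
Hypothesis nu_spec : forall s z, genv n fac (vend / 2) s -> stored Br (rmem s) (ireg s 38) z ->
  mabs z <= 3 * (3 * 2 ^+ J) :> R -> 0 <= rreg s 7 -> (ireg s 38 + (n + n) <= ireg s 39)%N ->
  wp nu s tn (fun s' => keeps s s' /\
    nrm q (rreg s 7) z <= rreg s' 39 <= (1 + dl) * nrm q (rreg s 7) z).

Definition search_time := (J * (@base_list_time n + 2) + 10 * L + 14 +
  (m * (@level_time n tn J level_cap).+1 + 2 +
  (@select_time n tn J level_cap (refine_cap e) + (10 * n + 8))))%N.

(** The last hypothesis abstracts the final argument, so the same run serves the approximate and the
    exact search. *)
Lemma wp_search (P : 'rV[int]_n -> Prop) s : stat B M e fac U vend s -> rreg s 7 = U -> heap Br [::] s ->
  (forall v X s1, 0 < v -> v <= vend -> 3 / 4 * vend <= v ->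
     (forall l, (l <= J)%N -> examined e q v X l) -> best_ok B M U q dl v X s1 ->
     exists2 x, P x & stored Br (rmem s1) (ireg s1 12) x) ->
  wp (search_cmd nu) s search_time (fun s' => exists2 x, P x & rvec s' 0 = latpt Br x).
Proof.
move=> st r7 hp HP.
have U0 : 0 < U := upper_gt0 B Ccent.
have L0 : 0 < vend := lower_gt0 B n_gt0 Ccent.
have LU : vend <= U := lower_le_upper B n_gt0 Ccent.
set v := U * (3 / 4) ^+ m.
have v0 : 0 < v by rewrite mulr_gt0// exprn_gt0// divr_gt0.
have v1 : v <= vend by rewrite leNgt Hm ltnn.
(* The descent stops at the first v <= vend, so the value before it, (4/3) v, was still above
   vend. *)
have v2 : 3 / 4 * vend <= v.
  rewrite /v; case: m Hm => [|k] Hk; first by rewrite expr0 mulr1; lra.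
  have : vend < U * (3 / 4) ^+ k by rewrite Hk.
  have -> : U * (3 / 4) ^+ k.+1 = 3 / 4 * (U * (3 / 4) ^+ k) by rewrite exprS; ring.
  by move=> H; rewrite ler_pM2l ?divr_gt0// ltW.
have [e0 e1] := andP e01.
apply: wp_seq; apply: wp_weaken (wp_base_phase oracle n_gt0 st hp HJ) (leqnn _) _.
move=> s1 [hp1 g1 f1].
have st1 : stat B M e fac U vend s1 by apply: stat_grow (heap_openE hp) (frame_le _ _ f1) g1 st.
have r17 : rreg s1 7 = U by case: f1 => _ fr _; rewrite fr.
have q0 := latt_q_ge0 B Ccent; have qD := latt_qD B Cconv Ccent; have qz := latt_q0 B Ccent.
have qU := lattice_upper B Ccent.
apply: wp_seq; apply: wp_weaken (@wp_levels _ _ oracle B M e fac U vend q _ dl tn nu J level_cap n_gt0 q0 qD qz dl01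
  nu_spec (lexx _) pow4_le_level_cap level_capP s1 m st1 hp1 r17 U0 qU Hm) (leqnn _) _.
move=> s2 [ALL [i0 [hp2 [h27 szA] nt r27 [g2 f2]]]].
have st2 : stat B M e fac U vend s2 by apply: stat_grow (heap_openE hp1) f2 g2 st1.
apply: wp_seq; apply: wp_weaken (@wp_select _ _ oracle B M e fac U vend q _ dl tn nu J level_cap (refine_cap e) v
  n_gt0 q0 qD qz dl01 nu_spec (lexx _) v0 (level_le_refine_cap e01) _ s2 ALL i0 st2 hp2 szA nt h27 r27) (leqnn _) _.
  by move=> l f D O; exact: refine_capP.
move=> s3 [X [bo ex st3]].
have [x Px sx] := HP v X s3 v0 v1 v2 ex bo.
apply: wp_weaken (wp_output oracle st3 sx) (leqnn _) _ => s4 ->.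
by exists x.
Qed.

End SearchCmd.

(** * Logarithmic bounds on the numbers of iterations *)

Lemma ln_le_subr1 {R : realType} (x : R) : 0 < x -> ln x <= x - 1.
Proof.
move=> x0; have := @le_ln1Dx R (x - 1).
by rewrite (_ : 1 + (x - 1) = x); [apply; lra | ring].
Qed.

Lemma ln_ge_1subV {R : realType} (x : R) : 0 < x -> 1 - x^-1 <= ln x.
Proof.
move=> x0; have := @ln_le_subr1 R x^-1; rewrite invr_gt0 lnV ?posrE// => /(_ x0).
by move: (ln x) x^-1 => a b; lra.
Qed.

(** 1 - 1/a bounds ln a from below, so about |ln y| / c doublings by a reach y; the least such
    exponent is the iteration count. *)
Lemma log_count {R : realType} (a y c : R) : 1 < a -> 0 < c -> c <= 1 - a^-1 -> 0 < y ->
  exists K, (forall k, (a ^+ k < y) = (k < K)%N) /\ K%:R <= `|ln y| / c + 1.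
Proof.
move=> a1 c0 ca y0; have a0 : 0 < a := lt_trans ltr01 a1.
have ca' : c <= ln a := le_trans ca (ln_ge_1subV a0).
set k0 := (Num.truncn (`|ln y| / c)).+1.
have yk0 : y <= a ^+ k0.
  rewrite -ler_ln ?posrE ?exprn_gt0// lnXn// -mulr_natl.
  have : `|ln y| / c < k0%:R by rewrite /k0; exact: truncnS_gt.
  rewrite ltr_pdivrMr// => H; apply: le_trans (ler_norm _) _; apply: le_trans (ltW H) _.
  by rewrite ler_wpM2l.
have ex : exists k, y <= a ^+ k by exists k0.
have [K yK mK] := ex_minnP ex; exists K; split.
  move=> k; rewrite ltNge; case: leqP => [Kk|kK].
    by apply/negbTE; rewrite negbK (le_trans yK)// ler_eXn2l.
  by apply/negP => /mK; rewrite leqNgt kK.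
apply: (@le_trans _ _ k0%:R); first by rewrite ler_nat mK.
rewrite /k0 -addn1 natrD lerD2r truncn_le// divr_ge0// ltW//.
Qed.

Section ParameterBounds.
Context {R : realType} {n : nat} (C : set 'rV[R]_n) (r rho : R) (B : 'M[rat]_n).
Hypothesis n_gt0 : (0 < n)%N.
Hypothesis Ccent : centered r rho C.
Local Notation Q := (size_bound B : R).
Local Notation U := (Q / r).
Local Notation vend := (1 / (rho * (Q * Q))).

Lemma sqr_lt_bitlen (z : int) : 1 + (z%:~R) ^+ 2 <= 4 ^+ bitlen z :> R.
Proof.
have : (`|z| < 2 ^ bitlen z)%N by rewrite /bitlen trunc_log_ltn.
set k := bitlen z => H.
have : (1 + `|z| ^ 2 <= 4 ^ k)%N.
  have -> : (4 ^ k = (2 ^ k) ^ 2)%N by rewrite -!expnM mulnC (expnM 2 2).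
  by move: H; move: (2 ^ k)%N (absz z) => a b; nia.
have E : z%:~R ^+ 2 = (absz z)%:R ^+ 2 :> R by rewrite natr_absz intr_norm real_normK ?num_real.
by rewrite E -(ler_nat R) natrD !natrX.
Qed.

Lemma size_bound_bitsize : Q <= 4 ^+ bitsize B.
Proof.
rewrite /size_bound /bitsize expr_sum; apply: ler_prod => i _; apply/andP; split.
  by apply: prodr_ge0 => j _; rewrite mulr_ge0// addr_ge0// sqr_ge0.
rewrite expr_sum; apply: ler_prod => j _; apply/andP; split.
  by rewrite mulr_ge0// addr_ge0// sqr_ge0.
rewrite [leRHS]exprD [X in _ <= X * _]exprD expr1; apply: (@le_trans _ _ (4 ^+ bitlen (numq (B i j)) * 4 ^+ bitlen (denq (B i j)))).
  by apply: ler_pM; rewrite ?sqr_lt_bitlen ?addr_ge0 ?sqr_ge0.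
by rewrite ler_peMr ?mulr_ge0 ?exprn_ge0// ler1n.
Qed.

(** The common yardstick in which every loop count is measured. *)
Definition log_size := n%:R + `|ln rho| + `|ln r| + (bitsize B)%:R : R.

Lemma ratio_ge1 : 1 <= U / vend.
Proof.
rewrite ler_pdivlMr ?(lower_gt0 B n_gt0 Ccent)// mul1r.
exact: (lower_le_upper B n_gt0 Ccent).
Qed.

Lemma ln4_le : ln 4 <= 3 :> R.
Proof. by apply: le_trans (ln_le_subr1 _) _ => //; lra. Qed.

(** The ratio equals Q^3 rho / r, Q is at most 4 to the bit size, and ln 4 <= 3, whence the factor 3
    * 3 = 9. *)
Lemma ln_ratio : 0 <= ln (U / vend) <= 9 * log_size.
Proof.
rewrite ln_ge0 ?ratio_ge1//=.
have Q0 := @size_bound_gt0 R n B; have r0 := inner_radius_gt0 Ccent; have rho0 := outer_radius_gt0 n_gt0 Ccent.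
have -> : U / vend = Q ^+ 3 * (rho / r) by field; rewrite !gt_eqF.
rewrite lnM ?posrE ?exprn_gt0 ?divr_gt0// ln_div ?posrE// lnXn// -[ln Q *+ _]mulr_natl.
have lQ : ln Q <= (bitsize B)%:R * 3.
  apply: (@le_trans _ _ (ln (4 ^+ bitsize B))); first by rewrite ler_ln ?posrE ?exprn_gt0// size_bound_bitsize.
  by rewrite lnXn// -[ln 4 *+ _]mulr_natl ler_wpM2l// ln4_le.
have h1 := ler_norm (ln rho); have h2 := ler_norm (- ln r); rewrite normrN in h2.
have n0 : 0 <= n%:R :> R by [].
have p1 := normr_ge0 (ln rho); have p2 := normr_ge0 (ln r).
rewrite /log_size; move: (ln Q) (`|ln rho|) (`|ln r|) (bitsize B)%:R (n%:R) lQ h1 h2 n0 p1 p2 => lq a b d e.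
by move: (ln rho) (ln r) => x y; lra.
Qed.

Lemma log_size_ge1 : 1 <= log_size.
Proof.
have : 1 <= n%:R :> R by rewrite ler1n.
by rewrite /log_size -!addrA => /le_trans; apply; rewrite lerDl !addr_ge0.
Qed.

Lemma doubling_count : exists J, (forall k, (2 ^+ k < 4 * U / vend) = (k < J)%N) /\ J%:R <= 25 * log_size.
Proof.
have h1 := ratio_ge1; have /andP[l0 l1] := ln_ratio; have l2 := log_size_ge1.
have y0 : 0 < 4 * U / vend by rewrite -mulrA mulr_gt0// (lt_le_trans ltr01).
have a1 : 1 < 2 :> R by rewrite ltr1n.
have c0 : 0 < 1 / 2 :> R by lra.
have ca : 1 / 2 <= 1 - 2^-1 :> R by lra.
have [J [HJ Jle]] := log_count a1 c0 ca y0.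
exists J; split => //; apply: le_trans Jle _.
rewrite -mulrA lnM ?posrE ?(lt_le_trans ltr01 h1)// ger0_norm; last by rewrite addr_ge0// ln_ge0// ler1n.
by move: ln4_le l1 l2; move: (ln 4) (ln (_ / _)) log_size => x y w; lra.
Qed.

Lemma level_count : exists m, (forall k, (vend < U * (3 / 4) ^+ k) = (k < m)%N) /\ m%:R <= 37 * log_size.
Proof.
have h1 := ratio_ge1; have /andP[l0 l1] := ln_ratio; have l2 := log_size_ge1.
have v0 := lower_gt0 B n_gt0 Ccent.
have y0 := lt_le_trans ltr01 h1.
have a1 : 1 < 4 / 3 :> R by lra.
have ca : 1 / 4 <= 1 - (4 / 3)^-1 :> R by rewrite invf_div; lra.
have c0 : 0 < 1 / 4 :> R by lra.
have [m [Hm mle]] := log_count a1 c0 ca y0.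
exists m; split.
  move=> k; have -> : (3 / 4) ^+ k = ((4 / 3) ^+ k)^-1 :> R by rewrite -exprVn invf_div.
  by rewrite ltr_pdivlMr ?exprn_gt0// -Hm [in RHS]ltr_pdivlMr// [in RHS]mulrC.
apply: le_trans mle _; rewrite ger0_norm//.
by move: l1 l2; move: (ln (_ / _)) log_size => y w; lra.
Qed.

(** With w = U / vend one has 2^J <= 8 w, so the largest gauge met is at most 72 U w. This is below
    (vend / 2) 4^4 w^2 = 128 U w, which determines the exponent K. *)
Lemma gauge_step_count J (e : R) : 0 < e <= 1 -> (forall k, (2 ^+ k < 4 * U / vend) = (k < J)%N) ->
  exists K, U * (3 * (3 * 2 ^+ J)) < vend / 2 * (1 + e / 4) ^+ K /\ K%:R <= 300 * (log_size / e).
Proof.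
move=> /andP[e0 e1] HJ; have h1 := ratio_ge1; have /andP[l0 l1] := ln_ratio; have l2 := log_size_ge1.
have v0 := lower_gt0 B n_gt0 Ccent; have U0 := upper_gt0 B Ccent.
have y0 := lt_le_trans ltr01 h1; set w := U / vend in h1 y0 l0 l1.
have J8 : 2 ^+ J <= 8 * w.
  case: J HJ => [|J] HJ; first by rewrite expr0; lra.
  have : 2 ^+ J < 4 * U / vend by rewrite HJ.
  by rewrite -mulrA -/w exprS; lra.
have a1 : 1 < 1 + e / 4 by rewrite ltrDl divr_gt0.
have ca : e / 5 <= 1 - (1 + e / 4)^-1.
  have -> : 1 - (1 + e / 4)^-1 = e / (4 + e) by field; rewrite !gt_eqF//; lra.
  rewrite ler_pM2l// lef_pV2 ?posrE; lra.
have e5 : 0 < e / 5 by rewrite divr_gt0.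
have z0 : 0 < 4 ^+ 4 * (w * w) by rewrite mulr_gt0 ?exprn_gt0// mulr_gt0.
have [K [HK Kle]] := log_count a1 e5 ca z0; exists K; split.
  have : 4 ^+ 4 * (w * w) <= (1 + e / 4) ^+ K by rewrite leNgt HK ltnn.
  have v20 : 0 < vend / 2 by rewrite divr_gt0.
  move=> H; apply: (@lt_le_trans _ _ (vend / 2 * (4 ^+ 4 * (w * w)))); last by rewrite ler_pM2l.
  have -> : vend / 2 * (4 ^+ 4 * (w * w)) = U * (128 * w).
    have <- : vend * w = U by rewrite /w mulrC divfK// gt_eqF.
    by move: (vend) (w) => a b; field.
  by rewrite ltr_pM2l//; lra.
apply: le_trans Kle _.
have w4 : 1 <= 4 ^+ 4 * (w * w) by apply: mulr_ege1; [rewrite exprn_ege1// ler1n | exact: mulr_ege1].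
rewrite ger0_norm; last by rewrite ln_ge0.
have -> : ln (4 ^+ 4 * (w * w)) = 4 * ln 4 + (ln w + ln w).
  rewrite lnM ?posrE ?(mulr_gt0 y0 y0) ?exprn_gt0// lnXn// [in RHS]mulr_natl.
  by congr (_ + _); rewrite lnM ?posrE.
rewrite invfM invrK.
apply: (@le_trans _ _ ((30 * log_size) * (e^-1 * 5) + log_size / e)).
  apply: lerD.
    rewrite ler_pM2r ?mulr_gt0 ?invr_gt0//.
    by move: ln4_le l1 l2; move: (ln 4) (ln w) log_size => x y u; lra.
  by rewrite ler_pdivlMr// mul1r (le_trans e1).
have : 0 < log_size / e by rewrite divr_gt0// (lt_le_trans ltr01).
have -> : 30 * log_size * (e^-1 * 5) = 150 * (log_size / e) by ring.
by move: (log_size / e) => x; lra.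
Qed.

End ParameterBounds.

(** * Total running time *)

Section TimeBound.
Implicit Types (n tn J m N X Y S : nat).

Lemma nest_le X Y S a b G : (0 < X)%N -> (0 < Y)%N -> (0 < S)%N -> (X * Y * S <= G)%N ->
  (X * (Y * (S * a + b) + 5) + 15 <= G * (a + b + 20))%N.
Proof.
move=> X0 Y0 S0 XYS.
have h1 : (X * Y <= G)%N by apply: leq_trans XYS; rewrite leq_pmulr.
have h2 : (X <= G)%N by apply: leq_trans h1; rewrite leq_pmulr.
have h3 : (1 <= G)%N := leq_trans X0 h2.
have h4 : (X * Y * S * a <= G * a)%N by rewrite leq_mul2r XYS orbT.
have h5 : (X * Y * b <= G * b)%N by rewrite leq_mul2r h1 orbT.
rewrite mulnDr !mulnA mulnDr !mulnA [X in (_ <= X)%N]mulnDr [X in (_ <= X + _)%N]mulnDr.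
move: h4 h5 h2 h3; move: (X * Y * S * a)%N (X * Y * b)%N (G * a)%N (G * b)%N => x y z w; clear; lia.
Qed.

Lemma prune_time_bound n tn N X Y S G : (n <= N)%N -> (tn <= N)%N -> (0 < N)%N ->
  (0 < X)%N -> (0 < Y)%N -> (0 < S)%N -> (X * Y * S <= G)%N -> (@prune_time n tn X Y S <= G * (146 * N))%N.
Proof.
move=> nN tN N0 X0 Y0 S0 H; apply: leq_trans (nest_le _ _ X0 Y0 S0 H) _.
by rewrite leq_mul2l; apply/orP; right; move: nN tN N0; clear; lia.
Qed.

(** Every term is first bounded in N, which dominates the loop counts, and in G = S1 S2 S2, which
    dominates each product of list sizes that occurs. It is then absorbed into G N^3. *)
Lemma total_time_bound n tn J m N S1 S2 : (n <= N)%N -> (tn <= N)%N -> (J <= N)%N -> (m <= N)%N ->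
  (0 < n)%N -> (4 ^ n <= S1)%N -> (S1 <= S2)%N ->
  (@stat_time n + 19 + (J * (@base_list_time n + 2) + 10 * (n + n) + 14 +
    (m * (@level_time n tn J S1).+1 + 2 + (@select_time n tn J S1 S2 + (10 * n + 8)))) <=
   S1 * (S2 * S2) * (3000 * (N * (N * N))))%N.
Proof.
move=> nN tN JN mN n0 S14 S12; set G := (S1 * (S2 * S2))%N.
have N0 : (0 < N)%N := leq_trans n0 nN.
have S10 : (0 < S1)%N by apply: leq_trans S14; rewrite expn_gt0.
have S20 : (0 < S2)%N := leq_trans S10 S12.
have G4 : (4 ^ n <= G)%N by apply: leq_trans S14 _; rewrite leq_pmulr// muln_gt0 S20.
have GS2 : (S2 <= G)%N by rewrite /G mulnC -mulnA leq_pmulr// muln_gt0 S20.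
have P1 : (@prune_time n tn S1 S1 S1 <= G * (146 * N))%N.
  by apply: prune_time_bound => //; rewrite -mulnA leq_mul// leq_mul.
have P2 : (@prune_time n tn S2 S1 S2 <= G * (146 * N))%N.
  by apply: prune_time_bound => //; rewrite /G mulnA (mulnC S2 S1).
apply: (@leq_trans (26 * (N * (N * N)) + 100 * (N * N) + 100 * N + 100 + 19 +
  (N * (N * (G * (20 * (N + N) + 24) + 16) + 10 * (N + N) + 20 + 2) + 10 * (N + N) + 14 +
   (N * (N * (G * (146 * N) + 10) + 10 * (N + N) + 30).+1 + 2 +
    (N.+1 * (N * (G * (146 * N) + 20) + 1 + (G * (N + 26 * (N * N) + 48 * N + 35).+1 + 20)) + 12 + (10 * N + 8))))))%N.
  rewrite /stat_time /base_list_time /level_time /select_time /refine_time /inspect_time.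
  repeat (first [done | apply: leq_add | apply: leq_mul | rewrite ltnS]).
have G1 : (1 <= G)%N := leq_trans S20 GS2.
have : (N <= N * N)%N by rewrite leq_pmulr.
have : (N * N <= N * (N * N))%N by rewrite leq_mul2l leq_pmulr// orbT.
have : (N * (N * N) <= G * (N * (N * N)))%N by rewrite leq_pmull.
have : (G * N <= G * (N * N))%N by rewrite leq_mul2l leq_pmulr// orbT.
have : (G * (N * N) <= G * (N * (N * N)))%N by rewrite leq_mul2l; apply/orP; right; rewrite leq_mul2l leq_pmulr// orbT.
have : (G <= G * N)%N by rewrite leq_pmulr.
move: N0 G1; clear; nia.
Qed.

End TimeBound.

(** A run that is correct for every tape is counted by all 2^T tapes, so its success probability is
    1. *)
Lemma computes_whp_sure {R : realType} {n : nat} (oracle : 'rV[R]_n -> R) (c : cmd)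
    (init : seq bool -> state R) (T : nat) (p : R) (good : set 'rV[R]_n) : p <= 1 ->
  (forall w, wp oracle c (init w) T (fun s => good (rvec s 0))) ->
  computes_whp oracle c init T p good.
Proof.
move=> p1 H; split => [w|].
  by have [t [s [tT ex _]]] := H w; exists t, s.
set P := [pred w : T.-tuple bool | _].
have -> : #|P| = (2 ^ T)%N.
  rewrite -card_bool -card_tuple; apply: eq_card => w; rewrite !inE.
  by apply/asboolP; have [t [s [tT ex g]]] := H w; exists t, s.
by rewrite natrX divff// expf_neq0.
Qed.

Section Caps.
Context {R : realType}.

(** The three caps contribute gamma^-3 e^-2 to the base of the power; gamma <= 1 gives gamma^-4, and
    27 <= 27^n moves the constant into the base. *)
Lemma caps_product (n : nat) (gamma e s1 s2 : R) : (0 < n)%N -> 0 < gamma <= 1 -> 0 < e ->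
  0 <= s1 <= 3 * (level_ratio / gamma) ^+ n -> 0 <= s2 <= 3 * ((level_ratio + 9) / e / gamma) ^+ n ->
  s1 * (s2 * s2) <= (27 * (level_ratio + 9) ^+ 3 * (1 / (gamma ^+ 4 * e ^+ 2))) ^+ n.
Proof.
move=> n0 /andP[g0 g1] e0 /andP[s10 s1b] /andP[s20 s2b].
have a0 := @level_ratio_ge0 R; move: (@level_ratio R) a0 s1b s2b => a a0 s1b s2b.
have a9 : 0 <= a + 9 by rewrite addr_ge0.
have b0 : 0 <= (a + 9) / gamma by rewrite divr_ge0// ltW.
have c0 : 0 <= (a + 9) / e / gamma by rewrite !divr_ge0// ltW.
have s1c : s1 <= 3 * ((a + 9) / gamma) ^+ n.
  apply: le_trans s1b _; rewrite ler_pM2l//; apply: lerXn2r; rewrite ?nnegrE ?divr_ge0 ?(ltW g0)//.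
  by rewrite ler_pM2r ?invr_gt0// lerDl.
set x := (a + 9) / gamma in b0 s1c; set y := (a + 9) / e / gamma in c0 s2b.
apply: (@le_trans _ _ (3 * x ^+ n * (3 * y ^+ n * (3 * y ^+ n)))).
  apply: ler_pM => //; first exact: mulr_ge0.
  exact: ler_pM.
have -> : 3 * x ^+ n * (3 * y ^+ n * (3 * y ^+ n)) = 27 * (x * (y * y)) ^+ n.
  by rewrite !exprMn; ring.
have xyy : 0 <= x * (y * y) := mulr_ge0 b0 (mulr_ge0 c0 c0).
apply: (@le_trans _ _ ((27 * (x * (y * y))) ^+ n)).
  rewrite [leRHS]exprMn ler_wpM2r ?exprn_ge0//.
  by rewrite -[leLHS]expr1 ler_weXn2l// ler1n.
have k0 : 0 <= 1 / (gamma ^+ 4 * e ^+ 2).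
  by rewrite divr_ge0// mulr_ge0// exprn_ge0// ltW.
have main : 27 * (x * (y * y)) <= 27 * (a + 9) ^+ 3 * (1 / (gamma ^+ 4 * e ^+ 2)).
  rewrite -mulrA ler_pM2l//.
  have -> : x * (y * y) = (a + 9) ^+ 3 * (gamma * (1 / (gamma ^+ 4 * e ^+ 2))).
    by rewrite /x /y; field; rewrite !gt_eqF.
  by rewrite ler_wpM2l ?exprn_ge0// ler_piMl.
have l0 : 0 <= 27 * (x * (y * y)) by rewrite mulr_ge0.
by apply: lerXn2r => //; rewrite nnegrE; exact: le_trans l0 main.
Qed.

End Caps.

(** * The two programs and the theorem *)

Definition approx_program : cmd := Seq setup_approx (search_cmd (nu gauge_by_membership)).
Definition exact_program : cmd := Seq setup_exact (search_cmd (nu gauge_by_value)).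

(** As x >= 2, constants are absorbed by powers of x: 2^13 covers 1 + 25 + 37 + 5500 and 2^12 covers
    3000. The exponent is 3 * 16 + 12 = 60. *)
Lemma polynomial_overhead {R : realType} (x : R) (n J m tn : nat) : 2 <= x -> n%:R <= x ->
  J%:R <= 25 * x -> m%:R <= 37 * x -> tn%:R <= 5500 * x ^+ 3 ->
  3000 * ((n + J + m + tn)%N%:R * ((n + J + m + tn)%N%:R * (n + J + m + tn)%N%:R)) <= x ^+ 60.
Proof.
move=> x2 nx Jx mx tx; have x1 : 1 <= x by apply: le_trans x2; rewrite ler1n.
have x0 : 0 <= x := le_trans ler01 x1.
set N := (n + J + m + tn)%N.
have p13 : 2 ^+ 13 <= x ^+ 13 by apply: lerXn2r; rewrite ?nnegrE.
have x3 : x <= x ^+ 3 by rewrite -[leLHS]expr1 ler_weXn2l.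
have NE : N%:R = n%:R + J%:R + m%:R + tn%:R :> R by rewrite !natrD.
have Nx : N%:R <= x ^+ 16.
  have -> : x ^+ 16 = x ^+ 13 * x ^+ 3 by rewrite -exprD.
  have y0 : 0 <= x ^+ 3 by rewrite exprn_ge0.
  apply: (@le_trans _ _ (2 ^+ 13 * x ^+ 3)); last by rewrite ler_wpM2r.
  by rewrite NE; move: nx Jx mx tx x3 y0; move: (x ^+ 3) n%:R J%:R m%:R tn%:R => a b c d f; lra.
have -> : x ^+ 60 = x ^+ 12 * (x ^+ 16 * (x ^+ 16 * x ^+ 16)) by rewrite -!exprD.
have p12 : 2 ^+ 12 <= x ^+ 12 by apply: lerXn2r; rewrite ?nnegrE.
have N0 : 0 <= N%:R :> R by [].
have NN : N%:R * (N%:R * N%:R) <= x ^+ 16 * (x ^+ 16 * x ^+ 16).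
  by apply: ler_pM; rewrite ?mulr_ge0//; apply: ler_pM.
have NN0 : 0 <= N%:R * (N%:R * N%:R) :> R by rewrite !mulr_ge0.
have c0 : 0 <= 3000 :> R := ler0n _ _.
have c1 : 3000 <= x ^+ 12 by lra.
exact: ler_pM c0 NN0 c1 NN.
Qed.

Section Programs.
Context {R : realType} {n : nat} (C : set 'rV[R]_n) (r rho gamma : R) (B : 'M[rat]_n) (M : 'M[R]_n).
Hypothesis n_gt0 : (0 < n)%N.
Hypothesis Cconv : convex_set (C : set (convex_lmodType 'rV[R]_n)).
Hypothesis Ccent : centered r rho C.
Hypothesis Ccpt : compact C.
Hypothesis Csym : gamma_symmetric gamma C.
Hypothesis uB : B \in unitmx.
Hypothesis rkM : (\rank M < n)%N.
Local Notation Br := (map_mx ratr B : 'M[R]_n).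
Local Notation q := (fun z => gauge C (latpt Br z)).
Local Notation Q := (size_bound B : R).
Local Notation U := (Q / r).
Local Notation vend := (1 / (rho * (Q * Q))).
Local Notation Lat := (lattice Br).
Local Notation lam := (lambda C Lat (rowspace M)).
Local Notation level_cap := (@level_cap R n gamma).
Local Notation refine_cap := (@refine_cap R n gamma).

Lemma run_time_bound (e x : R) (tn J m : nat) : 0 < e <= 1 -> 1 + log_size (n := n) r rho B <= x ->
  J%:R <= 25 * log_size (n := n) r rho B -> m%:R <= 37 * log_size (n := n) r rho B -> tn%:R <= 5500 * x ^+ 3 ->
  (@stat_time n + 19 + @search_time R n gamma e tn J m)%N%:R <=
    (27 * (level_ratio + 9) ^+ 3 * (1 / (gamma ^+ 4 * e ^+ 2))) ^+ n * x ^+ 60.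
Proof.
move=> e01 xl Jl ml tl; have [e0 e1] := andP e01.
set l := log_size r rho B in xl Jl ml.
have l1 : 1 <= l := log_size_ge1 r rho B n_gt0.
have nl : n%:R <= l by rewrite /l /log_size -!addrA lerDl !addr_ge0.
set N := (n + J + m + tn)%N.
have nN : (n <= N)%N by rewrite /N; clear; lia.
have tN : (tn <= N)%N by rewrite /N; clear; lia.
have JN : (J <= N)%N by rewrite /N; clear; lia.
have mN : (m <= N)%N by rewrite /N; clear; lia.
have := total_time_bound nN tN JN mN n_gt0 (pow4_le_level_cap Csym) (level_le_refine_cap Csym e01).
rewrite -/(@search_time R n gamma e tn J m) -(ler_nat R) => /le_trans; apply.
have H1 : (level_cap * (refine_cap e * refine_cap e))%N%:R <=
    (27 * (level_ratio + 9) ^+ 3 * (1 / (gamma ^+ 4 * e ^+ 2))) ^+ n :> R.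
  rewrite natrM [X in _ * X]natrM.
  by apply: (caps_product n_gt0 _ e0); rewrite ?ler0n ?(level_cap_le Csym) ?(refine_cap_le Csym)//; case: Csym.
have lx : l <= x by apply: le_trans xl; rewrite lerDr.
have H2 : (3000 * (N * (N * N)))%N%:R <= x ^+ 60.
  rewrite natrM [X in _ * X]natrM [X in _ * (_ * X)]natrM; apply: polynomial_overhead.
  - by apply: le_trans xl; move: l1; lra.
  - exact: le_trans nl lx.
  - by apply: le_trans Jl _; rewrite ler_pM2l.
  - by apply: le_trans ml _; rewrite ler_pM2l.
  - exact: tl.
rewrite natrM; exact: ler_pM (ler0n _ _) (ler0n _ _) H1 H2.
Qed.

Let envE (fac : R) s : genv n fac (vend / 2) s -> ireg s 0 = n /\ ireg s 1 = (n + n)%N.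
Proof. by case. Qed.

Lemma approx_program_correct (eps : R) : 0 < eps <= 1 / 2 ->
  exists T : nat,
    T%:R <= (27 * (level_ratio + 9) ^+ 3 * (1 / (gamma ^+ 4 * eps ^+ 2))) ^+ n
              * (1 + n%:R + `|ln rho| + `|ln r| + 1 / eps + (bitsize B)%:R) ^+ 60
    /\ computes_whp (membership_oracle C) approx_program
         (input [:: r; rho; gamma; eps] B M) T (1 - 2 ^- n)
         [set y | [/\ Lat y, ~ rowspace M y & gauge C y <= (1 + eps) * lam]].
Proof.
move=> /andP[e0 e2]; have e1 : eps <= 1 by move: e2; lra.
have e01 : 0 < eps <= 1 by rewrite e0 e1.
have [J [HJ Jl]] := doubling_count B n_gt0 Ccent.
have [m [Hm ml]] := level_count B n_gt0 Ccent.
have [K [HK Kl]] := gauge_step_count n_gt0 Ccent e01 HJ.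
have J_big : 4 * U / vend <= 2 ^+ J by rewrite leNgt HJ ltnn.
have dl0 : 0 < eps / 4 by rewrite divr_gt0.
have dl01 : 0 <= eps / 4 <= 1 by rewrite ltW//=; move: e1 e0; lra.
have vend0 := lower_gt0 B n_gt0 Ccent.
have s00 : 0 < vend / 2 by rewrite divr_gt0.
have r0 : r != 0 by rewrite gt_eqF// (inner_radius_gt0 Ccent).
(* At most K + 1 trial scales of 10 n + 8 steps each, followed by the sup norm and the
   comparison. *)
pose tn := (K.+1 * (10 * n + 8) + 14 + 12 * n + 10)%N.
have q_min z : z != 0 -> vend / 2 < q z.
  move=> z0; apply: lt_le_trans (lattice_lower n_gt0 Cconv Ccent uB z).
  have : 1 <= mabs z :> R by rewrite leNgt; apply: contra z0 => /mabs_lt1 ->.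
  by move: vend0; move: (vend) (mabs z) => a b; nra.
have q_max z : mabs z <= 3 * (3 * 2 ^+ J) :> R -> q z < vend / 2 * (1 + eps / 4) ^+ K.
  move=> zm; apply: le_lt_trans HK; apply: le_trans (lattice_upper B Ccent z) _.
  by rewrite ler_pM2l// (upper_gt0 B Ccent).
have nu_ok := wp_nu dl01 (@envE (1 + eps / 4))
  (fun s z => wp_gauge_by_membership Cconv Ccent dl0 s00 q_min q_max (s := s) (z := z)).
exists (@stat_time n + 19 + @search_time R n gamma eps tn J m)%N; split.
  have n0 : 0 <= n%:R :> R by [].
  have ie0 : 0 < 1 / eps by rewrite divr_gt0.
  set x := (X in _ * X ^+ 60).
  have xl : 1 + log_size r rho B + 1 / eps <= x.
    by rewrite /x /log_size; move: (`|ln rho|) (`|ln r|) (bitsize B)%:R n%:R (1 / eps) => a b c d f; lra.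
  have l1 := log_size_ge1 r rho B n_gt0.
  apply: run_time_bound Jl ml _ => //; first by apply: le_trans xl; rewrite lerDl ltW.
  set l := log_size r rho B in Kl xl l1.
  have x1 : 1 <= x by apply: le_trans xl; move: l1 ie0; move: (1 / eps) => a; lra.
  have nx : n%:R <= x.
    rewrite /x; have := normr_ge0 (ln rho); have := normr_ge0 (ln r); have : 0 <= (bitsize B)%:R :> R by [].
    move: ie0; move: (`|ln rho|) (`|ln r|) (bitsize B)%:R n%:R (1 / eps) => a b c d f; lra.
  have Kx : K%:R <= 300 * x ^+ 2.
    apply: le_trans Kl _; have c0 : 0 < 300 :> R by rewrite ltr0n.
    rewrite (ler_pM2l c0) expr2.
    have h1 : l <= x by apply: le_trans xl; rewrite addrAC lerDr addr_ge0 ?ltW.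
    have h2 : eps^-1 <= x by rewrite -div1r; apply: le_trans xl; rewrite lerDr addr_ge0// (le_trans ler01).
    by apply: ler_pM => //; [exact: le_trans ler01 l1 | rewrite invr_ge0 ltW].
  have -> : tn%:R = (K%:R + 1) * (10 * n%:R + 8) + 14 + 12 * n%:R + 10 :> R.
    by rewrite /tn -(addn1 K) natrD natrD natrD natrM natrD natrD natrM natrM.
  have k0 : 0 <= K%:R :> R := ler0n _ _.
  move: n%:R K%:R (x) n0 k0 x1 nx Kx => a k u a0 k0 x1 ax kx {x xl}; move: u x1 ax kx => x x1 ax kx.
  have x2 : x <= x ^+ 2 by rewrite -[leLHS]expr1 ler_weXn2l.
  have x3 : x ^+ 2 <= x ^+ 3 by rewrite ler_weXn2l.
  have H : (k + 1) * (10 * a + 8) <= (301 * x ^+ 2) * (18 * x).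
    have k1 : k + 1 <= 301 * x ^+ 2 by lra.
    have a1 : 10 * a + 8 <= 18 * x by lra.
    have k2 : 0 <= k + 1 := addr_ge0 k0 ler01.
    have a2 : 0 <= 10 * a + 8 by move: a0; lra.
    exact: ler_pM k2 a2 k1 a1.
  have E : (301 * x ^+ 2) * (18 * x) = 5418 * x ^+ 3 by rewrite [x ^+ 3]exprSr; ring.
  by move: H; rewrite E; lra.
apply: computes_whp_sure => [|w]; first by rewrite gerBl invr_ge0 exprn_ge0.
apply: wp_seq; apply: wp_weaken (wp_setup_approx (membership_oracle C) B M n_gt0 rho gamma eps w r0) (leqnn _) _.
move=> s [st r7 hp].
pose P z := ~~ (latpt Br z <= M)%MS /\ q z <= (1 + eps) * lam.
apply: wp_weaken (wp_search n_gt0 Cconv Ccent Ccpt Csym uB e01 dl01 HJ Hm nu_ok (P := P) st r7 hp _) (leqnn _) _.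
  move=> v X s1 v0 v1 v2 ex bo.
  have [x [xM sx xl]] := search_approx n_gt0 Cconv Ccent uB rkM e0 v0 v1 v2 J_big ex e2 bo.
  by exists x.
move=> s' [x [xM xl] ->]; split => //; first by exists x.
exact/negP.
Qed.

Lemma exact_program_correct (t : R) : 2 <= t -> lam <= t * lambda1 C Lat ->
  exists T : nat,
    T%:R <= (27 * (level_ratio + 9) ^+ 3 * (t ^+ 2 / gamma ^+ 4)) ^+ n
              * (1 + n%:R + `|ln rho| + `|ln r| + (bitsize B)%:R) ^+ 60
    /\ computes_whp (gauge C) exact_program
         (input [:: r; rho; gamma; t] B M) T (1 - 2 ^- n)
         [set y | [/\ Lat y, ~ rowspace M y & gauge C y = lam]].
Proof.
move=> t2 lt; have t0 : 0 < t by apply: lt_le_trans t2; rewrite ltr0n.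
set e := 1 / t; have e0 : 0 < e by rewrite divr_gt0.
have e1 : e <= 1 by rewrite ler_pdivrMr// mul1r; move: t2; lra.
have e01 : 0 < e <= 1 by rewrite e0 e1.
have [J [HJ Jl]] := doubling_count B n_gt0 Ccent.
have [m [Hm ml]] := level_count B n_gt0 Ccent.
have J_big : 4 * U / vend <= 2 ^+ J by rewrite leNgt HJ ltnn.
have dl01 : 0 <= (0 : R) <= 1 := introT andP (conj (lexx _) ler01).
have r0 : r != 0 by rewrite gt_eqF// (inner_radius_gt0 Ccent).
pose tn := (2 + 12 * n + 10)%N.
have nu_ok := wp_nu dl01 (@envE 1)
  (fun s z es sz (_ : mabs z <= 3 * (3 * 2 ^+ J) :> R) _ => wp_gauge_by_value C (Br := Br) es sz).
exists (@stat_time n + 19 + @search_time R n gamma e tn J m)%N; split.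
  have -> : t ^+ 2 / gamma ^+ 4 = 1 / (gamma ^+ 4 * e ^+ 2).
    have g0 := gamma_gt0 Csym.
    by rewrite /e; field; rewrite !gt_eqF.
  set x := (X in _ * X ^+ 60).
  have xl : 1 + log_size r rho B <= x by rewrite /x /log_size !addrA.
  apply: run_time_bound Jl ml _ => //.
  have l1 := log_size_ge1 r rho B n_gt0.
  have x1 : 1 <= x by apply: le_trans xl; move: l1; lra.
  have nx : n%:R <= x.
    rewrite /x; have := normr_ge0 (ln rho); have := normr_ge0 (ln r); have : 0 <= (bitsize B)%:R :> R by [].
    move: (`|ln rho|) (`|ln r|) (bitsize B)%:R n%:R => a b c d; lra.
  have -> : tn%:R = 2 + 12 * n%:R + 10 :> R by rewrite /tn natrD natrD natrM.
  move: n%:R (x) x1 nx => a u x1 ax {x xl}; move: u x1 ax => x x1 ax.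
  have x3 : x <= x ^+ 3 by rewrite -[leLHS]expr1 ler_weXn2l.
  lra.
apply: computes_whp_sure => [|w]; first by rewrite gerBl invr_ge0 exprn_ge0.
apply: wp_seq; apply: wp_weaken (wp_setup_exact (gauge C) B M n_gt0 rho gamma t w r0) (leqnn _) _.
move=> s [st r7 hp].
pose P z := ~~ (latpt Br z <= M)%MS /\ q z = lam.
apply: wp_weaken (wp_search n_gt0 Cconv Ccent Ccpt Csym uB e01 dl01 HJ Hm nu_ok (P := P) st r7 hp _) (leqnn _) _.
  move=> v X s1 v0 v1 v2 ex bo.
  have [x [xM sx xl]] := search_exact n_gt0 Cconv Ccent uB rkM e0 v0 v1 v2 J_big ex erefl t0 lt bo.
  by exists x.
move=> s' [x [xM xl] ->]; split => //; first by exists x.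
exact/negP.
Qed.

End Programs.

Theorem theorem6 (R : realType) :
  (exists (prog : cmd) (K : R) (d : nat), 0 < K /\
    forall (n : nat) (C : set 'rV[R]_n) (r rho gamma : R)
           (B : 'M[rat]_n) (M : 'M[R]_n) (eps : R),
      let L := lattice (map_mx ratr B) in
      convex_body C -> centered r rho C -> gamma_symmetric gamma C ->
      B \in unitmx -> (\rank M < n)%N -> 0 < eps <= 1 / 2 ->
      exists T : nat,
        T%:R <= (K * (1 / (gamma ^+ 4 * eps ^+ 2))) ^+ n
                * (1 + n%:R + `|ln rho| + `|ln r| + 1 / eps + (bitsize B)%:R) ^+ d
        /\ computes_whp (membership_oracle C) prog
             (input [:: r; rho; gamma; eps] B M) T (1 - 2 ^- n)
             [set y | [/\ L y, ~ rowspace M y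
                        & gauge C y <= (1 + eps) * lambda C L (rowspace M)]])
  /\
  (exists (prog : cmd) (K : R) (d : nat), 0 < K /\
    forall (n : nat) (C : set 'rV[R]_n) (r rho gamma : R)
           (B : 'M[rat]_n) (M : 'M[R]_n) (t : R),
      let L := lattice (map_mx ratr B) in
      convex_body C -> centered r rho C -> gamma_symmetric gamma C ->
      B \in unitmx -> (\rank M < n)%N -> 2 <= t ->
      lambda C L (rowspace M) <= t * lambda1 C L ->
      exists T : nat,
        T%:R <= (K * (t ^+ 2 / gamma ^+ 4)) ^+ n
                * (1 + n%:R + `|ln rho| + `|ln r| + (bitsize B)%:R) ^+ d
        /\ computes_whp (gauge C) prog
             (input [:: r; rho; gamma; t] B M) T (1 - 2 ^- n)
             [set y | [/\ L y, ~ rowspace M y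
                        & gauge C y = lambda C L (rowspace M)]]).
Proof.
have K0 : 0 < 27 * (level_ratio + 9) ^+ 3 :> R.
  by rewrite mulr_gt0 ?ltr0n// exprn_gt0// ltr_wpDl ?level_ratio_ge0 ?ltr0n.
split.
- exists approx_program, (27 * (level_ratio + 9) ^+ 3), 60%N; split => //.
  move=> n C r rho gamma B M eps L [Cconv Ccpt _] Ccent Csym uB rkM eps01.
  have n_gt0 : (0 < n)%N := leq_ltn_trans (leq0n _) rkM.
  exact: approx_program_correct.
- exists exact_program, (27 * (level_ratio + 9) ^+ 3), 60%N; split => //.
  move=> n C r rho gamma B M t L [Cconv Ccpt _] Ccent Csym uB rkM t2 lt.
  have n_gt0 : (0 < n)%N := leq_ltn_trans (leq0n _) rkM.
  exact: exact_program_correct.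
Qed.
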